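(* Let $q>1$ and let $u$ be a solution to $$\Delta^2 u+u^{-q}=0\quad\text{in }\mathbb{R}^3,\qquad u>0.$$ Assume that $$\beta:=\frac{1}{8\pi}\int_{\mathbb{R}^3}u^{-q}\,dx<+\infty.$$ Then, up to a rotation and translation (that is, after replacing $u$ by $x\mapsto u(Ax+x_0)$ for a suitable rotation $A$ of $\mathbb{R}^3$ and a suitable $x_0\in\mathbb{R}^3$), we have $$u(x)=(\beta+o(1))|x|+\sum_{i\in\mathcal{I}_1}a_ix_i^2+\sum_{i\in\mathcal{I}_2}b_ix_i+c,\qquad o(1)\to 0\ \text{ as } |x|\to\infty,$$ where $\mathcal{I}_1,\mathcal{I}_2\subseteq\{1,2,3\}$, $\mathcal{I}_1\cap\mathcal{I}_2=\emptyset$, $a_i>0$ for $i\in\mathcal{I}_1$, $|b_i|<\beta$ for $i\in\mathcal{I}_2$, and $c>0$.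
   Context: $\Delta^2=\Delta\Delta$ is the bi-Laplacian on $\mathbb{R}^3$. A solution is an entire positive classical solution, i.e. a function $u\in C^4(\mathbb{R}^3)$ with $u>0$ satisfying the equation pointwise on all of $\mathbb{R}^3$. The index sets $\mathcal{I}_1,\mathcal{I}_2$ may be empty. Here $x=(x_1,x_2,x_3)$. *)

(* Defs.v *)
(* Points of R^3 are column vectors. *)
From HB Require Import structures.
From mathcomp Require Import all_boot all_order all_algebra.
From mathcomp Require Import all_classical all_reals all_analysis.
Set Implicit Arguments.
Unset Strict Implicit.
Unset Printing Implicit Defensive.
Import Order.TTheory GRing.Theory Num.Theory.
Import numFieldNormedType.Exports.
Local Open Scope classical_set_scope.
Local Open Scope ring_scope.

Section Defs.
Variable R : realType.
Implicit Types (u f : 'cV[R]_3 -> R) (x : 'cV[R]_3) (A : 'M[R]_3).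

(* The library norm of a matrix is the sup norm, hence this definition. *)
Definition enorm x : R := Num.sqrt (\sum_(i < 3) x i 0 ^+ 2).

(* Neighbourhoods of infinity: the filter of the limit |x| -> +oo. *)
Definition at_infty : set_system 'cV[R]_3 :=
  filter_from [set: R] (fun M => [set x | M < enorm x]).

Definition basis_vec (i : 'I_3) : 'cV[R]_3 := delta_mx i 0.

Definition partial (i : 'I_3) f : 'cV[R]_3 -> R := fun x => 'D_(basis_vec i) f x.

(* 'D_v is total, so existence of the partial derivatives is required. *)
Fixpoint Ck (k : nat) f : Prop :=
  if k is k'.+1 then
    continuous f /\
    forall i : 'I_3,
      (forall x, derivable f x (basis_vec i)) /\ Ck k' (partial i f)
  else continuous f.

Definition laplacian f : 'cV[R]_3 -> R :=
  fun x => \sum_(i < 3) partial i (partial i f) x.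

Definition is_solution (q : R) u : Prop :=
  [/\ Ck 4 u,
      forall x, 0 < u x &
      forall x, laplacian (laplacian u) x + u x `^ (- q) = 0].

(* The library has no Lebesgue measure on column vectors; it is taken on
   R * R * R as a product measure and transported along this bijection. *)
Definition vec3 (p : R * R * R) : 'cV[R]_3 :=
  \col_(i < 3) [:: p.1.1; p.1.2; p.2]`_i.

Definition integral_R3 f : \bar R :=
  (\int[(@lebesgue_measure R \x @lebesgue_measure R) \x @lebesgue_measure R]_p
     (f (vec3 p))%:E)%E.

Definition beta (q : R) u : \bar R :=
  (((8 * pi)^-1)%:E * integral_R3 (fun x => (u x `^ (- q))%R))%E.

Definition is_rotation A : Prop := A^T *m A = 1%:M /\ \det A = 1.

End Defs.

Arguments at_infty R : clear implicits.

(* Main.v *)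
Require Import Defs.
From HB Require Import structures.
From mathcomp Require Import all_boot all_order all_algebra.
From mathcomp Require Import all_classical all_reals all_analysis.
From mathcomp Require Import measurable_realfun ring lra.
Set Implicit Arguments.
Unset Strict Implicit.
Unset Printing Implicit Defensive.
Import Order.TTheory GRing.Theory Num.Theory.
Import numFieldNormedType.Exports.
Local Open Scope classical_set_scope.
Local Open Scope ring_scope.

(** Write f for u to the power -q and v for the convolution of f with the
    kernel |x - y| - |y|, divided by 8 pi. Since |x| / (8 pi) is, up to sign,
    a fundamental solution of the bi-Laplacian, u - v should be biharmonic;
    it turns out to be a polynomial of degree at most 2, whose shape is
    restricted by u > 0 and by the integrability of f. This is reduced to
    third differences: a continuous function whose third differences vanish is
    a polynomial of degree at most 2 ([frechet]), so it is enough that u and v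
    have the same third differences.

    Equality of the third differences ([diff3_representation]) rests on three
    facts. The inequality that the bi-Laplacian of u is nonpositive forces the
    integral of u over a ball of radius L to be O(L^5) ([growth]): averages of
    u and of its Laplacian against truncated powers satisfy a differential
    system in the radius. The function sqrt(E + |x|^2) has bi-Laplacian
    - 15 E^2 (E + |x|^2)^(-7/2), an approximate identity of mass 8 pi
    ([I3_kern]). Finally, testing the equation against sqrt(E + |x - y|^2)
    truncated at distance L ([regularized_kernel]) gives u smoothed by that
    approximate identity, a truncated potential of f, and an error term
    supported at distance about L from x. The error is L^-3 times a
    profile of (y - x) / L whose derivatives are bounded independently of L,
    so a third difference in x makes it O(L^-6) pointwise and O(L^-6 L^5)
    after integration against u ([far_cvg0]).

    The potential v lies below beta |x| and is beta |x| + o(|x|), by cutting f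
    into its part near the origin and a part of small mass
    ([potential_asymptotic]). The polynomial u - v is diagonalized by a
    rotation, and a translation removes the linear terms in the directions
    where the quadratic coefficient is nonzero ([normal_form]). Suppose that
    some quadratic coefficient is negative, or zero with a linear coefficient
    b of absolute value at least beta. Then beta |x| plus the polynomial is
    bounded above on a tube around a half line ([tube]), hence so is u; hence
    f is bounded below by a positive constant on infinitely many disjoint
    boxes of the same size, against its integrability ([tube_excluded]). The
    additive constant of the polynomial is o(|x|), so it can be exchanged for
    any positive one. *)

(** * Integration over R^3 *)

Local Notation V R := 'cV[R]_3.
Local Notation mu3 R := ((@lebesgue_measure R \x @lebesgue_measure R) \x @lebesgue_measure R)%E.

Lemma sum3 (M : nmodType) (F : 'I_3 -> M) :
  \sum_(i < 3) F i = F (inord 0) + F (inord 1) + F (inord 2).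
Proof.
rewrite 3!big_ord_recr big_ord0 /= add0r.
by congr (F _ + F _ + F _); apply: val_inj; rewrite /= inordK.
Qed.

Lemma all3 (P : 'I_3 -> Prop) :
  P (inord 0) -> P (inord 1) -> P (inord 2) -> forall i, P i.
Proof.
move=> P0 P1 P2 i; rewrite -[i]inord_val.
by case: i => -[|[|[|]]].
Qed.

(** The triples carry the product sigma-algebra, so the preimage of an open
    interval is exhibited as a countable union of boxes with rational centres
    and sizes. *)
Lemma measurable_continuous_vec3 (R : realType) (F : V R -> R) : continuous F ->
  measurable_fun [set: R * R * R] (F \o @vec3 R).
Proof.
move=> cF; apply: (measurability _ (RGenOpens.measurableE R)).
move=> _ [_ [a [b ->] <-]]; rewrite setTI.
set O := [set` _].
have oO : open O by exact: interval_open.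
pose J (c r : rat) : set R := `]ratr c - ratr r, ratr c + ratr r[%classic.
pose B (q : rat * rat * rat * rat) : set (R * R * R) :=
  J q.1.1.1 q.2 `*` J q.1.1.2 q.2 `*` J q.1.2 q.2.
pose B' q := if `[< B q `<=` (F \o @vec3 R) @^-1` O >] then B q else set0.
rewrite (_ : _ @^-1` _ = \bigcup_q B' q).
  apply: countable_bigcupT_measurable; first exact: countableP.
  move=> q; rewrite /B'; case: ifP => // _.
  by apply: measurableX; [apply: measurableX|]; exact: measurable_itv.
apply/seteqP; split => [p Op|p [q _]]; last first.
  by rewrite /B'; case: asboolP => // Bq /Bq.
have /nbhs_ballP[e /= e0 eB] : nbhs (vec3 p) (F @^-1` O).
  by apply: cF; apply: open_nbhs_nbhs; split.
have e20 : 0 < e / 2 by lra.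
have [r] := @rat_in_itvoo R 0 (e / 2) e20.
rewrite in_itv /= => /andP[r0 re].
have approx (x : R) : exists c : rat, `|x - ratr c| < ratr r.
  have [|c] := @rat_in_itvoo R (x - ratr r) (x + ratr r); first by lra.
  by rewrite in_itv /= => /andP[? ?]; exists c; rewrite ltr_norml; lra.
have [c0 h0] := approx p.1.1; have [c1 h1] := approx p.1.2.
have [c2 h2] := approx p.2.
have Jp c x : `|x - ratr c| < ratr r -> J c r x.
  by rewrite /J /= in_itv /= ltr_norml => ?; lra.
have JJ c x y : `|x - ratr c| < ratr r -> J c r y -> `|x - y| < e.
  by rewrite /J /= in_itv /= !ltr_norml => ? ?; lra.
exists (c0, c1, c2, r) => //; rewrite /B' asboolT.
  by split; [split|]; exact: Jp.
move=> [[x y] z] /= [[Jx Jy] Jz]; apply: eB; split; first exact: e0.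
move=> i j; rewrite !mxE /ball /=.
by case: i => -[|[|[|//]]] /= _; [exact: (JJ c0)|exact: (JJ c1)|exact: (JJ c2)].
Qed.

Lemma integrable_bounded_support d (T : measurableType d) (R : realType)
    (mu : {measure set T -> \bar R}) (A : set T) (f : T -> R) (c : R) :
  measurable A -> (mu A < +oo)%E -> measurable_fun setT f ->
  (forall x, A x -> `|f x| <= c) -> (forall x, ~ A x -> f x = 0) ->
  mu.-integrable setT (EFin \o f).
Proof.
move=> mA muA mf fc f0.
have -> : EFin \o f = (EFin \o f) \_ A.
  apply/funext => x; rewrite patchE; case: ifPn => // /negP xA.
  by rewrite /= f0// => Ax; apply: xA; rewrite inE.
apply/integrable_restrict; [by []..|]; rewrite setTI.
apply: measurable_bounded_integrable => //; first exact: measurable_funS mf.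
by exists c; split; [exact: num_real|move=> M cM x /= Ax; rewrite (le_trans (fc _ Ax))// ltW].
Qed.

Lemma coord_le_norm (R : realType) m n (x : 'M[R]_(m, n)) i j : `|x i j| <= `|x|.
Proof.
by rewrite [leRHS]/Num.norm /= mx_normrE; apply/bigmax_geP; right => /=; exists (i, j).
Qed.

Lemma norm_le_coord (R : realType) m n (x : 'M[R]_(m, n)) c :
  0 <= c -> (forall i j, `|x i j| <= c) -> `|x| <= c.
Proof.
move=> c0 xc; rewrite [leLHS]/Num.norm /= mx_normrE; by apply/bigmax_leP.
Qed.

Lemma continuous_mx (T : topologicalType) (R : realType) m n (G : T -> 'M[R]_(m, n)) t :
  (forall i j, continuous_at t (fun t => G t i j)) -> continuous_at t G.
Proof.
move=> cG; apply/cvgrPdist_lt => /= e e0.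
have H : \forall s \near t, forall ij : 'I_m * 'I_n, `|G t ij.1 ij.2 - G s ij.1 ij.2| <= e / 2.
  apply: filter_forall => -[i j].
  by have /cvgrPdist_le := cG i j; apply; lra.
near=> s; apply: (@le_lt_trans _ _ (e / 2)); last lra.
apply: norm_le_coord; first lra.
move=> i j; rewrite !mxE.
have Hs : forall ij : 'I_m * 'I_n, `|G t ij.1 ij.2 - G s ij.1 ij.2| <= e / 2 by near: s.
exact: (Hs (i, j)).
Unshelve. all: by end_near. Qed.

(** Transposition carries the closed bounded set to a compact set of row
    vectors. *)
Lemma EVT_max_cV (R : realType) (K : set (V R)) (F : V R -> R) (M : R) :
  closed K -> K !=set0 -> (forall x, K x -> `|x| <= M) -> continuous F ->
  exists2 v, K v & forall x, K x -> F x <= F v.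
Proof.
move=> clK [x0 Kx0] KM cF.
have ctr : continuous (fun v : 'rV[R]_3 => v^T : V R).
  move=> v; apply: continuous_mx => i j.
  rewrite (_ : (fun _ => _) = (fun v : 'rV[R]_3 => v j i)); last by apply/funext => w; rewrite mxE.
  exact: coord_continuous.
pose A := [set v : 'rV[R]_3 | K v^T].
have cA : compact A.
  apply: bounded_closed_compact.
    exists M; split; first exact: num_real.
    move=> N MN v /= /KM vM; apply: le_trans (le_trans vM (ltW MN)).
    apply: norm_le_coord => // i j; rewrite -[v i j](mxE trmx_key (fun k l => v l k) j i).
    exact: (coord_le_norm v^T j i).
  by apply: (@preimage_closed _ _ (fun v : 'rV[R]_3 => v^T : V R) K) => // v _; exact: ctr.
have cG : continuous (fun v : 'rV[R]_3 => F v^T).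
  by move=> v; apply: continuous_comp; [exact: ctr|exact: cF].
have [|v Av vmax] := @EVT_max_rV R 3 _ A _ cA (continuous_subspaceT cG).
  by exists x0^T; rewrite /A /= trmxK.
exists v^T; first by rewrite inE in Av.
by move=> x Kx; have := vmax x^T; rewrite trmxK; apply; rewrite inE /A /= trmxK.
Qed.

Lemma bounded_ball_cV (R : realType) (F : V R -> R) (M : R) : continuous F ->
  exists c : R, forall x, `|x| <= M -> `|F x| <= c.
Proof.
move=> cF; have [M0|M0] := ltP M 0.
  by exists 0 => x xM; have := normr_ge0 x; lra.
have clK : closed [set x : V R | `|x| <= M].
  apply: (@preimage_closed _ _ (fun x : V R => `|x|) [set r : R | r <= M]); last exact: closed_le.
  by move=> x _; exact: norm_continuous.
have cG : continuous (fun x => `|F x|).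
  by move=> x; apply: continuous_comp; [exact: cF|exact: norm_continuous].
have [|//|v _ vmax] := EVT_max_cV clK _ (M := M) _ cG; first by exists 0; rewrite /= normr0.
by exists `|F v| => x; exact: vmax.
Qed.

Definition csupp (R : realType) (F : V R -> R) := exists M : R, forall x, M < `|x| -> F x = 0.
Definition int3 (R : realType) (F : V R -> R) := (mu3 R).-integrable setT (EFin \o (F \o @vec3 R)).
Definition I3 (R : realType) (F : V R -> R) : R := \int[mu3 R]_p F (vec3 p).

Lemma coord_vec3_le (R : realType) (p : R * R * R) :
  [/\ `|p.1.1| <= `|vec3 p|, `|p.1.2| <= `|vec3 p| & `|p.2| <= `|vec3 p|].
Proof.
by split; [have := coord_le_norm (vec3 p) (inord 0) 0|
  have := coord_le_norm (vec3 p) (inord 1) 0|have := coord_le_norm (vec3 p) (inord 2) 0];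
  rewrite mxE inordK.
Qed.

Lemma itv_ball_measure (R : realType) (x M : R) : 0 <= M ->
  lebesgue_measure (`[x - M, x + M]%classic : set R) = (2 * M)%:E.
Proof.
move=> M0; rewrite lebesgue_measure_itv /= lte_fin; case: ifP => [_|/negbT MM].
  by rewrite -EFinD; congr EFin; ring.
by congr EFin; move: MM; rewrite -leNgt; lra.
Qed.

Definition box (R : realType) (a b c M : R) : set (R * R * R) :=
  `[a - M, a + M]%classic `*` `[b - M, b + M]%classic `*` `[c - M, c + M]%classic.

Lemma measurable_box (R : realType) (a b c M : R) : measurable (box a b c M).
Proof. by apply: measurableX; [apply: measurableX|]; exact: measurable_itv. Qed.

Lemma mu3_box (R : realType) (a b c M : R) : 0 <= M ->
  mu3 R (box a b c M) = ((2 * M) ^+ 3)%:E.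
Proof.
move=> M0.
have len (x : R) := itv_ball_measure x M0.
rewrite product_measure1E//; last exact: measurableX.
have mI (x : R) : measurable (`[x - M, x + M]%classic : set R) by exact: measurable_itv.
have E2 := @product_measure1E _ _ _ _ R (@lebesgue_measure R) (@lebesgue_measure R) _ _ (mI a) (mI b).
apply: (etrans (congr2 mule (etrans E2 (congr2 mule (len a) (len b))) (len c))).
by rewrite -!EFinM; congr EFin; ring.
Qed.

Lemma int3_csupp (R : realType) (F : V R -> R) : continuous F -> csupp F -> int3 F.
Proof.
move=> cF [M F0].
have [c Fc] := bounded_ball_cV `|M| cF.
apply: (@integrable_bounded_support _ _ _ (mu3 R) (box 0 0 0 `|M|) _ c).
- exact: measurable_box.
- by rewrite [ltLHS](mu3_box 0 0 0 (normr_ge0 M)) ltry.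
- exact: measurable_continuous_vec3.
- move=> [[x y] z] [[]] /=; rewrite !in_itv /= !sub0r !add0r -!ler_norml => hx hy hz.
  apply: Fc; apply: norm_le_coord => // i j; rewrite mxE.
  by case: i => -[|[|[|//]]].
- move=> p np; apply: F0; rewrite ltNge; apply/negP => pM; apply: np.
  have [h1 h2 h3] := coord_vec3_le p.
  have h : `|vec3 p| <= `|M| by rewrite (le_trans pM)// ler_norm.
  by split; [split|]; rewrite /= in_itv /= sub0r add0r -ler_norml; exact: le_trans h.
Qed.

Lemma int3_le (R : realType) (F G : V R -> R) : continuous F ->
  (forall x, `|F x| <= G x) -> int3 G -> int3 F.
Proof.
move=> cF FG; apply: le_integrable => //; first by apply/measurable_EFinP; exact: measurable_continuous_vec3.
by move=> p _ /=; rewrite lee_fin (le_trans (FG _))// ler_norm.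
Qed.

Lemma int3D (R : realType) (F G : V R -> R) : int3 F -> int3 G -> int3 (fun x => F x + G x).
Proof.
by move=> iF iG; exact: (integrableD measurableT iF iG).
Qed.

Lemma int3B (R : realType) (F G : V R -> R) : int3 F -> int3 G -> int3 (fun x => F x - G x).
Proof.
by move=> iF iG; exact: (integrableB measurableT iF iG).
Qed.

Lemma int3Z (R : realType) (F : V R -> R) k : int3 F -> int3 (fun x => k * F x).
Proof.
by move=> iF; exact: (integrableZl measurableT k iF).
Qed.

Lemma I3D (R : realType) (F G : V R -> R) : int3 F -> int3 G ->
  I3 (fun x => F x + G x) = I3 F + I3 G.
Proof. by move=> iF iG; rewrite /I3 RintegralD. Qed.

Lemma I3B (R : realType) (F G : V R -> R) : int3 F -> int3 G ->
  I3 (fun x => F x - G x) = I3 F - I3 G.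
Proof. by move=> iF iG; rewrite /I3 RintegralB. Qed.

Lemma I3Z (R : realType) (F : V R -> R) k : int3 F ->
  I3 (fun x => k * F x) = k * I3 F.
Proof. by move=> iF; rewrite /I3 RintegralZl. Qed.

Lemma I3_le (R : realType) (F G : V R -> R) : int3 F -> int3 G ->
  (forall x, F x <= G x) -> I3 F <= I3 G.
Proof. by move=> iF iG FG; apply: le_Rintegral. Qed.

Lemma I3_ge0 (R : realType) (F : V R -> R) : (forall x, 0 <= F x) -> 0 <= I3 F.
Proof. by move=> F0; apply: Rintegral_ge0. Qed.

Lemma I3_norm_le (R : realType) (F G : V R -> R) : continuous F -> int3 G ->
  (forall x, `|F x| <= G x) -> `|I3 F| <= I3 G.
Proof.
move=> cF iG FG; have iF := int3_le cF FG iG.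
rewrite (le_trans (le_normr_Rintegral _ iF))//.
exact: (le_Rintegral measurableT (integrable_norm iF) iG (fun p _ => FG (vec3 p))).
Qed.

Lemma I3_EFin (R : realType) (F : V R -> R) : int3 F ->
  (\int[mu3 R]_p (F (vec3 p))%:E)%E = (I3 F)%:E.
Proof. by move=> iF; rewrite /I3 /Rintegral fineK//; exact: integrable_fin_num. Qed.

Lemma I3_dominated_cvg (R : realType) (F_ : nat -> V R -> R) (F G : V R -> R) :
  (forall n, continuous (F_ n)) -> continuous F -> int3 G ->
  (forall n x, `|F_ n x| <= G x) -> (forall x, F_ n x @[n --> \oo] --> F x) ->
  I3 (F_ n) @[n --> \oo] --> I3 F.
Proof.
move=> cF_ cF iG F_G FF.
have FG' x : `|F x| <= G x.
  apply: (cvgr_to_le (cvg_norm (FF x))); exact: nearW.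
have iF : int3 F by exact: int3_le FG' iG.
have iF_ n : int3 (F_ n) by exact: int3_le (F_G n) iG.
rewrite /I3 /Rintegral; apply: fine_cvg; rewrite fineK; last by exact: integrable_fin_num.
have H := @dominated_cvg _ _ _ (mu3 R) setT measurableT (fun n p => (F_ n (vec3 p))%:E) (fun p => (F (vec3 p))%:E) (fun p => (G (vec3 p))%:E).
apply: H.
- by move=> n; apply/measurable_EFinP; exact: measurable_continuous_vec3.
- by move=> p _; apply: cvg_EFin; [exact: nearW|exact: FF].
- by [].
- exact: iG.
- by move=> n p _; rewrite lee_fin.
Qed.

Lemma line_is_derive (R : realType) (f : V R -> R) (x v : V R) s d :
  is_derive (x + s *: v) v f d -> is_derive s 1 (fun s => f (x + s *: v)) d.
Proof.
move=> [df fd].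
have E : (fun h : R => h^-1 *: (f (x + (h *: 1 + s) *: v) - f (x + s *: v))) =
         (fun h : R => h^-1 *: (f (h *: v + (x + s *: v)) - f (x + s *: v))).
  by apply/funext => h; have -> : x + (h *: (1 : R) + s) *: v = h *: v + (x + s *: v) by rewrite [h *: _]mulr1 scalerDl addrCA.
by split; [rewrite /derivable|move: fd; rewrite /derive]; rewrite /= E.
Qed.

(** The fundamental theorem of calculus between two points outside the
    support. *)
Lemma integral_derive0 (R : realType) (f df : R -> R) (M : R) :
  (forall s : R, is_derive s 1 f (df s)) -> continuous df ->
  (forall s, M < `|s| -> f s = 0) -> (forall s, M < `|s| -> df s = 0) ->
  (\int[@lebesgue_measure R]_s (df s)%:E = 0)%E.
Proof.
move=> fd cdf f0 df0.
pose N : R := `|M| + 1.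
have N0 : 0 < N by rewrite /N; have := normr_ge0 M; lra.
have MN : M < `|N| by rewrite gtr0_norm// /N; have := ler_norm M; lra.
have -> : (\int[@lebesgue_measure R]_s (df s)%:E = \int[@lebesgue_measure R]_(s in `[(- N)%R, N%R]) (df s)%:E)%E.
  rewrite [RHS]integral_mkcond; apply: eq_integral => s _.
  rewrite patchE; case: ifPn => // /negP sN; rewrite df0// ltNge; apply/negP => sM.
  apply: sN; rewrite inE /= in_itv /= -ler_norml (le_trans sM)//.
  by have := ler_norm M; rewrite /N; lra.
rewrite (@continuous_FTC2 _ _ f).
- by rewrite !f0// ?normrN// -EFinD subrr.
- by lra.
- exact: continuous_subspaceT.
- have cf : continuous f.
    by move=> s; apply: differentiable_continuous; apply/derivable1_diffP; have [] := fd s.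
  split.
  + by move=> s _; have [] := fd s.
  + by apply: cvg_at_right_filter; exact: cf.
  + by apply: cvg_at_left_filter; exact: cf.
- by move=> s _; rewrite derive1E; have [] := fd s.
Qed.

Lemma vec3_lines (R : realType) (x y z : R) :
  [/\ vec3 (x, y, z) = vec3 (0, y, z) + x *: basis_vec R (inord 0),
      vec3 (x, y, z) = vec3 (x, 0, z) + y *: basis_vec R (inord 1) &
      vec3 (x, y, z) = vec3 (x, y, 0) + z *: basis_vec R (inord 2)].
Proof.
split; apply/matrixP => i j; rewrite ord1 !mxE; move: i; apply: all3;
  rewrite -?val_eqE /= ?inordK //=; ring.
Qed.

Section PlaneMeasure.
Variable R : realType.

(** The product measure needs a name to carry the sigma-finiteness that
    Fubini's theorem on triples asks of its first factor. *)
Definition lam2 := (@lebesgue_measure R \x @lebesgue_measure R)%E.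
HB.instance Definition _ := Measure.on lam2.

Let J (n : nat) : set R := `[0 - n%:R, 0 + n%:R]%classic.

Lemma lam2_square (n : nat) : lam2 (J n `*` J n) = ((2 * n%:R) * (2 * n%:R))%:E.
Proof.
have len : lebesgue_measure (J n) = (2 * n%:R)%:E by apply: itv_ball_measure.
have mI : measurable (J n) by exact: measurable_itv.
have E2 := @product_measure1E _ _ _ _ R (@lebesgue_measure R) (@lebesgue_measure R) _ _ mI mI.
by apply: (etrans (etrans E2 (congr2 mule len len))); rewrite EFinM.
Qed.

Lemma sigma_finite_lam2 : sigma_finite setT lam2.
Proof.
exists (fun n => J n `*` J n).
  apply/esym/seteqP; split => // -[x y] _.
  pose n := (Num.trunc (Num.max `|x| `|y|)).+1.
  have : Num.max `|x| `|y| < n%:R by apply: truncnS_gt.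
  rewrite gt_max => /andP[xn yn]; exists n => //=.
  by split; rewrite /J /= in_itv /= sub0r add0r -ler_norml ltW.
move=> n; split; first by apply: measurableX; exact: measurable_itv.
by rewrite lam2_square ltry.
Qed.
HB.instance Definition _ := Measure_isSigmaFinite.Build _ _ _ lam2 sigma_finite_lam2.
End PlaneMeasure.
Arguments lam2 R : clear implicits.

(** One component of the divergence theorem: by Fubini's theorem the innermost
    integral can be taken along the direction [i], where the integrand is the
    derivative of a function with bounded support. *)
Lemma I3_partial_eq0 (R : realType) (i : 'I_3) (F dF : V R -> R) :
  (forall x, is_derive x (basis_vec R i) F (dF x)) -> continuous dF ->
  csupp F -> csupp dF -> I3 dF = 0.
Proof.
move=> FdF cdF [M F0] sdF; have [M' dF0] := sdF.
have idF := int3_csupp cdF sdF.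
pose N := Num.max M M'.
have {}F0 x : N < `|x| -> F x = 0 by move=> h; apply: F0; apply: le_lt_trans h; rewrite le_max lexx.
have {}dF0 x : N < `|x| -> dF x = 0 by move=> h; apply: dF0; apply: le_lt_trans h; rewrite le_max lexx orbT.
have line (a : V R) (c : R -> V R) : (forall s, c s = a + s *: basis_vec R i) ->
    (forall s, `|s| <= `|c s|) -> (\int[@lebesgue_measure R]_s (dF (c s))%:E = 0)%E.
  move=> ca cs; apply: (@integral_derive0 _ (fun s => F (c s)) _ N).
  - move=> s; have -> : (fun s => F (c s)) = (fun s => F (a + s *: basis_vec R i)).
      by apply/funext => s'; rewrite ca.
    by rewrite ca; apply: line_is_derive.
  - move=> s; apply: continuous_comp; last exact: cdF.
    rewrite (_ : c = (fun s => a + s *: basis_vec R i)); last exact/funext.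
    by apply: cvgD; [exact: cvg_cst|apply: cvgZr_tmp; exact: cvg_id].
  - by move=> s Ns; rewrite F0// (lt_le_trans Ns).
  - by move=> s Ns; rewrite dF0// (lt_le_trans Ns).
have [c dFc] := bounded_ball_cV `|N| cdF.
have islice (z : R) : ((@lebesgue_measure R) \x (@lebesgue_measure R))%E.-integrable setT
    (fun p : R * R => (dF (vec3 (p, z)))%:E).
  pose A : set (R * R) := `[(- `|N|), `|N|]%classic `*` `[(- `|N|), `|N|]%classic.
  have mA : measurable A by apply: measurableX; exact: measurable_itv.
  have AN (p : R * R) : A p <-> `|p.1| <= `|N| /\ `|p.2| <= `|N|.
    by rewrite /A; split => -[]; rewrite /= !in_itv /= -!ler_norml.
  apply: (@integrable_bounded_support _ _ R ((@lebesgue_measure R) \x (@lebesgue_measure R))%E A (fun p : R * R => dF (vec3 (p, z))) `|c|) => //.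
  - rewrite [ltLHS]product_measure1E//= !lebesgue_measure_itv /= !lte_fin; case: ifP => _; rewrite ?mul0e// -?EFinD -?EFinM ltry//.
  - exact: (measurableT_comp (measurable_continuous_vec3 cdF) (measurable_pair2 z)).
  - move=> p /AN[p1 p2]; have [zN|zN] := leP `|z| `|N|.
      apply: (le_trans (dFc _ _)); last exact: ler_norm.
      apply: norm_le_coord => // i' j; rewrite mxE; move: i'.
      by apply: all3; rewrite inordK.
    rewrite dF0 ?normr0//.
    have [_ _ /=] := coord_vec3_le (p, z); apply: lt_le_trans; apply: le_lt_trans zN; exact: ler_norm.
  - move=> p nA; apply: dF0; rewrite ltNge; apply/negP => pN; apply: nA; apply/AN.
    have [/= h1 h2 _] := coord_vec3_le (p, z); have := ler_norm N; split; lra.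
rewrite /I3 /Rintegral; apply/eqP; rewrite -[0]/(fine 0%E); apply/eqP; congr fine.
move: i FdF line; apply: all3 => FdF line.
- apply: (etrans (esym (@integral21_prod_meas1 _ _ _ _ R (lam2 R) (@lebesgue_measure R) (fun p : R * R * R => (dF (vec3 p))%:E) idF))); apply: integral0_eq => z _.
  apply: (etrans (esym (@integral21_prod_meas1 _ _ _ _ R (@lebesgue_measure R) (@lebesgue_measure R) (fun p : R * R => (dF (vec3 (p, z)))%:E) (islice z)))); apply: integral0_eq => y _.
  apply: (line (vec3 (0, y, z)) (fun x => vec3 (x, y, z))) => x; first by have [] := vec3_lines x y z.
  by have [] := coord_vec3_le (x, y, z).
- apply: (etrans (esym (@integral21_prod_meas1 _ _ _ _ R (lam2 R) (@lebesgue_measure R) (fun p : R * R * R => (dF (vec3 p))%:E) idF))); apply: integral0_eq => z _.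
  apply: (etrans (esym (@integral12_prod_meas1 _ _ _ _ R (@lebesgue_measure R) (@lebesgue_measure R) (fun p : R * R => (dF (vec3 (p, z)))%:E) (islice z)))); apply: integral0_eq => x _.
  apply: (line (vec3 (x, 0, z)) (fun y => vec3 (x, y, z))) => y; first by have [] := vec3_lines x y z.
  by have [] := coord_vec3_le (x, y, z).
- apply: (etrans (esym (@integral12_prod_meas1 _ _ _ _ R (lam2 R) (@lebesgue_measure R) (fun p : R * R * R => (dF (vec3 p))%:E) idF))); apply: integral0_eq => -[x y] _.
  apply: (line (vec3 (x, y, 0)) (fun z => vec3 (x, y, z))) => z; first by have [] := vec3_lines x y z.
  by have [] := coord_vec3_le (x, y, z).
Qed.

(** * Pointwise calculus and the squared distance *)

Lemma line_is_deriveP (R : realType) (f : V R -> R) (x v : V R) (d : R) :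
  is_derive (0 : R) 1 (fun s => f (x + s *: v)) d -> is_derive x v f d.
Proof.
move=> [df fd].
have E : (fun h : R => h^-1 *: (f (x + (h *: (1 : R) + 0) *: v) - f (x + (0 : R) *: v))) =
         (fun h : R => h^-1 *: (f (h *: v + x) - f x)).
  apply/funext => h; rewrite scale0r !addr0.
  by have -> : x + (h *: (1 : R)) *: v = h *: v + x by rewrite [h *: _]mulr1 addrC.
by split; [move: df; rewrite /derivable|move: fd; rewrite /derive]; rewrite /= E.
Qed.

Section PointwiseDerivatives.
Variables (R : realType) (W : normedModType R).
Implicit Types (f g : W -> R) (x v : W) (df dg k : R).

Lemma isdC k x v : is_derive x v (fun _ => k) (0 : R).
Proof. exact: is_derive_cst. Qed.

Lemma isdD f g x v df dg : is_derive x v f df -> is_derive x v g dg ->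
  is_derive x v (fun y => f y + g y) (df + dg).
Proof. by move=> ? ?; exact: is_deriveD. Qed.

Lemma isdB f g x v df dg : is_derive x v f df -> is_derive x v g dg ->
  is_derive x v (fun y => f y - g y) (df - dg).
Proof. by move=> ? ?; exact: is_deriveB. Qed.

Lemma isdM f g x v df dg : is_derive x v f df -> is_derive x v g dg ->
  is_derive x v (fun y => f y * g y) (df * g x + f x * dg).
Proof.
by move=> fd gd; apply: (is_derive_eq (is_deriveM fd gd)); rewrite addrC; congr (_ + _); rewrite [LHS]mulrC.
Qed.

Lemma isdZ f x v df k : is_derive x v f df -> is_derive x v (fun y => k * f y) (k * df).
Proof. by move=> ?; exact: is_deriveZ. Qed.

Lemma isdX f x v df n : is_derive x v f df ->
  is_derive x v (fun y => f y ^+ n) (n%:R * f x ^+ n.-1 * df).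
Proof. by move=> fd; have := is_deriveX n fd; rewrite exprfctE. Qed.

End PointwiseDerivatives.

Lemma isdI (R : realType) (x : R) : is_derive x 1 (fun y : R => y) 1.
Proof. exact: is_derive_id. Qed.

Lemma isdV (R : realType) (x : R) : x != 0 -> is_derive x 1 (fun y : R => y^-1) (- x ^- 2).
Proof.
move=> x0; apply: (is_derive_eq (is_deriveV x0 (is_derive_id x 1))).
by rewrite scaler1.
Qed.

Lemma isd_comp (R : realType) (f g : R -> R) (x df dg : R) :
  is_derive x 1 g dg -> is_derive (g x) 1 f df ->
  is_derive x 1 (fun y => f (g y)) (df * dg).
Proof. by move=> ? ?; exact: is_derive1_comp. Qed.

Lemma isd_continuous (R : realType) (f : R -> R) (x df : R) :
  is_derive x 1 f df -> continuous_at x f.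
Proof. by move=> [d _]; apply: differentiable_continuous; apply/derivable1_diffP. Qed.

Section PointwiseContinuity.
Variables (R : realType) (T : topologicalType).
Implicit Types (f g : T -> R) (x : T).

Lemma ctC k x : continuous_at x (fun _ : T => k : R).
Proof. exact: cst_continuous. Qed.

Lemma ctD f g x : continuous_at x f -> continuous_at x g ->
  continuous_at x (fun y => f y + g y).
Proof. by move=> cf cg; apply: cvgD; [exact: cf|exact: cg]. Qed.

Lemma ctB f g x : continuous_at x f -> continuous_at x g ->
  continuous_at x (fun y => f y - g y).
Proof. by move=> cf cg; apply: cvgB; [exact: cf|exact: cg]. Qed.

Lemma ctM f g x : continuous_at x f -> continuous_at x g ->
  continuous_at x (fun y => f y * g y).
Proof. by move=> cf cg; apply: cvgM; [exact: cf|exact: cg]. Qed.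

Lemma ctZ k f x : continuous_at x f -> continuous_at x (fun y => k * f y).
Proof. by apply: ctM; exact: cvg_cst. Qed.

Lemma ctX n f x : continuous_at x f -> continuous_at x (fun y => f y ^+ n).
Proof.
move=> cf; apply: (@continuous_comp _ _ _ f (fun r => r ^+ n)) => //.
exact: exprn_continuous.
Qed.

Lemma ct_comp (h : R -> R) f x : continuous_at x f -> continuous_at (f x) h ->
  continuous_at x (fun y => h (f y)).
Proof. by move=> cf ch; exact: continuous_comp. Qed.

End PointwiseContinuity.

Lemma ctI (R : realType) (x : R) : continuous_at x (fun y : R => y).
Proof. exact: cvg_id. Qed.

(** Radial functions are written as functions of the squared distance, which
    is a polynomial, so that the centre is not a special point. *)
Definition sq (R : realType) (x : V R) : R := \sum_(i < 3) x i 0 ^+ 2.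

Section SquaredDistance.
Variable R : realType.
Implicit Types (x y c : V R) (i : 'I_3).

Lemma sqE x : sq x = x (inord 0) 0 ^+ 2 + x (inord 1) 0 ^+ 2 + x (inord 2) 0 ^+ 2.
Proof. by rewrite /sq sum3. Qed.

Lemma sq_ge0 x : 0 <= sq x.
Proof. by apply: sumr_ge0 => i _; exact: sqr_ge0. Qed.

Lemma coord_sq_le x i : x i 0 ^+ 2 <= sq x.
Proof. by rewrite /sq (bigD1 i)//= lerDl sumr_ge0// => j _; exact: sqr_ge0. Qed.

Lemma enorm_sq x : enorm x = Num.sqrt (sq x).
Proof. by []. Qed.

Lemma enorm_ge0 x : 0 <= enorm x.
Proof. exact: sqrtr_ge0. Qed.

Lemma sqr_enorm x : enorm x ^+ 2 = sq x.
Proof. by rewrite sqr_sqrtr// sq_ge0. Qed.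

Lemma norm_le_enorm x : `|x| <= enorm x.
Proof.
apply: norm_le_coord; first exact: enorm_ge0.
by move=> i j; rewrite ord1 -sqrtr_sqr ler_wsqrtr// coord_sq_le.
Qed.

Lemma sq_sub_continuous c : continuous (fun y => sq (y - c)).
Proof.
move=> y; rewrite (_ : (fun y => _) = (fun y => (y (inord 0) 0 - c (inord 0) 0) ^+ 2 +
  (y (inord 1) 0 - c (inord 1) 0) ^+ 2 + (y (inord 2) 0 - c (inord 2) 0) ^+ 2)); last first.
  by apply/funext => z; rewrite sqE !mxE.
have cc i : continuous_at y (fun y : V R => (y i 0 - c i 0) ^+ 2).
  by apply: ctX; apply: ctB; [exact: coord_continuous|exact: ctC].
by apply: ctD; [apply: ctD|]; exact: cc.
Qed.

Lemma sq_sub_is_derive c x i :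
  is_derive x (basis_vec R i) (fun y => sq (y - c)) (2 * (x i 0 - c i 0)).
Proof.
apply: line_is_deriveP.
rewrite (_ : (fun s => _) = (fun s : R => sq (x - c) + (s * (2 * (x i 0 - c i 0)) + s ^+ 2))); last first.
  apply/funext => s; move: i; apply: all3; rewrite !sqE !mxE -?val_eqE /= ?inordK //=; ring.
apply: (is_derive_eq (isdD (isdC _ _ _) (isdD (isdM (isdI _) (isdC _ _ _)) (isdX 2 (isdI _))))).
by rewrite /=; ring.
Qed.

Lemma radial_is_derive (g : R -> R) c x i dg :
  is_derive (sq (x - c)) 1 g dg ->
  is_derive x (basis_vec R i) (fun y => g (sq (y - c))) (dg * (2 * (x i 0 - c i 0))).
Proof.
move=> gd; apply: line_is_deriveP.
have H := @line_is_derive R (fun y => sq (y - c)) x (basis_vec R i) 0.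
apply: (@isd_comp _ g (fun s : R => sq (x + s *: basis_vec R i - c))); last by rewrite scale0r addr0.
by apply: H; rewrite scale0r addr0; exact: sq_sub_is_derive.
Qed.

End SquaredDistance.

(** * Green's identities against radial functions *)

Section Green.
Variable R : realType.
Implicit Types (T : R) (w u : V R -> R) (g : R -> R) (c x y : V R) (i : 'I_3).

Lemma Ck_continuous n w : Ck n w -> continuous w.
Proof. by case: n => // n []. Qed.

Lemma Ck_derivable n w i x : Ck n.+1 w -> is_derive x (basis_vec R i) w (partial i w x).
Proof. by move=> [_ /(_ i)[dw _]]; apply: derivableP; exact: dw. Qed.

Lemma Ck_partial n w i : Ck n.+1 w -> Ck n (partial i w).
Proof. by move=> [_ /(_ i)[]]. Qed.

Lemma Ck_weaken n w : Ck n.+1 w -> Ck n w.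
Proof.
elim: n w => [|n IH] w; first by move=> [].
by move=> [cw Cw]; split => // i; have [dw Cpw] := Cw i; split => //; exact: IH.
Qed.

Lemma Ck_add n w1 w2 : Ck n w1 -> Ck n w2 -> Ck n (fun x => w1 x + w2 x).
Proof.
elim: n w1 w2 => [|n IH] w1 w2; first by move=> c1 c2 x; apply: ctD; [exact: c1|exact: c2].
move=> C1 C2; split.
  by move=> x; apply: ctD; [exact: (Ck_continuous C1)|exact: (Ck_continuous C2)].
have D i x := isdD (Ck_derivable i x C1) (Ck_derivable i x C2).
move=> i; split; first by move=> x; have [] := D i x.
rewrite (_ : partial i _ = fun x => partial i w1 x + partial i w2 x); first by apply: IH; apply: Ck_partial.
by apply/funext => x; have [_] := D i x.
Qed.

Lemma Ck_laplacian n w : Ck n.+2 w -> Ck n (laplacian w).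
Proof.
move=> Cw; rewrite (_ : laplacian w = fun x => partial (inord 0) (partial (inord 0) w) x +
    partial (inord 1) (partial (inord 1) w) x + partial (inord 2) (partial (inord 2) w) x).
  by apply: Ck_add; [apply: Ck_add|]; apply: Ck_partial; exact: Ck_partial.
by apply/funext => x; rewrite /laplacian sum3.
Qed.

Lemma radial_continuous g c : (forall t : R, 0 <= t -> continuous_at t g) ->
  continuous (fun y => g (sq (y - c))).
Proof.
move=> cg y; apply: (@ct_comp _ _ g (fun y => sq (y - c))); first exact: sq_sub_continuous.
by apply: cg; exact: sq_ge0.
Qed.

Lemma sq_sub_large T c : exists M : R, forall y, M < `|y| -> T < sq (y - c).
Proof.
exists (`|c| + `|T| + 1) => y yM.
have h1 : `|y| <= `|y - c| + `|c| by have := ler_normD (y - c) c; rewrite subrK.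
have h2 := norm_le_enorm (y - c); have h3 := sqr_enorm (y - c).
have h4 := ler_norm T; have h5 := normr_ge0 T.
rewrite -h3; nra.
Qed.

Lemma radial_csupp g c T w : (forall t : R, T < t -> g t = 0) ->
  csupp (fun y => w y * g (sq (y - c))).
Proof.
move=> g0; have [M HM] := sq_sub_large T c.
by exists M => y /HM /g0 ->; rewrite mulr0.
Qed.

Lemma int3_radial g c T w : continuous w -> (forall t : R, 0 <= t -> continuous_at t g) ->
  (forall t : R, T < t -> g t = 0) -> int3 (fun y => w y * g (sq (y - c))).
Proof.
move=> cw cg g0; apply: int3_csupp; last exact: radial_csupp g0.
by move=> y; apply: ctM; [exact: cw|exact: radial_continuous].
Qed.

(** The Laplacian of g(t) for t = |y - c|^2 is 4 t g''(t) + 6 g'(t) in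
    dimension 3. The difference of the two integrands is the divergence of w
    grad g - g grad w, and its i-th component integrates to zero by
    [I3_partial_eq0]. *)
Lemma radial_green w g g1 g2 c T : Ck 2 w ->
  (forall t : R, 0 <= t -> is_derive t 1 g (g1 t)) ->
  (forall t : R, 0 <= t -> is_derive t 1 g1 (g2 t)) ->
  (forall t : R, 0 <= t -> continuous_at t g2) ->
  (forall t : R, T < t -> [/\ g t = 0, g1 t = 0 & g2 t = 0]) ->
  I3 (fun y => w y * (4 * sq (y - c) * g2 (sq (y - c)) + 6 * g1 (sq (y - c)))) =
  I3 (fun y => laplacian w y * g (sq (y - c))).
Proof.
move=> Cw dg dg1 cg2 gT.
have g0 (t : R) : T < t -> g t = 0 by move=> /gT[].
have g10 (t : R) : T < t -> g1 t = 0 by move=> /gT[].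
have g20 (t : R) : T < t -> g2 t = 0 by move=> /gT[].
have cg (t : R) : 0 <= t -> continuous_at t g by move=> /dg /isd_continuous.
have cg1 (t : R) : 0 <= t -> continuous_at t g1 by move=> /dg1 /isd_continuous.
have cw := Ck_continuous Cw.
have cC i : continuous (fun y : V R => y i 0 - c i 0).
  by move=> y; apply: ctB; [exact: coord_continuous|exact: ctC].
pose dF i y := w y * (4 * (y i 0 - c i 0) ^+ 2 * g2 (sq (y - c)) + 2 * g1 (sq (y - c))) -
   partial i (partial i w) y * g (sq (y - c)).
have cpp i : continuous (partial i (partial i w)).
  exact: (Ck_continuous (Ck_partial i (Ck_partial i Cw))).
have idF i : continuous (dF i) /\ csupp (dF i).
  split.
    move=> y; apply: ctB; apply: ctM => //; try exact: cpp; try exact: radial_continuous.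
    apply: ctD; last by apply: ctZ; exact: radial_continuous.
    by apply: ctM; [apply: ctZ; apply: ctX; exact: cC|exact: radial_continuous].
  have [M HM] := sq_sub_large T c.
  by exists M => y /HM h; rewrite /dF g0// g10// g20// !mulr0 addr0 subr0 mulr0.
have I0 i : I3 (dF i) = 0.
  apply: (@I3_partial_eq0 _ i (fun y => w y * (2 * (y i 0 - c i 0)) * g1 (sq (y - c)) - partial i w y * g (sq (y - c)))).
  - move=> x.
    have dx : is_derive x (basis_vec R i) (fun y : V R => y i 0 - c i 0) 1.
      apply: line_is_deriveP.
      rewrite (_ : (fun s => _) = (fun s : R => s + (x i 0 - c i 0))); last first.
        by apply/funext => s; rewrite !mxE eqxx mulr1; ring.
      by apply: (is_derive_eq (isdD (isdI _) (isdC _ _ _))); rewrite addr0.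
    have H := isdB (isdM (isdM (Ck_derivable i x Cw) (isdZ 2 dx)) (radial_is_derive i (dg1 _ (sq_ge0 (x - c)))))
      (isdM (Ck_derivable i x (Ck_partial i Cw)) (radial_is_derive i (dg _ (sq_ge0 (x - c))))).
    by apply: (is_derive_eq H); rewrite /dF; ring.
  - by have [] := idF i.
  - have [M HM] := sq_sub_large T c.
    by exists M => y /HM h; rewrite g0// g10// !mulr0 subr0.
  - by have [] := idF i.
have ii i : int3 (dF i) by have [? ?] := idF i; exact: int3_csupp.
apply/eqP; rewrite -subr_eq0 -I3B; last first.
- apply: int3_radial g0; [exact: (Ck_continuous (Ck_laplacian Cw))|exact: cg].
- have := @int3_radial (fun t => 4 * t * g2 t + 6 * g1 t) c T w cw; apply.
    move=> t t0; apply: ctD; last by apply: ctZ; exact: cg1.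
    by apply: ctM; [apply: ctZ; exact: ctI|exact: cg2].
  by move=> t tT; rewrite g10// g20// !mulr0 addr0.
rewrite (_ : (fun x => _) = (fun y => dF (inord 0) y + dF (inord 1) y + dF (inord 2) y)); last first.
  apply/funext => y; rewrite /dF /laplacian sum3.
  have := sqE (y - c); rewrite !mxE.
  move: (sq _) (partial _ _ y) (partial _ _ y) (partial _ _ y) => t p0 p1 p2.
  move: (g t) (g1 t) (g2 t) (y _ _ - _) (y _ _ - _) (y _ _ - _) => G G1 G2 y0 y1 y2 ->.
  by ring.
clearbody dF; apply/eqP; apply: (etrans (I3D (int3D (ii _) (ii _)) (ii _))).
by rewrite (I3D (ii _) (ii _)) !I0 !addr0.
Qed.

(** The radial operator 4 t g'' + 6 g', applied twice, is 16 t^2 g4 + 80 t g3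
    + 60 g2. *)
Lemma radial_bigreen u g g1 g2 g3 g4 c T : Ck 4 u ->
  (forall t : R, 0 <= t -> is_derive t 1 g (g1 t)) ->
  (forall t : R, 0 <= t -> is_derive t 1 g1 (g2 t)) ->
  (forall t : R, 0 <= t -> is_derive t 1 g2 (g3 t)) ->
  (forall t : R, 0 <= t -> is_derive t 1 g3 (g4 t)) ->
  (forall t : R, 0 <= t -> continuous_at t g4) ->
  (forall t : R, T < t -> [/\ g t = 0, g1 t = 0, g2 t = 0, g3 t = 0 & g4 t = 0]) ->
  I3 (fun y => u y * (16 * sq (y - c) ^+ 2 * g4 (sq (y - c)) + 80 * sq (y - c) * g3 (sq (y - c)) + 60 * g2 (sq (y - c)))) =
  I3 (fun y => laplacian (laplacian u) y * g (sq (y - c))).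
Proof.
move=> Cu dg dg1 dg2 dg3 cg4 gT.
rewrite -(@radial_green _ g g1 g2 c T) //; last 3 first.
- exact: Ck_laplacian.
- by move=> t t0; apply: isd_continuous (dg2 t t0).
- by move=> t /gT[].
have cM (k t : R) : continuous_at t (fun t : R => k * t) by apply: ctZ; exact: ctI.
have cg3 (t : R) (t0 : 0 <= t) := isd_continuous (dg3 t t0).
have dLg (t : R) : 0 <= t -> is_derive t 1 (fun t => 4 * t * g2 t + 6 * g1 t) (4 * t * g3 t + 10 * g2 t).
  by move=> t0; apply: (is_derive_eq (isdD (isdM (isdZ 4 (isdI t)) (dg2 t t0)) (isdZ 6 (dg1 t t0)))); ring.
have dLg1 (t : R) : 0 <= t -> is_derive t 1 (fun t => 4 * t * g3 t + 10 * g2 t) (4 * t * g4 t + 14 * g3 t).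
  by move=> t0; apply: (is_derive_eq (isdD (isdM (isdZ 4 (isdI t)) (dg3 t t0)) (isdZ 10 (dg2 t t0)))); ring.
have cLg2 (t : R) : 0 <= t -> continuous_at t (fun t => 4 * t * g4 t + 14 * g3 t).
  by move=> t0; apply: ctD; [apply: ctM; [exact: cM|exact: cg4]|apply: ctZ; exact: cg3].
have LgT (t : R) : T < t -> [/\ 4 * t * g2 t + 6 * g1 t = 0, 4 * t * g3 t + 10 * g2 t = 0
    & 4 * t * g4 t + 14 * g3 t = 0].
  by move=> /gT[_ -> -> -> ->]; rewrite !mulr0 !addr0.
apply: etrans (radial_green c (Ck_weaken (Ck_weaken Cu)) dLg dLg1 cLg2 LgT).
by congr I3; apply/funext => y; ring.
Qed.

End Green.

(** * Growth of the solution in mean *)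

(** The k-th power of the positive part: of class C^(k-1), and a source of
    compactly supported radial functions whose Laplacians are again of this
    kind. *)
Definition tpow (R : realType) (k : nat) (x : R) : R := Num.max x 0 ^+ k.

Section TruncatedPowers.
Variable R : realType.
Implicit Types (x : R) (k : nat).

Lemma tpow_ge0 k x : 0 <= tpow k x.
Proof. by apply: exprn_ge0; rewrite le_max lexx orbT. Qed.

Lemma tpow_neg k x : x <= 0 -> tpow k.+1 x = 0.
Proof. by move=> x0; rewrite /tpow max_r// expr0n. Qed.

Lemma tpow_pos k x : 0 <= x -> tpow k x = x ^+ k.
Proof. by move=> x0; rewrite /tpow max_l. Qed.

Lemma tpow_le1 k x : x <= 1 -> tpow k x <= 1.
Proof. by move=> x1; apply: exprn_ile1; rewrite ?le_max ?ge_max ?lexx ?orbT// x1 ler01. Qed.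

Lemma tpow_is_derive k x : is_derive x 1 (@tpow R k.+2) (k.+2%:R * tpow k.+1 x).
Proof.
have [x0|x0|->] := ltgtP x 0.
- rewrite tpow_neg ?mulr0; last exact: ltW.
  apply: (@near_eq_is_derive _ _ _ (fun _ => 0)).
    near=> y; apply/esym/tpow_neg/ltW; near: y; exact: lt_nbhsl.
- rewrite tpow_pos ?ltW//.
  apply: (@near_eq_is_derive R R R (fun y : R => y ^+ k.+2)).
    near=> y; apply/esym/tpow_pos/ltW; near: y; exact: lt_nbhsr.
  by apply: (is_derive_eq (isdX k.+2 (isdI x))); rewrite mulr1.
rewrite tpow_neg// mulr0.
suff H : h^-1 *: (tpow k.+2 (h *: (1 : R) + 0) - tpow k.+2 0) @[h --> (0 : R)^'] --> (0 : R).
  by split; [apply/cvg_ex; exists 0|apply/cvg_lim].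
apply: (@cvg_to_0_linear _ _ 1 1) => // h /andP[h0 h1].
rewrite [h *: _]mulr1 addr0 (tpow_neg k.+1 (lexx 0)) subr0 normrM normfV mul1r.
have hh : `|Num.max h 0| <= `|h| by have [?|?] := leP h 0; rewrite ?normr0.
rewrite ler_pdivrMl// /tpow exprS normrM normrX; apply: ler_pM => //.
rewrite exprS; have h2 : `|Num.max h 0| ^+ k <= 1 by rewrite exprn_ile1//; lra.
by have h3 := normr_ge0 (Num.max h 0); nra.
Unshelve. all: by end_near. Qed.

Lemma tpow_continuous k : continuous (@tpow R k.+1).
Proof.
move=> x; apply: ctX.
rewrite (_ : (fun y => _) = (fun y : R => (y + `|y|) / 2)); last first.
  apply/funext => y; have [?|?] := leP y 0; [rewrite ler0_norm//|rewrite gtr0_norm//]; lra.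
by apply: ctM; [apply: ctD; [exact: ctI|exact: norm_continuous]|exact: ctC].
Qed.

End TruncatedPowers.

Section Growth.
Variable R : realType.
Implicit Types (u w : V R -> R).

(** A radial test function at scale 1 / rho. The weight rho^3 makes its
    derivative [dbump] in rho a multiple of the Laplacian of the next
    truncated power ([dbump_green]). *)
Definition bump k (rho t : R) := rho ^+ 3 * tpow k (1 - rho ^+ 2 * t).
Definition dbump k (rho t : R) :=
  3 * rho ^+ 2 * tpow k.+1 (1 - rho ^+ 2 * t) - 2 * k.+1%:R * rho ^+ 4 * t * tpow k (1 - rho ^+ 2 * t).

Lemma tpow_affine_is_derive k (a b s : R) :
  is_derive s 1 (fun s => tpow k.+2 (a + b * s)) (k.+2%:R * b * tpow k.+1 (a + b * s)).
Proof.
have H := isd_comp (isdD (isdC a _ _) (isdZ b (isdI s))) (tpow_is_derive k (a + b * s)).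
by apply: (is_derive_eq H); ring.
Qed.

Lemma bump_is_derive k (rho t : R) : is_derive rho 1 (fun r => bump k.+2 r t) (dbump k.+1 rho t).
Proof.
have D : is_derive rho 1 (fun r : R => 1 - r ^+ 2 * t) (- (2 * rho * t)).
  by apply: (is_derive_eq (isdB (isdC 1 _ _) (isdM (isdX 2 (isdI rho)) (isdC t _ _)))); rewrite /=; ring.
have H := isdM (isdX 3 (isdI rho)) (isd_comp D (tpow_is_derive k _)).
apply: (is_derive_eq H); rewrite /dbump /=; ring.
Qed.

Lemma bump_continuous k (rho : R) : continuous (bump k.+1 rho).
Proof.
move=> t; apply: ctZ; apply: (@ct_comp _ _ (@tpow R k.+1)); last exact: tpow_continuous.
by apply: ctB; [exact: ctC|apply: ctZ; exact: ctI].
Qed.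

(** Differentiation under the integral sign. For parameters between a/2 and 2a
    the derivative is dominated by a multiple of |w| on a fixed ball. *)
Lemma I3_bump_is_derive k w (a : R) : continuous w -> 0 < a ->
  is_derive a 1 (fun r => I3 (fun y => w y * bump k.+2 r (sq (y - 0))))
    (I3 (fun y => w y * dbump k.+1 a (sq (y - 0)))).
Proof.
move=> cw a0.
pose f (r : R) (p : R * R * R) := w (vec3 p) * bump k.+2 r (sq (vec3 p - 0)).
(* For r between a/2 and 2a the support of the derivative lies in t <= 4 /
   a^2, where K bounds both of its terms; the truncated power in G is at
   least 1 there. *)
pose K : R := 3 * (2 * a) ^+ 2 + 2 * k.+2%:R * (2 * a) ^+ 4 * (4 / a ^+ 2).
pose G (y : V R) := `|w y| * (K * tpow 1 (2 - a ^+ 2 / 4 * sq (y - 0))).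
have K0 : 0 <= K.
  by rewrite /K addr_ge0// !mulr_ge0// ?exprn_ge0 ?invr_ge0 ?exprn_ge0//; lra.
have df (r : R) p : is_derive r 1 (f ^~ p) (w (vec3 p) * dbump k.+1 r (sq (vec3 p - 0))).
  exact: isdZ (bump_is_derive k r _).
have Ia : (`]a / 2, 2 * a[%classic : set R) a by rewrite /= in_itv /=; apply/andP; split; lra.
have sup (r t : R) : a / 2 < r -> 4 / a ^+ 2 < t -> 1 - r ^+ 2 * t <= 0.
  move=> ar at4; have a2 : 0 < a ^+ 2 by rewrite exprn_gt0.
  have : 4 < a ^+ 2 * t by rewrite -ltr_pdivrMl// mulrC.
  have : a ^+ 2 <= 4 * r ^+ 2 by nra.
  have : 0 < t by apply: lt_trans at4; rewrite divr_gt0.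
  nra.
have intf (r : R) : (`]a / 2, 2 * a[%classic : set R) r -> (mu3 R).-integrable setT (EFin \o f r).
  rewrite /= in_itv /= => /andP[r1 r2].
  apply: (@int3_radial R (bump k.+2 r) 0 (4 / a ^+ 2) w cw); first by move=> t _; exact: bump_continuous.
  by move=> t at4; rewrite /bump tpow_neg ?mulr0//; exact: sup.
have iG : int3 G.
  apply: (@int3_radial R (fun t => K * tpow 1 (2 - a ^+ 2 / 4 * t)) 0 (8 / a ^+ 2) (fun y => `|w y|)).
  - by move=> y; apply: (@ct_comp _ _ (fun r => `|r|) w); [exact: cw|exact: norm_continuous].
  - move=> t _; apply: ctZ; apply: (@ct_comp _ _ (@tpow R 1)); last exact: tpow_continuous.
    by apply: ctB; [exact: ctC|apply: ctZ; exact: ctI].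
  - move=> t at8; rewrite tpow_neg ?mulr0//.
    have a2 : 0 < a ^+ 2 by rewrite exprn_gt0.
    have : 8 < a ^+ 2 * t by rewrite -ltr_pdivrMl// mulrC.
    lra.
have Gub (r : R) p : (`]a / 2, 2 * a[%classic : set R) r -> setT p -> `|partial1of2 f r p| <= G (vec3 p).
  rewrite /= in_itv /= => /andP[r1 r2] _.
  rewrite partial1of2E; have [_ ->] := df r p; rewrite normrM /G ler_wpM2l//.
  have := sq_ge0 (vec3 p - 0); move: (sq _) => t t0.
  have [at4|at4] := ltP (4 / a ^+ 2) t.
    have z := sup _ _ r1 at4.
    by rewrite /dbump (tpow_neg k.+1 z) (tpow_neg k z) !mulr0 subr0 normr0 mulr_ge0// tpow_ge0.
  have a2 : 0 < a ^+ 2 by rewrite exprn_gt0.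
  have ta : a ^+ 2 * t <= 4 by rewrite -ler_pdivlMl// mulrC.
  have b1 : 1 <= tpow 1 (2 - a ^+ 2 / 4 * t).
    by rewrite tpow_pos; lra.
  apply: (@le_trans _ _ K); last by rewrite ler_peMr.
  have x1 : 1 - r ^+ 2 * t <= 1 by have := sqr_ge0 r; nra.
  have q1 := tpow_le1 k.+2 x1; have q2 := tpow_le1 k.+1 x1.
  have q3 := tpow_ge0 k.+2 (1 - r ^+ 2 * t); have q4 := tpow_ge0 k.+1 (1 - r ^+ 2 * t).
  have Q (c q C : R) : 0 <= q -> q <= 1 -> 0 <= c -> c <= C -> `|c * q| <= C.
    by move=> ? ? ? ?; rewrite ger0_norm ?mulr_ge0//; nra.
  have r0 : 0 <= r by lra.
  have r2a n : r ^+ n <= (2 * a) ^+ n by rewrite lerXn2r// ?nnegrE; lra.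
  rewrite /dbump (le_trans (ler_normB _ _))// /K lerD//; apply: Q => //.
  - by rewrite mulr_ge0 ?exprn_ge0.
  - by rewrite ler_pM2l.
  - by rewrite !mulr_ge0 ?exprn_ge0.
  - apply: ler_pM => //; first by rewrite !mulr_ge0 ?exprn_ge0.
    by rewrite ler_pM2l ?mulr_gt0.
have G0 p : 0 <= G (vec3 p) by rewrite mulr_ge0// mulr_ge0// tpow_ge0.
have derf (r : R) p : (`]a / 2, 2 * a[%classic : set R) r -> setT p -> derivable (f ^~ p) r 1.
  by move=> _ _; have [] := df r p.
have C := cvg_differentiation_under_integral measurableT Ia intf derf G0 iG Gub.
have -> : I3 (fun y => w y * dbump k.+1 a (sq (y - 0))) = \int[mu3 R]_p partial1of2 f a p.
  rewrite /I3; congr (fine _); apply: eq_integral => p _; rewrite partial1of2E.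
  by have [_ ->] := df a p.
split.
  exact: (derivable_under_integral measurableT Ia intf derf G0 iG Gub).
by rewrite -derive1E; exact: (differentiation_under_integral measurableT Ia intf derf G0 iG Gub).
Qed.

End Growth.

Section GrowthBound.
Variable R : realType.
Implicit Types (u w : V R -> R).

Lemma tpow_radial_facts k (rho : R) : 0 < rho ->
  [/\ forall t : R, is_derive t 1 (fun t => tpow k.+2 (1 - rho ^+ 2 * t)) (- (k.+2%:R * rho ^+ 2) * tpow k.+1 (1 - rho ^+ 2 * t)),
      continuous (fun t => tpow k.+1 (1 - rho ^+ 2 * t)) &
      forall t, (rho ^+ 2)^-1 < t -> tpow k.+1 (1 - rho ^+ 2 * t) = 0].
Proof.
move=> rho0; have r2 : 0 < rho ^+ 2 by rewrite exprn_gt0.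
split.
- move=> t; have := tpow_affine_is_derive k 1 (- rho ^+ 2) t.
  rewrite (_ : (fun s => tpow k.+2 (1 + - rho ^+ 2 * s)) = (fun s => tpow k.+2 (1 - rho ^+ 2 * s))).
    by move=> H; apply: (is_derive_eq H); rewrite (mulNr (rho ^+ 2) t); ring.
  by apply/funext => s; rewrite mulNr.
- move=> t; apply: (@ct_comp _ _ (@tpow R k.+1)); last exact: tpow_continuous.
  by apply: ctB; [exact: ctC|apply: ctZ; exact: ctI].
- move=> t tT; apply: tpow_neg; have : 1 < rho ^+ 2 * t by rewrite -ltr_pdivrMl// mulr1.
  lra.
Qed.

Lemma dbump_green k w (rho : R) : Ck 2 w -> 0 < rho ->
  I3 (fun y => w y * dbump k.+1 rho (sq (y - 0))) =
  - (2 * k.+3%:R)^-1 * I3 (fun y => laplacian w y * tpow k.+3 (1 - rho ^+ 2 * sq (y - 0))).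
Proof.
move=> Cw rho0.
have [d3 c3 z3] := tpow_radial_facts k.+1 rho0.
have [d2 c2 z2] := tpow_radial_facts k rho0.
have [_ _ z4] := tpow_radial_facts k.+2 rho0.
rewrite -(@radial_green _ w _ (fun t => - (k.+3%:R * rho ^+ 2) * tpow k.+2 (1 - rho ^+ 2 * t))
  (fun t => - (k.+3%:R * rho ^+ 2) * (- (k.+2%:R * rho ^+ 2) * tpow k.+1 (1 - rho ^+ 2 * t))) 0 (rho ^+ 2)^-1 Cw
  (fun t _ => d3 t) (fun t _ => isdZ _ (d2 t))); last 2 first.
- by move=> t _; apply: ctZ; apply: ctZ; exact: c2.
- by move=> t tT; rewrite z2// z3// z4// !mulr0.
rewrite -I3Z; last first.
  apply: (@int3_radial R (fun t => 4 * t * (- (k.+3%:R * rho ^+ 2) * (- (k.+2%:R * rho ^+ 2) * tpow k.+1 (1 - rho ^+ 2 * t))) + 6 * (- (k.+3%:R * rho ^+ 2) * tpow k.+2 (1 - rho ^+ 2 * t))) 0 (rho ^+ 2)^-1).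
  - exact: (Ck_continuous Cw).
  - move=> t _; apply: ctD; last by apply: ctZ; apply: ctZ; exact: c3.
    by apply: ctM; [apply: ctZ; exact: ctI|apply: ctZ; apply: ctZ; exact: c2].
  - by move=> t tT; rewrite z2// z3// !mulr0 addr0.
congr I3; apply/funext => y; rewrite /dbump.
move: (sq _) (tpow _ _) (tpow _ _) (w y) => t P Q W.
have k0 : k.+3%:R != 0 :> R by rewrite pnatr_eq0.
by field.
Qed.

(** Let I(r) and J(r) be the integrals of u and of its Laplacian against the
    test functions at scale 1 / r. Then I' = - J / (6 r^3), and J is
    nondecreasing because the bi-Laplacian of u is nonpositive. So J is at
    most J(1) for r below 1, and integrating I' bounds I(r) by O(r^-2);
    division by the weight r^3 gives the fifth power. *)
Lemma growth u : Ck 4 u -> (forall x, laplacian (laplacian u) x <= 0) ->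
  exists C : R, forall rho : R, 0 < rho -> rho <= 1 ->
    I3 (fun y => u y * tpow 2 (1 - rho ^+ 2 * sq (y - 0))) <= C / rho ^+ 5.
Proof.
move=> Cu Lu; have Cl := Ck_laplacian Cu; have C2 := Ck_weaken (Ck_weaken Cu).
have cu := Ck_continuous Cu; have cl := Ck_continuous Cl.
pose I r := I3 (fun y => u y * bump 2 r (sq (y - 0))).
pose J r := I3 (fun y => laplacian u y * bump 3 r (sq (y - 0))).
have dI (r : R) : 0 < r -> is_derive r 1 I (- 6^-1 * r ^- 3 * J r).
  move=> r0; apply: (is_derive_eq (I3_bump_is_derive 0 cu r0)).
  have [_ c z] := tpow_radial_facts 2 r0.
  rewrite (dbump_green 0 C2 r0) /J /bump.
  rewrite (_ : (fun y => laplacian u y * (r ^+ 3 * _)) = (fun y => r ^+ 3 * (laplacian u y * tpow 3 (1 - r ^+ 2 * sq (y - 0))))); last first.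
    by apply/funext => y; ring.
  rewrite I3Z; last by apply: (@int3_radial R (fun t => tpow 3 (1 - r ^+ 2 * t)) 0 (r ^+ 2)^-1 _ cl) => // t _; exact: c.
  by field; rewrite gt_eqF.
have dJ (r : R) : 0 < r -> exists2 d, is_derive r 1 J d & 0 <= d.
  move=> r0; exists (I3 (fun y => laplacian u y * dbump 2 r (sq (y - 0)))).
    exact: (I3_bump_is_derive 1 cl r0).
  rewrite (dbump_green 1 Cl r0) mulNr oppr_ge0 mulr_ge0_le0 ?invr_ge0//.
  rewrite -oppr_ge0 -mulN1r -I3Z; last first.
    have [_ c z] := tpow_radial_facts 3 r0.
    exact: (@int3_radial R (fun t => tpow 4 (1 - r ^+ 2 * t)) 0 (r ^+ 2)^-1
      (laplacian (laplacian u)) (Ck_continuous (Ck_laplacian Cl)) (fun t _ => c t) z).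
  by apply: I3_ge0 => y; rewrite mulN1r oppr_ge0 mulr_le0_ge0// tpow_ge0.
have mono (f : R -> R) : (forall r : R, 0 < r -> r <= 1 -> exists2 d, is_derive r 1 f d & 0 <= d) ->
    forall rho : R, 0 < rho -> rho <= 1 -> f rho <= f 1.
  move=> df rho r0 r1; apply: (@ger0_derive1_le_cc _ f rho 1); rewrite ?in_itv/= ?lexx ?r1//.
  - move=> x; rewrite in_itv/= => /andP[x0 x1].
    by have [d [fd _] _] := df x (lt_trans r0 x0) (ltW x1).
  - move=> x; rewrite in_itv/= => /andP[x0 x1].
    by have [d [_ fd] d0] := df x (lt_trans r0 x0) (ltW x1); rewrite derive1E fd.
  - apply: derivable_within_continuous => x; rewrite in_itv/= => /andP[x0 x1].
    by have [d [fd _] _] := df x (lt_le_trans r0 x0) x1.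
have J1 (rho : R) : 0 < rho -> rho <= 1 -> J rho <= `|J 1|.
  by move=> r0 r1; rewrite (le_trans _ (ler_norm _))// mono// => r ? _; exact: dJ.
(* A correction of the function I that is nondecreasing for 0 < r <= 1. *)
pose H r := I r - `|J 1| / 12 * r^-1 ^+ 2.
have dH (r : R) : 0 < r -> r <= 1 -> exists2 d, is_derive r 1 H d & 0 <= d.
  move=> r0 r1; exists (- 6^-1 * r ^- 3 * J r + `|J 1| / 6 * r ^- 3).
    have r0' : r != 0 by rewrite gt_eqF.
    apply: (is_derive_eq (isdB (dI r r0) (isdZ (`|J 1| / 12) (isdX 2 (isdV r0'))))).
    by rewrite /=; field.
  have := J1 r r0 r1; have : 0 < r ^- 3 by rewrite invr_gt0 exprn_gt0.
  by move: (r ^- 3) => z; nra.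
exists (`|I 1| + `|J 1| / 12) => rho r0 r1.
have := mono H dH rho r0 r1.
rewrite /H invr1 expr1n mulr1 => Hle.
have [_ c z] := tpow_radial_facts 1 r0.
have E : I rho = rho ^+ 3 * I3 (fun y => u y * tpow 2 (1 - rho ^+ 2 * sq (y - 0))).
  rewrite -I3Z; last by apply: (@int3_radial R (fun t => tpow 2 (1 - rho ^+ 2 * t)) 0 (rho ^+ 2)^-1 _ cu) => // t _; exact: c.
  by congr I3; apply/funext => y; rewrite /bump; ring.
have p5 : 0 < rho ^+ 5 by rewrite exprn_gt0.
rewrite ler_pdivlMr//.
have r2 : 0 < rho ^+ 2 by rewrite exprn_gt0.
have -> : I3 (fun y => u y * tpow 2 (1 - rho ^+ 2 * sq (y - 0))) * rho ^+ 5 = I rho * rho ^+ 2 by rewrite E; ring.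
have IH : I rho <= (I 1 - `|J 1| / 12) + `|J 1| / 12 * rho^-1 ^+ 2 by lra.
have e : rho^-1 ^+ 2 * rho ^+ 2 = 1 by rewrite -exprMn mulVf ?expr1n// gt_eqF.
have r21 : rho ^+ 2 <= 1 by rewrite exprn_ile1// ltW.
have := normr_ge0 (J 1); have := ler_norm (I 1); have := normr_ge0 (I 1).
have eJ : `|J 1| / 12 * rho^-1 ^+ 2 * rho ^+ 2 = `|J 1| / 12 by rewrite -mulrA e mulr1.
have := ler_wpM2r (ltW r2) IH; rewrite [leRHS]mulrDl eJ.
nra.
Qed.
End GrowthBound.

(** * The mass of the approximate identity *)

Section LineIntegrals.
Variable R : realType.
Implicit Types A c k l x : R.

(** An odd antiderivative is convenient: its increment over a symmetric
    interval is twice its value at the right end, and monotone convergence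
    does the rest. *)
Lemma ge0_integral_line (f F : R -> R) (c l : R) :
  (forall x, 0 <= f x) -> continuous f -> (forall x : R, is_derive x 1 F (f x)) ->
  (forall x, F (- x) = - F x) -> F n.+1%:R @[n --> \oo] --> l ->
  (\int[@lebesgue_measure R]_x (f (x - c))%:E = (2 * l)%:E)%E.
Proof.
move=> f0 cf dF FN Fl.
pose A (n : nat) : set R := `[c - n.+1%:R, c + n.+1%:R]%classic.
pose g (n : nat) : R -> \bar R := (fun x => (f (x - c))%:E) \_ (A n).
have dFc (x : R) : is_derive x 1 (fun x => F (x - c)) (f (x - c)).
  apply: (is_derive_eq (isd_comp (isdB (isdI x) (isdC c _ _)) (dF (x - c)))).
  by rewrite subr0 mulr1.
have cfc : continuous (fun x => f (x - c)).
  by move=> x; apply: (@ct_comp _ _ f); [apply: ctB; [exact: ctI|exact: ctC]|exact: cf].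
have mg n : measurable_fun setT (g n).
  apply/(measurable_restrictT _ _).1; first exact: measurable_itv.
  apply/measurable_EFinP; apply: measurable_funS (continuous_measurable_fun cfc) => //.
have g0 n x : (0 <= g n x)%E.
  by rewrite /g patchE; case: ifP => // _; rewrite lee_fin.
have gnd x : {homo g ^~ x : n m / (n <= m)%N >-> (n <= m)%E}.
  move=> n m nm; rewrite /g !patchE; case: ifPn => [|_]; last first.
    by have := g0 m x; rewrite /g patchE.
  rewrite inE /A /= in_itv /= => /andP[h1 h2]; rewrite ifT ?lexx//.
  have : (n.+1%:R : R) <= m.+1%:R by rewrite ler_nat ltnS.
  by rewrite inE /= in_itv /=; move=> ?; apply/andP; split; lra.
have C1 : (\int[@lebesgue_measure R]_x g n x)%E @[n --> \oo] --> (\int[@lebesgue_measure R]_x (f (x - c))%:E)%E.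
  rewrite (_ : (\int[@lebesgue_measure R]_x (f (x - c))%:E = \int[@lebesgue_measure R]_x limn (g ^~ x))%E).
    have H := @cvg_monotone_convergence _ _ _ (@lebesgue_measure R) setT measurableT g.
    by apply: H => [n|n x _|x _]; [exact: mg|exact: g0|exact: gnd].
  apply: eq_integral => x _; apply/esym/cvg_lim => //.
  apply: cvg_near_cst; near=> n; rewrite /g patchE ifT// inE /A /= in_itv /=.
  have : `|x - c| < n.+1%:R.
    near: n; exists (Num.truncn `|x - c|) => // n /= hn.
    by rewrite (lt_le_trans (truncnS_gt _))// ler_nat ltnS.
  by rewrite ltr_norml => /andP[? ?]; apply/andP; split; lra.
have C2 : (\int[@lebesgue_measure R]_x g n x)%E @[n --> \oo] --> (2 * l)%:E.
  rewrite (_ : (fun n => _) = (fun n : nat => (2 * F n.+1%:R)%:E)).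
    by apply: cvg_EFin; [exact: nearW|apply: cvgM => //; exact: cvg_cst].
  apply/funext => n; rewrite /g -integral_mkcond (@continuous_FTC2 _ _ (fun x => F (x - c))).
  - rewrite -EFinB (_ : c + n.+1%:R - c = n.+1%:R); last by ring.
    rewrite (_ : c - n.+1%:R - c = - n.+1%:R); last by ring.
    by rewrite FN; congr EFin; ring.
  - by rewrite -subr_gt0; have : (0 : R) < n.+1%:R by []; lra.
  - exact: continuous_subspaceT.
  - have cF : continuous (fun x => F (x - c)) by move=> s; exact: isd_continuous (dFc s).
    split.
    + by move=> s _; have [] := dFc s.
    + by apply: cvg_at_right_filter; exact: cF.
    + by apply: cvg_at_left_filter; exact: cF.
  - by move=> s _; rewrite derive1E; have [] := dFc s.
exact: (cvg_unique _ C1 C2).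
Unshelve. all: by end_near. Qed.

Lemma ge0_integral_lineZ (f : R -> R) (k c a : R) : 0 <= k ->
  (forall x, 0 <= f x) -> continuous f ->
  (\int[@lebesgue_measure R]_x (f (x - c))%:E = a%:E)%E ->
  (\int[@lebesgue_measure R]_x (k * f (x - c))%:E = (k * a)%:E)%E.
Proof.
move=> k0 f0 cf fa; rewrite EFinM -fa -ge0_integralZl//.
- apply/measurable_EFinP; apply: continuous_measurable_fun => x.
  by apply: (@ct_comp _ _ f); [apply: ctB; [exact: ctI|exact: ctC]|exact: cf].
- by move=> x _; rewrite lee_fin.
Qed.

Let rad (A x : R) := Num.sqrt (A + x ^+ 2).

Lemma rad_gt0 A x : 0 < A -> 0 < rad A x.
Proof. by move=> A0; rewrite sqrtr_gt0; have := sqr_ge0 x; lra. Qed.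

Lemma sqr_rad A x : 0 < A -> rad A x ^+ 2 = A + x ^+ 2.
Proof. by move=> A0; rewrite sqr_sqrtr//; have := sqr_ge0 x; lra. Qed.

Lemma rad_is_derive (A x : R) : 0 < A -> is_derive x 1 (rad A) (x / rad A x).
Proof.
move=> A0; have Ax : 0 < A + x ^+ 2 by have := sqr_ge0 x; lra.
apply: (is_derive_eq (isd_comp (isdD (isdC A _ _) (isdX 2 (isdI x))) (is_derive1_sqrt Ax))).
have : rad A x != 0 by rewrite gt_eqF// rad_gt0.
rewrite -/(rad A x) /=; move: (rad A x) => r r0; field; exact: r0.
Qed.

Lemma rad_continuous A : 0 < A -> continuous (rad A).
Proof. by move=> A0 x; exact: isd_continuous (rad_is_derive x A0). Qed.

Lemma rad_odd A x : rad A (- x) = rad A x.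
Proof. by rewrite /rad sqrrN. Qed.

(** The derivative of [sg] is A / rad^3 and its square is 1 - A / rad^2, so
    the odd inverse powers of [rad], from the third on, have antiderivatives
    polynomial in [sg]. *)
Let sg A x := x / rad A x.

Lemma sg_is_derive (A x : R) : 0 < A -> is_derive x 1 (sg A) (A / rad A x ^+ 3).
Proof.
move=> A0; have r0 : rad A x != 0 by rewrite gt_eqF// rad_gt0.
apply: (is_derive_eq (isdM (isdI x) (isd_comp (rad_is_derive x A0) (isdV r0)))).
have := sqr_rad x A0; move: (rad A x) r0 => r r0 e.
have -> : A = r ^+ 2 - x ^+ 2 by rewrite e; ring.
by field.
Qed.

Lemma sgE A x : 0 < A -> sg A x ^+ 2 = 1 - A / rad A x ^+ 2.
Proof.
move=> A0; have r0 : rad A x != 0 by rewrite gt_eqF// rad_gt0.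
have := sqr_rad x A0; rewrite /sg; move: (rad A x) r0 => r r0 e.
have -> : A = r ^+ 2 - x ^+ 2 by rewrite e; ring.
by field.
Qed.

Lemma sg_cvg A : 0 < A -> sg A n.+1%:R @[n --> \oo] --> (1 : R).
Proof.
move=> A0; apply/cvgrPdist_le => e e0; near=> n.
have n1 : (1 : R) <= n.+1%:R by rewrite ler1n.
have An : A < e * n.+1%:R.
  rewrite -ltr_pdivrMl// mulrC; near: n; exists (Num.truncn (A / e)) => // n /= hn.
  by rewrite (lt_le_trans (truncnS_gt _))// ler_nat ltnS.
move: n1 An; move: n.+1%:R => x x1 Ax.
have r0 := rad_gt0 x A0; have e2 := sqr_rad x A0.
have xr : x <= rad A x by nra.
rewrite /sg -[X in X - _](@mulfV _ (rad A x)) ?gt_eqF// -mulrBl ger0_norm; last first.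
  by rewrite divr_ge0; lra.
rewrite ler_pdivrMr//; nra.
Unshelve. all: by end_near. Qed.

Lemma cvg_pow (f : nat -> R) l (k : nat) : f n @[n --> \oo] --> l -> f n ^+ k @[n --> \oo] --> l ^+ k.
Proof.
move=> fl; elim: k => [|k IH]; first by under eq_fun do rewrite expr0; rewrite expr0; exact: cvg_cst.
by under eq_fun do rewrite exprS; rewrite exprS; apply: cvgM.
Qed.

Lemma invn_cvg0 (f : nat -> R) : (forall n, `|f n| <= n.+1%:R^-1) -> f n @[n --> \oo] --> (0 : R).
Proof.
move=> fn; apply: norm_cvg0; apply: (@squeeze_cvgr _ _ _ _ (fun _ => 0) (fun n => n.+1%:R^-1)).
- by apply: nearW => n; rewrite normr_ge0 fn.
- exact: cvg_cst.
- exact: cvg_harmonic.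
Qed.

Lemma rad_inv_continuous A n : 0 < A -> continuous (fun x : R => (rad A x ^+ n)^-1).
Proof.
move=> A0 x; apply: (@ct_comp _ _ (fun y => y^-1)); first by apply: ctX; exact: rad_continuous.
by apply: inv_continuous; rewrite expf_neq0// gt_eqF// rad_gt0.
Qed.

Lemma rad_inv_ge0 A n x : 0 <= (rad A x ^+ n)^-1.
Proof. by rewrite invr_ge0 exprn_ge0// sqrtr_ge0. Qed.

(** Substituting s = x / sqrt(A + x^2), whose derivative is A / sqrt(A +
    x^2)^3, turns the integrand into (1 - s^2)^2 / A^3. *)
Lemma integral_rad7 k A c : 0 <= k -> 0 < A ->
  (\int[@lebesgue_measure R]_x (k * (rad A (x - c) ^+ 7)^-1)%:E = (k * (16 / 15 / A ^+ 3))%:E)%E.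
Proof.
move=> k0 A0; apply: (@ge0_integral_lineZ (fun x => (rad A x ^+ 7)^-1)) => //.
- by move=> x; exact: rad_inv_ge0.
- exact: rad_inv_continuous.
have A1 : A != 0 by rewrite gt_eqF.
pose F x := (A ^+ 3)^-1 * (sg A x - 2 / 3 * sg A x ^+ 3 + 5^-1 * sg A x ^+ 5).
have -> : 16 / 15 / A ^+ 3 = 2 * ((A ^+ 3)^-1 * (1 - 2 / 3 * 1 ^+ 3 + 5^-1 * 1 ^+ 5)) by field.
apply: (@ge0_integral_line (fun x => (rad A x ^+ 7)^-1) F).
- by move=> x; exact: rad_inv_ge0.
- exact: rad_inv_continuous.
- move=> x; have s := sg_is_derive x A0.
  apply: (is_derive_eq (isdZ _ (isdD (isdB s (isdZ _ (isdX 3 s))) (isdZ _ (isdX 5 s))))).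
  have r0 : rad A x != 0 by rewrite gt_eqF// rad_gt0.
  rewrite /= (_ : sg A x ^+ 4 = (sg A x ^+ 2) ^+ 2); last by ring.
  rewrite (sgE x A0); move: (rad A x) r0 => r r0.
  by field; rewrite r0 gt_eqF.
- by move=> x; rewrite /F /sg rad_odd; ring.
- have s := sg_cvg A0; apply: cvgM; first exact: cvg_cst.
  apply: cvgD; [apply: cvgB => //|]; apply: cvgM; try exact: cvg_cst.
    exact: cvg_pow.
  exact: cvg_pow.
Qed.

Lemma integral_rad5 k A c : 0 <= k -> 0 < A ->
  (\int[@lebesgue_measure R]_x (k * (rad A (x - c) ^+ 5)^-1)%:E = (k * (4 / 3 / A ^+ 2))%:E)%E.
Proof.
move=> k0 A0; apply: (@ge0_integral_lineZ (fun x => (rad A x ^+ 5)^-1)) => //.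
- by move=> x; exact: rad_inv_ge0.
- exact: rad_inv_continuous.
have A1 : A != 0 by rewrite gt_eqF.
pose F x := (A ^+ 2)^-1 * (sg A x - 3^-1 * sg A x ^+ 3).
have -> : 4 / 3 / A ^+ 2 = 2 * ((A ^+ 2)^-1 * (1 - 3^-1 * 1 ^+ 3)) by field.
apply: (@ge0_integral_line (fun x => (rad A x ^+ 5)^-1) F).
- by move=> x; exact: rad_inv_ge0.
- exact: rad_inv_continuous.
- move=> x; have s := sg_is_derive x A0.
  apply: (is_derive_eq (isdZ _ (isdB s (isdZ _ (isdX 3 s))))).
  have r0 : rad A x != 0 by rewrite gt_eqF// rad_gt0.
  rewrite /= (sgE x A0); move: (rad A x) r0 => r r0.
  by field; rewrite r0 gt_eqF.
- by move=> x; rewrite /F /sg rad_odd; ring.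
- have s := sg_cvg A0; apply: cvgM; first exact: cvg_cst.
  apply: cvgB => //; apply: cvgM; first exact: cvg_cst.
  exact: cvg_pow.
Qed.

(** The even power forbids the algebraic substitution; the antiderivative
    comes from the usual reduction formula and ends with an arctangent. *)
Lemma integral_rad6 k A c : 0 <= k -> 0 < A ->
  (\int[@lebesgue_measure R]_x (k * ((A + (x - c) ^+ 2) ^+ 3)^-1)%:E =
    (k * (3 * pi / 8 / (A ^+ 2 * Num.sqrt A)))%:E)%E.
Proof.
move=> k0 A0; pose a := Num.sqrt A.
have a0 : 0 < a by rewrite sqrtr_gt0.
have a20 : a != 0 by rewrite gt_eqF.
have aA : A = a ^+ 2 by rewrite sqr_sqrtr// ltW.
have Ax x : 0 < A + x ^+ 2 by have := sqr_ge0 x; lra.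
pose F x := (4 * A)^-1 * (x * ((A + x ^+ 2) ^+ 2)^-1) + 3 / 8 / A ^+ 2 * (x * (A + x ^+ 2)^-1) +
  3 / 8 / (A ^+ 2 * a) * atan (a^-1 * x).
have valE : 3 * pi / 8 / (A ^+ 2 * a) = 2 * ((4 * A)^-1 * 0 + 3 / 8 / A ^+ 2 * 0 + 3 / 8 / (A ^+ 2 * a) * (pi / 2)).
  by field; rewrite a20 gt_eqF.
have dx (x : R) : is_derive x 1 (fun x => A + x ^+ 2) (2 * x).
  by apply: (is_derive_eq (isdD (isdC A _ _) (isdX 2 (isdI x)))); rewrite /=; ring.
have nz x : A + x ^+ 2 != 0 by rewrite gt_eqF.
have nz2 x : (A + x ^+ 2) ^+ 2 != 0 by rewrite expf_neq0.
have f0 x : 0 <= ((A + x ^+ 2) ^+ 3)^-1 by rewrite invr_ge0 exprn_ge0// ltW.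
have cf : continuous (fun x : R => ((A + x ^+ 2) ^+ 3)^-1).
  move=> x; apply: (@ct_comp _ _ (fun y => y^-1)).
    by apply: ctX; apply: ctD; [exact: ctC|apply: ctX; exact: ctI].
  by apply: inv_continuous; rewrite expf_neq0.
apply: (@ge0_integral_lineZ (fun x => ((A + x ^+ 2) ^+ 3)^-1)) => //.
rewrite valE; apply: (@ge0_integral_line (fun x => ((A + x ^+ 2) ^+ 3)^-1) F) => //.
- move=> x.
  apply: (is_derive_eq (isdD (isdD (isdZ _ (isdM (isdI x) (isd_comp (isdX 2 (dx x)) (isdV (nz2 x)))))
    (isdZ _ (isdM (isdI x) (isd_comp (dx x) (isdV (nz x))))))
    (isdZ _ (isd_comp (isdZ a^-1 (isdI x)) (is_derive1_atan (a^-1 * x)))))).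
  have h : (1 + (a^-1 * x) ^+ 2) = (A + x ^+ 2) / a ^+ 2 by rewrite aA; field.
  rewrite /= h; have := nz x; rewrite aA => nzx; field; rewrite a20 /=.
  by rewrite nzx.
- by move=> x; rewrite /F !mulrN atanN sqrrN !mulNr !mulrN -!opprD.
- have small (h : R -> R) : (forall x, 1 <= x -> `|h x| <= x^-1) -> h n.+1%:R @[n --> \oo] --> (0 : R).
    by move=> hx; apply: invn_cvg0 => n; apply: hx; rewrite ler1n.
  apply: cvgD; first (apply: cvgD; apply: cvgM; try exact: cvg_cst).
  + apply: (small (fun x => x * ((A + x ^+ 2) ^+ 2)^-1)) => x x1.
    rewrite ger0_norm; last by rewrite mulr_ge0 ?invr_ge0 ?exprn_ge0 ?ltW//; lra.
    rewrite ler_pdivrMr ?exprn_gt0// ler_pdivlMl; last lra.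
    have x2 : x ^+ 2 <= A + x ^+ 2 by lra.
    have x21 : 1 <= x ^+ 2 by rewrite expr2; nra.
    rewrite -expr2; nra.
  + apply: (small (fun x => x * (A + x ^+ 2)^-1)) => x x1.
    rewrite ger0_norm; last by rewrite mulr_ge0 ?invr_ge0 ?ltW//; lra.
    rewrite ler_pdivrMr// ler_pdivlMl; last lra.
    by rewrite -expr2; lra.
  + apply: cvgM; first exact: cvg_cst.
    have /cvg_pinftyP := @cvgy_atan R; apply.
    apply/cvgryPge => M; near=> n.
    rewrite ler_pdivlMl//; near: n; exists (Num.truncn (`|a * M|)) => // n /= hn.
    rewrite (le_trans (ler_norm _))// ltW// (lt_le_trans (truncnS_gt _))// ler_nat ltnS//.
Unshelve. all: by end_near. Qed.
End LineIntegrals.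

Section Kernel.
Variable R : realType.

(** Minus the bi-Laplacian of sqrt(E + |x|^2), as a function of t = |x|^2. *)
Definition kern (E t : R) : R := 15 * E ^+ 2 / Num.sqrt (E + t) ^+ 7.

Lemma kern_ge0 E t : 0 <= kern E t.
Proof. by rewrite /kern mulr_ge0 ?invr_ge0 ?exprn_ge0 ?sqrtr_ge0// mulr_ge0 ?sqr_ge0. Qed.

Lemma sqrt_is_derive (E t : R) : 0 < E -> 0 <= t ->
  is_derive t 1 (fun t => Num.sqrt (E + t)) (2 * Num.sqrt (E + t))^-1.
Proof.
move=> E0 t0; have Et : 0 < E + t by lra.
apply: (is_derive_eq (isd_comp (isdD (isdC E _ _) (isdI t)) (is_derive1_sqrt Et))).
by rewrite add0r mulr1.
Qed.

Lemma sqrt_neq0 (E t : R) : 0 < E -> 0 <= t -> Num.sqrt (E + t) != 0.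
Proof. by move=> E0 t0; rewrite gt_eqF// sqrtr_gt0; lra. Qed.

Lemma kern_continuous (E t : R) : 0 < E -> 0 <= t -> continuous_at t (kern E).
Proof.
move=> E0 t0; apply: ctZ; apply: (@ct_comp _ _ (fun y => y^-1)).
  by apply: ctX; apply: isd_continuous (sqrt_is_derive E0 t0).
by apply: inv_continuous; rewrite expf_neq0// sqrt_neq0.
Qed.

Lemma sq_sub_vec3 (x y z : R) c : sq (vec3 (x, y, z) - c) =
  (x - c (inord 0) 0) ^+ 2 + (y - c (inord 1) 0) ^+ 2 + (z - c (inord 2) 0) ^+ 2.
Proof. by rewrite sqE !mxE /= !inordK. Qed.

(** The coordinates are integrated one at a time. The exponent of E + |x|^2
    drops from 7/2 to 3 and then to 5/2, and the constants are 15 * 16/15 =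
    16, then 16 * 3 pi / 8 = 6 pi, then 6 pi * 4/3 = 8 pi. *)
Lemma integral_kern E c : 0 < E ->
  (\int[mu3 R]_p (kern E (sq (vec3 p - c)))%:E = (8 * pi)%:E)%E.
Proof.
move=> E0.
pose h (p : R * R * R) := (kern E (sq (vec3 p - c)))%:E.
have ck : continuous (fun y : V R => kern E (sq (y - c))).
  by apply: radial_continuous => t t0; exact: kern_continuous.
have mh : measurable_fun setT h by apply/measurable_EFinP; exact: (measurable_continuous_vec3 ck).
have h0 p : (0 <= h p)%E by rewrite lee_fin kern_ge0.
apply: (etrans (@fubini_tonelli1 _ _ _ _ R (lam2 R) (@lebesgue_measure R) h mh h0)).
have mF := @measurable_fun_fubini_tonelli_F _ _ _ _ R (@lebesgue_measure R) h mh h0.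
pose A (p : R * R) := E + ((p.1 - c (inord 0) 0) ^+ 2 + (p.2 - c (inord 1) 0) ^+ 2).
have A0 p : 0 < A p by rewrite ltr_wpDr// addr_ge0// sqr_ge0.
have pi0 := pi_ge0 R.
have E2 : 0 <= E ^+ 2 by exact: sqr_ge0.
have k15 : 0 <= 15 * E ^+ 2 by rewrite mulr_ge0.
have k16 : 0 <= 16 * E ^+ 2 by rewrite mulr_ge0.
have k6 : 0 <= 6 * pi * E ^+ 2 by rewrite mulr_ge0// mulr_ge0.
have FE p : fubini_F (@lebesgue_measure R) h p = (16 * E ^+ 2 * (A p ^+ 3)^-1)%:E.
  case: p => x y; rewrite /fubini_F /h.
  transitivity (\int[@lebesgue_measure R]_z (15 * E ^+ 2 * (Num.sqrt (A (x, y) + (z - c (inord 2) 0) ^+ 2) ^+ 7)^-1)%:E)%E.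
    by apply: eq_integral => z _; rewrite sq_sub_vec3 /kern [E + _]addrA.
  apply: (etrans (integral_rad7 _ k15 (A0 (x, y)))); congr EFin; field; rewrite gt_eqF//.
have -> : (\int[lam2 R]_p fubini_F (@lebesgue_measure R) h p)%E =
    (\int[lam2 R]_p (16 * E ^+ 2 * (A p ^+ 3)^-1)%:E)%E.
  by apply: eq_integral => p _; rewrite FE.
pose h2 (p : R * R) := (16 * E ^+ 2 * (A p ^+ 3)^-1)%:E.
have mh2 : measurable_fun setT h2.
  by rewrite (_ : h2 = fubini_F (@lebesgue_measure R) h)//; apply/funext => p; rewrite FE.
have h20 p : (0 <= h2 p)%E by rewrite lee_fin mulr_ge0// invr_ge0 exprn_ge0// ltW.
apply: (etrans (@fubini_tonelli1 _ _ _ _ R (@lebesgue_measure R) (@lebesgue_measure R) h2 mh2 h20)).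
pose B x := E + (x - c (inord 0) 0) ^+ 2.
have B0 x : 0 < B x by rewrite ltr_wpDr// sqr_ge0.
have F2E x : fubini_F (@lebesgue_measure R) h2 x = (6 * pi * E ^+ 2 * (Num.sqrt (B x) ^+ 5)^-1)%:E.
  rewrite /fubini_F /h2.
  transitivity (\int[@lebesgue_measure R]_y (16 * E ^+ 2 * ((B x + (y - c (inord 1) 0) ^+ 2) ^+ 3)^-1)%:E)%E.
    by apply: eq_integral => y _; rewrite /A /B addrA.
  apply: (etrans (integral_rad6 _ k16 (B0 x))); congr EFin.
  have s0 : Num.sqrt (B x) != 0 by rewrite gt_eqF// sqrtr_gt0.
  have sB : B x = Num.sqrt (B x) ^+ 2 by rewrite sqr_sqrtr// ltW.
  by move: sB s0; move: (Num.sqrt (B x)) => s -> s0; field; rewrite s0.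
transitivity (\int[@lebesgue_measure R]_x (6 * pi * E ^+ 2 * (Num.sqrt (E + (x - c (inord 0) 0) ^+ 2) ^+ 5)^-1)%:E)%E.
  by apply: eq_integral => x _; exact: F2E.
apply: (etrans (integral_rad5 _ k6 E0)); congr EFin; field; rewrite gt_eqF//.
Qed.

Lemma int3_kern E c : 0 < E -> int3 (fun y => kern E (sq (y - c))).
Proof.
move=> E0; apply/integrableP; split.
  apply/measurable_EFinP; apply: measurable_continuous_vec3.
  by apply: radial_continuous => t t0; exact: kern_continuous.
rewrite (_ : (\int[mu3 R]_p _)%E = (\int[mu3 R]_p (kern E (sq (vec3 p - c)))%:E)%E).
  by rewrite integral_kern// ltry.
by apply: eq_integral => p _ /=; rewrite ger0_norm// kern_ge0.
Qed.

Lemma I3_kern E c : 0 < E -> I3 (fun y => kern E (sq (y - c))) = 8 * pi.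
Proof. by move=> E0; rewrite /I3 /Rintegral integral_kern. Qed.

End Kernel.

(** * A truncated and regularized distance *)

Section Smooth.
Variable R : realType.
Implicit Types (f g : R -> R) (x : R) (n : nat).

Fixpoint smooth n g : Prop :=
  if n is n'.+1 then
    exists g', (forall x : R, is_derive x 1 g (g' x)) /\ smooth n' g'
  else continuous g.

Lemma smooth_continuous n g : smooth n g -> continuous g.
Proof. by case: n => // n [g' [dg _]] x; exact: isd_continuous (dg x). Qed.

Lemma smooth_weaken n g : smooth n.+1 g -> smooth n g.
Proof.
elim: n g => [|n IH] g; first exact: smooth_continuous.
by move=> [g' [dg sg]]; exists g'; split => //; exact: IH.
Qed.

Lemma smoothD n f g : smooth n f -> smooth n g -> smooth n (fun x => f x + g x).
Proof.
elim: n f g => [|n IH] f g; first by move=> cf cg x; apply: ctD; [exact: cf|exact: cg].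
move=> [f' [df sf]] [g' [dg sg]]; exists (fun x => f' x + g' x); split; last exact: IH.
by move=> x; exact: isdD.
Qed.

Lemma smoothM n f g : smooth n f -> smooth n g -> smooth n (fun x => f x * g x).
Proof.
elim: n f g => [|n IH] f g; first by move=> cf cg x; apply: ctM; [exact: cf|exact: cg].
move=> sf0 sg0; have [f' [df sf]] := sf0; have [g' [dg sg]] := sg0.
exists (fun x => f' x * g x + f x * g' x); split; first by move=> x; exact: isdM.
by apply: smoothD; apply: IH => //; exact: smooth_weaken.
Qed.

Lemma smooth_comp n f g : smooth n f -> smooth n g -> smooth n (fun x => f (g x)).
Proof.
elim: n f g => [|n IH] f g.
  by move=> cf cg x; apply: (@ct_comp _ _ f g); [exact: cg|exact: cf].
move=> [f' [df sf]] sg0; have [g' [dg sg]] := sg0.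
exists (fun x => f' (g x) * g' x); split; first by move=> x; exact: isd_comp (dg x) (df (g x)).
by apply: smoothM => //; apply: IH => //; exact: smooth_weaken.
Qed.

Lemma smooth_cst n (k : R) : smooth n (fun _ => k).
Proof.
elim: n k => [|n IH] k; first by move=> x; exact: ctC.
by exists (fun _ => 0); split => // x; exact: isdC.
Qed.

Lemma smooth_affine n (a b : R) : smooth n (fun x => a + b * x).
Proof.
case: n => [|n]; first by move=> x; apply: ctD; [exact: ctC|apply: ctZ; exact: ctI].
exists (fun _ => b); split; last exact: smooth_cst.
by move=> x; apply: (is_derive_eq (isdD (isdC a _ _) (isdZ b (isdI x)))); rewrite add0r mulr1.
Qed.

Lemma smooth_tpow k : smooth k (@tpow R k.+1).
Proof.
elim: k => [|k IH]; first exact: tpow_continuous.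
exists (fun x => k.+2%:R * tpow k.+1 x); split; first exact: tpow_is_derive.
by apply: (smoothM (smooth_cst k k.+2%:R)).
Qed.

(** Equal to 1 up to 1 and to 0 from 2 on. The exponent 8 makes it of class
    C^7: four derivatives are taken by the bi-Laplacian and three more by
    third differences. *)
Definition cutoff x := tpow 8 (1 - tpow 8 (x - 1)).

Lemma cutoff1 x : x <= 1 -> cutoff x = 1.
Proof.
move=> x1; have z : tpow 8 (x - 1) = 0 by apply: tpow_neg; lra.
by rewrite /cutoff z subr0 tpow_pos ?expr1n.
Qed.

Lemma cutoff0 x : 2 <= x -> cutoff x = 0.
Proof.
move=> x2; have x1 : 1 <= x - 1 by lra.
have z : 1 <= tpow 8 (x - 1) by rewrite tpow_pos; [exact: exprn_ege1|lra].
by rewrite /cutoff tpow_neg// subr_le0.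
Qed.

Lemma cutoff_ge0 x : 0 <= cutoff x.
Proof. exact: tpow_ge0. Qed.

Lemma cutoff_le1 x : cutoff x <= 1.
Proof. by apply: tpow_le1; have := tpow_ge0 8 (x - 1); lra. Qed.

Lemma smooth_cutoff : smooth 7 cutoff.
Proof.
apply: (smooth_comp (smooth_tpow 7)).
rewrite (_ : (fun x => _) = (fun x => 1 + -1 * tpow 8 (-1 + 1 * x))); last first.
  by apply/funext => x; rewrite mul1r mulN1r [-1 + x]addrC.
apply: smoothD; first exact: smooth_cst.
apply: smoothM; first exact: smooth_cst.
by apply: (smooth_comp (smooth_tpow 7)); exact: smooth_affine.
Qed.

Lemma smooth_seq n g : smooth n g -> exists d : nat -> R -> R,
  [/\ d 0%N = g, forall i, (i < n)%N -> forall x : R, is_derive x 1 (d i) (d i.+1 x)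
    & forall i, (i <= n)%N -> continuous (d i)].
Proof.
elim: n g => [|n IH] g; first by move=> cg; exists (fun _ => g); split => // -[].
move=> sg0; have [g' [dg /IH[d [d0 dd dc]]]] := sg0.
exists (fun i => if i is j.+1 then d j else g); split => //.
  by move=> [_ x|i ni x]; [rewrite d0|exact: dd].
by move=> [_|i ni]; [exact: smooth_continuous sg0|exact: dc].
Qed.

Lemma is_derive_locally_cst g (k d x : R) (A : set R) : open A -> A x ->
  (forall y, A y -> g y = k) -> is_derive x 1 g d -> d = 0.
Proof.
move=> oA Ax gk [_ <-].
have E : is_derive x 1 g 0.
  apply: (@near_eq_is_derive R R R (fun _ => k)).
  by near=> y; rewrite gk//; near: y; exact: open_nbhs_nbhs.
by have [_ ->] := E.
Unshelve. all: by end_near. Qed.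

(** The derivatives vanish where the cutoff is locally constant, hence are
    bounded by compactness of [0, 2]. *)
Lemma cutoff_seq : exists (d : nat -> R -> R) (M : R),
  [/\ d 0%N = cutoff,
      forall i, (i < 7)%N -> forall x : R, is_derive x 1 (d i) (d i.+1 x),
      forall i, (i <= 7)%N -> continuous (d i),
      forall i, (0 < i <= 7)%N -> forall x, x < 1 \/ 2 < x -> d i x = 0 &
      forall i, (i <= 7)%N -> forall x, 0 <= x -> `|d i x| <= M].
Proof.
have [d [d0 dd dc]] := smooth_seq smooth_cutoff.
have dz i : (0 < i <= 7)%N -> forall x, x < 1 \/ 2 < x -> d i x = 0.
  elim: i => // i IH /andP[_ i7] x [x1|x2].
  - apply: (@is_derive_locally_cst (d i) (if i is 0 then 1 else 0) _ x [set y | y < 1]) => //.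
    + by case: i IH i7 => [|i] IH i7 y /= y1; [rewrite d0 cutoff1// ltW|apply: IH; [exact: ltnW|left]].
    + exact: dd.
  - apply: (@is_derive_locally_cst (d i) 0 _ x [set y | 2 < y]) => //.
    + by case: i IH i7 => [|i] IH i7 y /= y1; [rewrite d0 cutoff0// ltW|apply: IH; [exact: ltnW|right]].
    + exact: dd.
have bd i : (i <= 7)%N -> exists M : R, forall x, 0 <= x -> `|d i x| <= M.
  move=> i7; have cn : {within `[0 : R, 2], continuous (fun x => `|d i x|)}.
    apply: continuous_subspaceT => x; apply: (@ct_comp _ _ (fun r => `|r|)); first exact: dc.
    exact: norm_continuous.
  have [|c _ cmax] := @EVT_max R (fun x => `|d i x|) 0 2 _ cn; first by lra.
  exists `|d i c| => x x0; have [x2|x2] := leP x 2; first by apply: cmax; rewrite in_itv /= x0.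
  case: i i7 {cn} cmax => [_ _|i i7 _]; first by rewrite d0 (cutoff0 (ltW x2)) normr0.
  by rewrite dz ?normr0//; right.
have [M HM] : exists M : R, forall i, (i <= 7)%N -> forall x, 0 <= x -> `|d i x| <= M.
  have [m Hm] := @choice _ _ (fun i M => (i <= 7)%N -> forall x, 0 <= x -> `|d i x| <= M)
    (fun i => match boolP (i <= 7)%N with
      | AltTrue h => let: ex_intro M HM := bd i h in ex_intro _ M (fun _ => HM)
      | AltFalse h => ex_intro _ 0 (fun h' => False_ind _ (negP h h')) end).
  exists (\sum_(j < 8) `|m j|) => i i7 x x0.
  rewrite (le_trans (Hm i i7 x x0))// (le_trans (ler_norm _))//.
  rewrite (bigD1 (Ordinal (i7 : (i < 8)%N)))//= lerDl; exact: sumr_ge0.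
by exists d, M; split.
Qed.

End Smooth.

Section UniformFamilies.
Variable R : realType.
Implicit Types (F G : R -> R -> R) (e t : R).

(** Together with [unif] below, this describes functions of t depending on a
    regularization parameter e, supported in 1 <= t <= 2, with bounds on them
    and on their first n derivatives that do not depend on e. The errors
    created by the cutoff are of this kind, since sqrt(e + t) is smooth
    uniformly in e away from t = 0. *)
Definition unif0 F :=
  [/\ exists M : R, forall e t, 0 < e -> e <= 1 -> 0 <= t -> `|F e t| <= M,
      forall e t, t < 1 \/ 2 < t -> F e t = 0 &
      forall e t, 0 < e -> 0 <= t -> continuous_at t (F e)].

Fixpoint unif n F : Prop :=
  if n is n'.+1 then
    unif0 F /\ exists F', (forall e t, 0 < e -> 0 <= t -> is_derive t 1 (F e) (F' e t)) /\ unif n' F'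
  else unif0 F.

Lemma unif_unif0 n F : unif n F -> unif0 F.
Proof. by case: n => // n []. Qed.

Lemma unif0D F G : unif0 F -> unif0 G -> unif0 (fun e t => F e t + G e t).
Proof.
move=> [[M FM] F0 cF] [[M' GM] G0 cG]; split.
- exists (M + M') => e t e0 e1 t0; rewrite (le_trans (ler_normD _ _))// lerD//; [exact: FM|exact: GM].
- by move=> e t h; rewrite F0// G0// addr0.
- by move=> e t e0 t0; apply: ctD; [exact: cF|exact: cG].
Qed.

Lemma unif0Z k F : unif0 F -> unif0 (fun e t => k * F e t).
Proof.
move=> [[M FM] F0 cF]; split.
- exists (`|k| * M) => e t e0 e1 t0; rewrite normrM ler_wpM2l//; exact: FM.
- by move=> e t h; rewrite F0// mulr0.
- by move=> e t e0 t0; apply: ctZ; exact: cF.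
Qed.

Lemma unifD n F G : unif n F -> unif n G -> unif n (fun e t => F e t + G e t).
Proof.
elim: n F G => [|n IH] F G; first exact: unif0D.
move=> [F0 [F' [dF uF]]] [G0 [G' [dG uG]]]; split; first exact: unif0D.
exists (fun e t => F' e t + G' e t); split; last exact: IH.
by move=> e t e0 t0; apply: isdD; [exact: dF|exact: dG].
Qed.

Lemma unifZ n k F : unif n F -> unif n (fun e t => k * F e t).
Proof.
elim: n F => [|n IH] F; first exact: unif0Z.
move=> [F0 [F' [dF uF]]]; split; first exact: unif0Z.
exists (fun e t => k * F' e t); split; last exact: IH.
by move=> e t e0 t0; apply: isdZ; exact: dF.
Qed.

Let s e t := Num.sqrt (e + t).

Lemma sinv_is_derive m e t : 0 < e -> 0 <= t ->
  is_derive t 1 (fun t => (s e t ^+ m)^-1) (- (m%:R / 2) * (s e t ^+ m.+2)^-1).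
Proof.
move=> e0 t0; have s0 := sqrt_neq0 e0 t0; have sm : s e t ^+ m != 0 by rewrite expf_neq0.
apply: (is_derive_eq (isd_comp (isdX m (sqrt_is_derive e0 t0)) (isdV sm))).
rewrite -/(s e t); case: m sm => [|m] sm /=.
  by rewrite !mul0r oppr0 mul0r mulr0.
have k0 : m.+1%:R != 0 :> R by rewrite pnatr_eq0.
move: (m.+1%:R) k0 => k k0; rewrite !exprS; move: sm; rewrite exprS mulf_eq0 negb_or => /andP[_].
move: (s e t ^+ m) s0; rewrite -/(s e t); move: (s e t) => a b a0 b0; field.
by rewrite b0.
Qed.

Variables (d : nat -> R -> R) (B : R).
Hypotheses (d0 : d 0%N = @cutoff R)
  (dd : forall i, (i < 7)%N -> forall x : R, is_derive x 1 (d i) (d i.+1 x))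
  (dc : forall i, (i <= 7)%N -> continuous (d i))
  (dz : forall i, (0 < i <= 7)%N -> forall x, x < 1 \/ 2 < x -> d i x = 0)
  (dB : forall i, (i <= 7)%N -> forall x, 0 <= x -> `|d i x| <= B).

Let q r p m j e t := e ^+ r * (t ^+ p * (s e t ^+ m)^-1 * d j t).

Lemma q_unif0 r p m j : (0 < j <= 7)%N -> unif0 (q r p m j).
Proof.
move=> /andP[j0 j7]; split.
- exists (2 ^+ p * B) => e t e0 e1 t0.
    have B0 : 0 <= B by apply: le_trans (dB j7 t0).
    have [t1|t1] := ltP t 1; first by rewrite /q dz ?j0//; [rewrite !mulr0 normr0 mulr_ge0// exprn_ge0|left].
    have [t2|t2] := ltP 2 t; first by rewrite /q dz ?j0//; [rewrite !mulr0 normr0 mulr_ge0// exprn_ge0|right].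
    have s1 : 1 <= s e t by rewrite -sqrtr1 ler_wsqrtr//; lra.
    have si : (s e t ^+ m)^-1 <= 1 by rewrite invf_le1 ?exprn_gt0// ?exprn_ege1//; lra.
    have si0 : 0 <= (s e t ^+ m)^-1 by rewrite invr_ge0 exprn_ge0//; lra.
    have er : e ^+ r <= 1 by rewrite exprn_ile1// ltW.
    have er0 : 0 <= e ^+ r by rewrite exprn_ge0// ltW.
    have tp : t ^+ p <= 2 ^+ p by rewrite lerXn2r// nnegrE.
    have tp0 : 0 <= t ^+ p by rewrite exprn_ge0.
    rewrite /q !normrM (ger0_norm er0) (ger0_norm tp0) (ger0_norm si0).
    rewrite -[leRHS]mul1r; apply: ler_pM => //; first by rewrite !mulr_ge0.
    apply: ler_pM => //; first by rewrite mulr_ge0.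
      by rewrite -[leRHS]mulr1; apply: ler_pM.
    exact: dB.
- by move=> e t h; rewrite /q dz ?j0// !mulr0.
- move=> e t e0 t0; apply: ctZ; apply: ctM; last exact: dc.
    apply: ctM; first by apply: ctX; exact: ctI.
    exact: isd_continuous (sinv_is_derive m e0 t0).
Qed.

(** The monomials [q] are stable under differentiation, each derivative
    spending at most one of the seven derivatives of the cutoff. *)
Lemma q_unif n r p m j : (0 < j)%N -> (j + n <= 7)%N -> unif n (q r p m j).
Proof.
elim: n r p m j => [|n IH] r p m j j0 jn; have j7 : (j <= 7)%N by rewrite (leq_trans _ jn)// leq_addr.
  by apply: q_unif0; rewrite j0.
split; first by apply: q_unif0; rewrite j0.
  have jn1 : (j < 7)%N by rewrite (leq_trans _ jn)// addnS ltnS leq_addr.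
  exists (fun e t => p%:R * q r p.-1 m j e t + (- (m%:R / 2) * q r p m.+2 j e t + q r p m j.+1 e t)); split.
    move=> e t e0 t0.
    apply: (is_derive_eq (isdZ (e ^+ r) (isdM (isdM (isdX p (isdI t)) (sinv_is_derive m e0 t0)) (dd jn1 t)))).
    by rewrite /q; ring.
  have jn' : (j + n <= 7)%N by rewrite -ltnS -addnS ltnW.
  apply: unifD; first by apply: unifZ; exact: IH.
  by apply: unifD; [apply: unifZ; exact: IH|apply: IH => //; rewrite addSnnS].
Qed.

(** What the bi-Laplacian of sqrt(e + t) * cutoff t becomes when the term
    without derivatives of the cutoff is set aside ([bilaplacian_g]). *)
Definition Nfun e t :=
  24 * q 0 2 5 1 e t + (-60 * q 0 1 3 1 e t + (60 * q 0 0 1 1 e t +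
  (-24 * q 0 2 3 2 e t + (180 * q 0 1 1 2 e t + (60 * q 1 0 1 2 e t +
  (112 * q 0 2 1 3 e t + (80 * q 1 1 1 3 e t + (16 * q 1 2 1 4 e t + 16 * q 0 3 1 4 e t)))))))).

Lemma Nfun_unif : unif 3 Nfun.
Proof. by repeat (apply: unifD; first by apply: unifZ; exact: q_unif); apply: unifZ; exact: q_unif. Qed.

Let a1 e t := 1 / 2 * (s e t ^+ 1)^-1.
Let a2 e t := - (1 / 4) * (s e t ^+ 3)^-1.
Let a3 e t := 3 / 8 * (s e t ^+ 5)^-1.
Let a4 e t := - (15 / 16) * (s e t ^+ 7)^-1.
Let g0 e t := s e t * d 0 t.
Let g1 e t := a1 e t * d 0 t + s e t * d 1 t.
Let g2 e t := a2 e t * d 0 t + 2 * (a1 e t * d 1 t) + s e t * d 2 t.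
Let g3 e t := a3 e t * d 0 t + 3 * (a2 e t * d 1 t) + 3 * (a1 e t * d 2 t) + s e t * d 3 t.
Let g4 e t := a4 e t * d 0 t + 4 * (a3 e t * d 1 t) + 6 * (a2 e t * d 2 t) + 4 * (a1 e t * d 3 t) + s e t * d 4 t.

Lemma g_derive e t : 0 < e -> 0 <= t ->
  [/\ is_derive t 1 (g0 e) (g1 e t), is_derive t 1 (g1 e) (g2 e t),
      is_derive t 1 (g2 e) (g3 e t), is_derive t 1 (g3 e) (g4 e t) & continuous_at t (g4 e)].
Proof.
move=> e0 t0.
have ds : is_derive t 1 (s e) (a1 e t).
  by apply: (is_derive_eq (sqrt_is_derive e0 t0)); rewrite /a1 expr1 invfM mul1r.
have da1 : is_derive t 1 (a1 e) (a2 e t).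
  by apply: (is_derive_eq (isdZ _ (sinv_is_derive 1 e0 t0))); rewrite mulrA; congr (_ * _); lra.
have da2 : is_derive t 1 (a2 e) (a3 e t).
  by apply: (is_derive_eq (isdZ _ (sinv_is_derive 3 e0 t0))); rewrite mulrA; congr (_ * _); lra.
have da3 : is_derive t 1 (a3 e) (a4 e t).
  by apply: (is_derive_eq (isdZ _ (sinv_is_derive 5 e0 t0))); rewrite mulrA; congr (_ * _); lra.
have D0 := dd (isT : (0 < 7)%N) t; have D1 := dd (isT : (1 < 7)%N) t.
have D2 := dd (isT : (2 < 7)%N) t; have D3 := dd (isT : (3 < 7)%N) t.
have D4 := dd (isT : (4 < 7)%N) t.
split.
- exact: isdM.
- by apply: (is_derive_eq (isdD (isdM da1 D0) (isdM ds D1))); rewrite /g2; ring.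
- by apply: (is_derive_eq (isdD (isdD (isdM da2 D0) (isdZ 2 (isdM da1 D1))) (isdM ds D2))); rewrite /g3; ring.
- by apply: (is_derive_eq (isdD (isdD (isdD (isdM da3 D0) (isdZ 3 (isdM da2 D1))) (isdZ 3 (isdM da1 D2))) (isdM ds D3))); rewrite /g4; ring.
- have c0 := isd_continuous ds; have c1 := isd_continuous da1; have c2 := isd_continuous da2.
  have c3 := isd_continuous da3; have c4 := isd_continuous (isdZ (- (15 / 16)) (sinv_is_derive 7 e0 t0)).
  have e0' := isd_continuous D0; have e1 := isd_continuous D1; have e2 := isd_continuous D2.
  have e3 := isd_continuous D3; have e4 := isd_continuous D4.
  apply: ctD; last exact: ctM.
  apply: ctD; last by apply: ctZ; exact: ctM.
  apply: ctD; last by apply: ctZ; exact: ctM.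
  apply: ctD; last by apply: ctZ; exact: ctM.
  exact: ctM.
Qed.

Lemma g_eq0 e t : 2 < t -> [/\ g0 e t = 0, g1 e t = 0, g2 e t = 0, g3 e t = 0 & g4 e t = 0].
Proof.
move=> t2; have z0 : d 0 t = 0 by rewrite d0 cutoff0// ltW.
have z1 : d 1 t = 0 by apply: dz => //; right.
have z2 : d 2 t = 0 by apply: dz => //; right.
have z3 : d 3 t = 0 by apply: dz => //; right.
have z4 : d 4 t = 0 by apply: dz => //; right.
by rewrite /g0 /g1 /g2 /g3 /g4 z0 z1 z2 z3 z4 !mulr0 !addr0.
Qed.

Lemma bilaplacian_g e t : 0 < e -> 0 <= t ->
  16 * t ^+ 2 * g4 e t + 80 * t * g3 e t + 60 * g2 e t = Nfun e t - kern e t * d 0 t.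
Proof.
move=> e0 t0; have s0 := sqrt_neq0 e0 t0.
have s2 : e = Num.sqrt (e + t) ^+ 2 - t by rewrite sqr_sqrtr; lra.
rewrite /Nfun /g2 /g3 /g4 /a1 /a2 /a3 /a4 /q /kern /s.
move: (d 0 t) (d 1 t) (d 2 t) (d 3 t) (d 4 t) => x0 x1 x2 x3 x4.
move: s2 s0; move: (Num.sqrt (e + t)) => r -> r0.
by field.
Qed.

(** The functions [g] are the successive derivatives of sqrt(e + t) * cutoff
    t, given by Leibniz' rule. *)
Lemma regularized_radius e : 0 < e -> exists g : nat -> R -> R,
  [/\ forall t, g 0%N t = Num.sqrt (e + t) * cutoff t,
      forall i t, (i < 4)%N -> 0 <= t -> is_derive t 1 (g i) (g i.+1 t),
      forall t, 0 <= t -> continuous_at t (g 4%N),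
      forall i t, (i <= 4)%N -> 2 < t -> g i t = 0 &
      forall t, 0 <= t -> 16 * t ^+ 2 * g 4%N t + 80 * t * g 3%N t + 60 * g 2%N t =
        Nfun e t - kern e t * cutoff t].
Proof.
move=> e0; exists (fun i => nth (g0 e) [:: g0 e; g1 e; g2 e; g3 e; g4 e] i); split.
- by move=> t; rewrite /g0 d0.
- by move=> [|[|[|[|//]]]] t _ t0; have [] := g_derive e0 t0.
- by move=> t t0; have [] := g_derive e0 t0.
- by move=> [|[|[|[|[|//]]]]] t _ /(g_eq0 e)[].
- by move=> t t0; rewrite /= bilaplacian_g// d0.
Qed.

End UniformFamilies.

Section RegularizedKernel.
Variable R : realType.

Lemma sqrt_scale (L e t : R) : 0 < L ->
  Num.sqrt (e * L ^+ 2 + t) = L * Num.sqrt (e + L ^- 2 * t).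
Proof.
move=> L0; have -> : e * L ^+ 2 + t = L ^+ 2 * (e + L ^- 2 * t) by field; rewrite gt_eqF.
by rewrite sqrtrM ?sqr_ge0// sqrtr_sqr gtr0_norm.
Qed.

Lemma kern_scale (L e t : R) : 0 < L -> kern (e * L ^+ 2) t = L ^- 3 * kern e (L ^- 2 * t).
Proof.
move=> L0; rewrite /kern sqrt_scale//; move: (Num.sqrt _) => S.
have -> : (L * S) ^+ 7 = L ^+ 7 * S ^+ 7 by ring.
by rewrite invfM; move: ((S ^+ 7)^-1) => s; field; rewrite gt_eqF.
Qed.

(** Green's identity against L * sqrt(e + s) * cutoff s with s = |y - c|^2 /
    L^2, that is, against sqrt(e L^2 + |y - c|^2) truncated at distance L. By
    homogeneity the bi-Laplacian brings out L^-3, and the error N does not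
    depend on L. *)
Lemma regularized_kernel : exists N : R -> R -> R, unif 3 N /\
  forall (u : 'cV[R]_3 -> R) (c : 'cV[R]_3) (L e : R), Ck 4 u -> 0 < e -> 0 < L ->
  I3 (fun y => u y * (kern (e * L ^+ 2) (sq (y - c)) * cutoff (L ^- 2 * sq (y - c)))) =
  I3 (fun y => u y * (L ^- 3 * N e (L ^- 2 * sq (y - c)))) -
  I3 (fun y => laplacian (laplacian u) y * (Num.sqrt (e * L ^+ 2 + sq (y - c)) * cutoff (L ^- 2 * sq (y - c)))).
Proof.
have [d [B [d0 dd dc dz dB]]] := @cutoff_seq R.
exists (Nfun d); split; first exact: (Nfun_unif dd dc dz dB).
move=> u c L e Cu e0 L0.
have L20 : 0 <= L ^- 2 by rewrite invr_ge0 sqr_ge0.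
have dscale (k : R) (f f' : R -> R) (t : R) : is_derive (L ^- 2 * t) 1 f (f' (L ^- 2 * t)) ->
    is_derive t 1 (fun t => k * f (L ^- 2 * t)) (k * L ^- 2 * f' (L ^- 2 * t)).
  by move=> df; apply: (is_derive_eq (isdZ k (isd_comp (isdZ _ (isdI t)) df))); ring.
have [g [g0E gd gc gz gN]] := regularized_radius d0 dd dz e0.
have H := @radial_bigreen R u (fun t => L * g 0%N (L ^- 2 * t)) (fun t => L * L ^- 2 * g 1%N (L ^- 2 * t))
  (fun t => L * L ^- 2 * L ^- 2 * g 2%N (L ^- 2 * t)) (fun t => L * L ^- 2 * L ^- 2 * L ^- 2 * g 3%N (L ^- 2 * t))
  (fun t => L * L ^- 2 * L ^- 2 * L ^- 2 * L ^- 2 * g 4%N (L ^- 2 * t)) c (2 * L ^+ 2) Cu.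
have nn (t : R) : 0 <= t -> 0 <= L ^- 2 * t by move=> t0; rewrite mulr_ge0.
have L2 : 0 < L ^+ 2 by rewrite exprn_gt0.
have large (t : R) : 2 * L ^+ 2 < t -> 2 < L ^- 2 * t by rewrite ltr_pdivlMl// mulrC.
have {}H : I3 (fun y => u y * (16 * sq (y - c) ^+ 2 * (L * L ^- 2 * L ^- 2 * L ^- 2 * L ^- 2 * g 4%N (L ^- 2 * sq (y - c))) +
   80 * sq (y - c) * (L * L ^- 2 * L ^- 2 * L ^- 2 * g 3%N (L ^- 2 * sq (y - c))) +
   60 * (L * L ^- 2 * L ^- 2 * g 2%N (L ^- 2 * sq (y - c))))) =
   I3 (fun y => laplacian (laplacian u) y * (L * g 0%N (L ^- 2 * sq (y - c)))).
  apply: H => t.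
  - by move=> t0; apply: dscale; apply: gd => //; exact: nn.
  - by move=> t0; apply: dscale; apply: gd => //; exact: nn.
  - by move=> t0; apply: dscale; apply: gd => //; exact: nn.
  - by move=> t0; apply: dscale; apply: gd => //; exact: nn.
  - move=> t0; apply: ctZ; apply: (@ct_comp _ _ (g 4%N)); first by apply: ctZ; exact: ctI.
    by apply: gc; exact: nn.
  - by move=> /large tL; rewrite !gz// !mulr0.
have E1 : I3 (fun y => laplacian (laplacian u) y * (Num.sqrt (e * L ^+ 2 + sq (y - c)) * cutoff (L ^- 2 * sq (y - c)))) =
    I3 (fun y => laplacian (laplacian u) y * (L * g 0%N (L ^- 2 * sq (y - c)))).
  by congr I3; apply/funext => y; rewrite sqrt_scale// g0E -[L * _ * _]mulrA.
rewrite E1 -H.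
have [N0 Nz Nc] := unif_unif0 (Nfun_unif dd dc dz dB).
have cu := Ck_continuous Cu.
rewrite -I3B; last first.
- have gF (t : R) : 0 <= t -> continuous_at t (fun t => 16 * t ^+ 2 * (L * L ^- 2 * L ^- 2 * L ^- 2 * L ^- 2 * g 4%N (L ^- 2 * t)) +
     80 * t * (L * L ^- 2 * L ^- 2 * L ^- 2 * g 3%N (L ^- 2 * t)) + 60 * (L * L ^- 2 * L ^- 2 * g 2%N (L ^- 2 * t))).
    move=> t0; have D i (i4 : (i < 4)%N) := gd i _ i4 (nn t t0).
    have cs (f : R -> R) (k : R) : continuous_at (L ^- 2 * t) f -> continuous_at t (fun t => k * f (L ^- 2 * t)).
      by move=> cf; apply: ctZ; apply: (@ct_comp _ _ f) => //; apply: ctZ; exact: ctI.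
    apply: ctD; last by apply: ctZ; apply: cs; exact: isd_continuous (D _ (isT : (2 < 4)%N)).
    apply: ctD; apply: ctM.
    - by apply: ctZ; apply: ctX; exact: ctI.
    - by apply: cs; apply: gc; exact: nn.
    - by apply: ctZ; exact: ctI.
    - by apply: cs; exact: isd_continuous (D _ (isT : (3 < 4)%N)).
  apply: (@int3_radial R _ c (2 * L ^+ 2) u cu gF).
  by move=> t /large tL; rewrite !gz// !mulr0 !addr0.
- apply: (@int3_radial R (fun t => L ^- 3 * Nfun d e (L ^- 2 * t)) c (2 * L ^+ 2) u cu).
    move=> t t0; apply: ctZ; apply: (@ct_comp _ _ (Nfun d e)); first by apply: ctZ; exact: ctI.
    by apply: Nc => //; exact: nn.
  by move=> t /large t2; rewrite Nz ?mulr0//; right.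
congr I3; apply/funext => y; rewrite kern_scale//.
have := gN _ (nn _ (sq_ge0 (y - c))).
move: (Nfun _ _ _) (kern _ _) (g _ _) (g _ _) (g _ _) (cutoff _) => n k G4 G3 G2 D.
move: (sq _) => t E.
rewrite -mulrBr; congr (_ * _).
have L1 : L != 0 by rewrite gt_eqF.
rewrite [X in _ - X](_ : _ = L ^- 3 * (n - k * D)); last by rewrite -E; field.
by ring.
Qed.
End RegularizedKernel.

(** * Third differences *)

Section EuclideanNorm.
Variable R : realType.
Implicit Types (x y z h k l : V R) (a : R).

Definition dot x y : R := \sum_(i < 3) x i 0 * y i 0.

Lemma dotE x y : dot x y = x (inord 0) 0 * y (inord 0) 0 + x (inord 1) 0 * y (inord 1) 0 +
  x (inord 2) 0 * y (inord 2) 0.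
Proof. by rewrite /dot sum3. Qed.

Lemma dotDl x y z : dot (x + y) z = dot x z + dot y z.
Proof. by rewrite !dotE !mxE; ring. Qed.

Lemma dotZl a x y : dot (a *: x) y = a * dot x y.
Proof. by rewrite !dotE !mxE; ring. Qed.

Lemma dotC x y : dot x y = dot y x.
Proof. by rewrite !dotE; ring. Qed.

Lemma sqD x y : sq (x + y) = sq x + 2 * dot x y + sq y.
Proof. by rewrite !sqE !dotE !mxE; ring. Qed.

Lemma sqZ a x : sq (a *: x) = a ^+ 2 * sq x.
Proof. by rewrite !sqE !mxE; ring. Qed.

Lemma sqN x : sq (- x) = sq x.
Proof. by rewrite !sqE !mxE; ring. Qed.

Lemma dot_le x y : `|dot x y| <= enorm x * enorm y.
Proof.
rewrite -ler_sqr ?nnegrE ?mulr_ge0 ?enorm_ge0// exprMn !sqr_enorm -normrX ger0_norm ?sqr_ge0//.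
rewrite -subr_ge0 !sqE dotE.
move: (x _ _) (x _ _) (x _ _) (y _ _) (y _ _) (y _ _) => x0 x1 x2 y0 y1 y2.
(* Lagrange's identity *)
rewrite (_ : _ - _ = (x0 * y1 - x1 * y0) ^+ 2 + (x0 * y2 - x2 * y0) ^+ 2 + (x1 * y2 - x2 * y1) ^+ 2); last by ring.
by rewrite !addr_ge0// sqr_ge0.
Qed.

Lemma enormD x y : enorm (x + y) <= enorm x + enorm y.
Proof.
rewrite -ler_sqr ?nnegrE ?addr_ge0 ?enorm_ge0// sqr_enorm sqD sqrrD !sqr_enorm.
have := dot_le x y; have := ler_norm (dot x y); rewrite -mulr_natl; lra.
Qed.

Lemma enormZ a x : enorm (a *: x) = `|a| * enorm x.
Proof. by rewrite !enorm_sq sqZ sqrtrM ?sqr_ge0// sqrtr_sqr. Qed.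

Lemma enormN x : enorm (- x) = enorm x.
Proof. by rewrite !enorm_sq sqN. Qed.

Lemma enorm_distC x y : enorm (x - y) = enorm (y - x).
Proof. by rewrite -enormN opprB. Qed.

Lemma enorm0 : enorm (0 : V R) = 0.
Proof. by rewrite -(scale0r (0 : V R)) enormZ normr0 mul0r. Qed.

Lemma enorm_le_dist x y : `|enorm x - enorm y| <= enorm (x - y).
Proof.
have h1 := enormD (x - y) y; have h2 := enormD (y - x) x.
rewrite subrK in h1; rewrite subrK enorm_distC in h2.
by rewrite ler_norml; lra.
Qed.

Lemma enorm_continuous : continuous (@enorm R).
Proof.
move=> x; rewrite (_ : @enorm R = fun y => Num.sqrt (sq (y - 0))); last by apply/funext => y; rewrite subr0.
apply: (@ct_comp _ _ (@Num.sqrt R) (fun y => sq (y - 0))); first exact: sq_sub_continuous.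
exact: sqrt_continuous.
Qed.

End EuclideanNorm.

Section ThirdDifferences.
Variable R : realType.
Implicit Types (x y z h k l : V R) (F G : V R -> R) (a : R).

Definition diff h F x := F (x + h) - F x.
(** Third differences annihilate quadratic polynomials, and on functions that
    live at scale L they gain a factor L^-3. *)
Definition diff3 h k l F x := diff h (diff k (diff l F)) x.

Lemma diff3E h k l F x : diff3 h k l F x =
  F (x + h + k + l) - F (x + h + k) - (F (x + h + l) - F (x + h)) -
  (F (x + k + l) - F (x + k) - (F (x + l) - F x)).
Proof. by []. Qed.

Lemma diff3B h k l F G x :
  diff3 h k l (fun x => F x - G x) x = diff3 h k l F x - diff3 h k l G x.
Proof. by rewrite !diff3E; ring. Qed.

Lemma diff3Z h k l a F x : diff3 h k l (fun x => a * F x) x = a * diff3 h k l F x.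
Proof. by rewrite !diff3E; ring. Qed.

Lemma diff3_cst h k l a x : diff3 h k l (fun _ => a) x = 0.
Proof. by rewrite !diff3E; ring. Qed.

Lemma diff3_scale h k l F a y x :
  diff3 h k l (fun x => F (a *: (x - y))) x = diff3 (a *: h) (a *: k) (a *: l) F (a *: (x - y)).
Proof.
rewrite !diff3E.
have E z w : a *: (z + w - y) = a *: (z - y) + a *: w by rewrite -scalerDr addrAC.
by rewrite !E.
Qed.

Lemma diff3_continuous h k l F : continuous F -> continuous (diff3 h k l F).
Proof.
move=> cF; have cd (G : V R -> R) (m : V R) : continuous G -> continuous (diff m G).
  move=> cG x; apply: ctB; last exact: cG.
  apply: (@continuous_comp _ _ _ (fun y => y + m)); last exact: cG.
  by apply: (@continuousD _ _ _ (fun y : V R => y) (fun _ => m) x); [exact: cvg_id|exact: cst_continuous].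
exact: (cd _ h (cd _ k (cd _ l cF))).
Qed.

Lemma diff3_cvg h k l (F_ : nat -> V R -> R) F x :
  (forall x, F_ n x @[n --> \oo] --> F x) ->
  diff3 h k l (F_ n) x @[n --> \oo] --> diff3 h k l F x.
Proof. by move=> FF; rewrite diff3E; do ![apply: cvgB; try exact: FF]. Qed.

Lemma diff3_I3 h k l (G : V R -> V R -> R) x : (forall x, int3 (G x)) ->
  int3 (fun y => diff3 h k l (G ^~ y) x) /\
  diff3 h k l (fun x => I3 (G x)) x = I3 (fun y => diff3 h k l (G ^~ y) x).
Proof.
have one (m : V R) (H : V R -> V R -> R) : (forall x, int3 (H x)) ->
    (forall x, int3 (fun y => diff m (H ^~ y) x)) /\
    (diff m (fun x => I3 (H x)) = fun x => I3 (fun y => diff m (H ^~ y) x)).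
  move=> iH; split; first by move=> z; exact: int3B.
  by apply/funext => z; rewrite /diff I3B.
move=> iG; rewrite /diff3.
have [i1 e1] := one l G iG.
have [i2 e2] := one k _ i1.
have [i3 e3] := one h _ i2.
by rewrite e1 e2 e3; split => //; exact: i3.
Qed.

Lemma shift_is_derive F x h m (d : R) :
  is_derive (x + m) h F d -> is_derive x h (fun y => F (y + m)) d.
Proof.
move=> dF; apply: line_is_deriveP.
rewrite (_ : (fun s => _) = (fun s : R => F (x + m + s *: h))); last by apply/funext => s; rewrite addrAC.
by apply: line_is_derive; rewrite scale0r addr0.
Qed.

Lemma diff_is_derive F F' h m : (forall x, is_derive x h F (F' x)) ->
  forall x, is_derive x h (diff m F) (diff m F' x).
Proof. by move=> dF x; exact: (isdB (shift_is_derive (dF (x + m))) (dF x)). Qed.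

Lemma diff_mvt F F' h x : (forall x, is_derive x h F (F' x)) ->
  exists2 th : R, 0 <= th <= 1 & diff h F x = F' (x + th *: h).
Proof.
move=> dF; have d (s : R) : is_derive s 1 (fun s => F (x + s *: h)) (F' (x + s *: h)).
  exact: line_is_derive.
have [|th] := @MVT_segment R (fun s => F (x + s *: h)) (fun s => F' (x + s *: h)) 0 1 ler01 (fun s _ => d s).
  by apply: continuous_subspaceT => s; exact: isd_continuous (d s).
rewrite in_itv /= => th01; rewrite scale1r scale0r addr0 subr0 mulr1 => E.
by exists th.
Qed.

(** The mean value theorem, once for each direction: each difference of a
    derivative is again a derivative at a displaced point. *)
Lemma diff3_mvt F F1 F2 F3 h k l x :
  (forall x, is_derive x h F (F1 x)) -> (forall x, is_derive x k F1 (F2 x)) ->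
  (forall x, is_derive x l F2 (F3 x)) ->
  exists2 z, enorm (z - x) <= enorm h + enorm k + enorm l & diff3 h k l F x = F3 z.
Proof.
move=> d1 d2 d3; rewrite /diff3.
have [a /andP[a0 a1] ->] := diff_mvt x (diff_is_derive k (diff_is_derive l d1)).
have [b /andP[b0 b1] ->] := diff_mvt (x + a *: h) (diff_is_derive l d2).
have [c /andP[c0 c1] ->] := diff_mvt (x + a *: h + b *: k) d3.
exists (x + a *: h + b *: k + c *: l) => //.
rewrite (_ : _ - x = a *: h + b *: k + c *: l); last by rewrite addrC -!addrA addKr.
have t1 := enormD (a *: h + b *: k) (c *: l); have t2 := enormD (a *: h) (b *: k).
rewrite !enormZ !ger0_norm// in t1 t2.
have := enorm_ge0 h; have := enorm_ge0 k; have := enorm_ge0 l.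
nra.
Qed.

Lemma sq_is_derive x h : is_derive x h (@sq R) (2 * dot x h).
Proof.
apply: line_is_deriveP.
rewrite (_ : (fun s => _) = (fun s : R => sq x + (s * (2 * dot x h) + s ^+ 2 * sq h))); last first.
  by apply/funext => s; rewrite sqD sqZ dotC dotZl dotC; ring.
apply: (is_derive_eq (isdD (isdC _ _ _) (isdD (isdM (isdI _) (isdC _ _ _)) (isdM (isdX 2 (isdI _)) (isdC _ _ _))))).
by rewrite /=; ring.
Qed.

Lemma comp_sq_is_derive (g : R -> R) x h dg : is_derive (sq x) 1 g dg ->
  is_derive x h (fun y => g (sq y)) (2 * dot x h * dg).
Proof.
move=> gd; apply: line_is_deriveP.
have H := @line_is_derive R (@sq R) x h 0.
rewrite mulrC; apply: (@isd_comp _ g (fun s : R => sq (x + s *: h))); last by rewrite scale0r addr0.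
by apply: H; rewrite scale0r addr0; exact: sq_is_derive.
Qed.

Lemma dot_is_derive x h m : is_derive x h (fun y => dot y m) (dot h m).
Proof.
apply: line_is_deriveP.
rewrite (_ : (fun s => _) = (fun s : R => dot x m + s * dot h m)); last first.
  by apply/funext => s; rewrite dotDl dotZl.
by apply: (is_derive_eq (isdD (isdC _ _ _) (isdM (isdI _) (isdC _ _ _)))); ring.
Qed.

(** At points z with |z|^2 > 2 all derivatives vanish, so the polynomial
    factors z that the chain rule produces are bounded on the relevant set. *)
Lemma unif_diff3 (N : R -> R -> R) : unif 3 N -> exists2 M : R, 0 <= M &
  forall e, 0 < e -> e <= 1 -> forall h k l x,
  `|diff3 h k l (fun z => N e (sq z)) x| <= M * (enorm h * enorm k * enorm l) /\
  (2 + (enorm h + enorm k + enorm l) < enorm x -> diff3 h k l (fun z => N e (sq z)) x = 0).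
Proof.
move=> [N0 [N1 [dN [N1_0 [N2 [dN1 [N2_0 [N3 [dN2 N3_0]]]]]]]]].
have [[M2 HM2] Z2 _] := N2_0; have [[M3 HM3] Z3 _] := N3_0.
exists (24 * `|M2| + 64 * `|M3|); first by rewrite addr_ge0// mulr_ge0.
move=> e e0 e1 h k l x.
have s0 := @sq_ge0 R.
pose F1 z := 2 * dot z h * N1 e (sq z).
pose F2 z := 2 * dot k h * N1 e (sq z) + 2 * dot z h * (2 * dot z k * N2 e (sq z)).
pose F3 z := 4 * (dot k h * dot z l + dot l h * dot z k + dot z h * dot l k) * N2 e (sq z) +
  8 * (dot z h * dot z k * dot z l) * N3 e (sq z).
have d1 z : is_derive z h (fun z => N e (sq z)) (F1 z).
  by apply: comp_sq_is_derive; apply: dN.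
have d2 z : is_derive z k F1 (F2 z).
  exact: isdM (isdZ 2 (dot_is_derive z k h)) (comp_sq_is_derive k (dN1 e _ e0 (s0 z))).
have d3 z : is_derive z l F2 (F3 z).
  have H := isdD (isdZ (2 * dot k h) (comp_sq_is_derive l (dN1 e _ e0 (s0 z))))
    (isdM (isdZ 2 (dot_is_derive z l h)) (isdM (isdZ 2 (dot_is_derive z l k)) (comp_sq_is_derive l (dN2 e _ e0 (s0 z))))).
  by apply: (is_derive_eq H); rewrite /F3; ring.
have [z zx ->] := diff3_mvt x d1 d2 d3.
have big : 2 < sq z -> F3 z = 0 by move=> z2; rewrite /F3 Z2 ?Z3; [ring|right|right].
split; last first.
  move=> xb; apply: big; have := enorm_le_dist z x; rewrite ler_norml => /andP[zx' _].
  rewrite -sqr_enorm; nra.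
have K0 : 0 <= enorm h * enorm k * enorm l by rewrite !mulr_ge0 ?enorm_ge0.
have [z2|z2] := ltP 2 (sq z).
  by rewrite big// normr0 mulr_ge0// addr_ge0// mulr_ge0.
have ez : enorm z <= 2.
  by have := sqr_enorm z; have := enorm_ge0 z; nra.
have ez0 := enorm_ge0 z; have eh := enorm_ge0 h; have ek := enorm_ge0 k; have el := enorm_ge0 l.
have zd m : `|dot z m| <= 2 * enorm m.
  by apply: le_trans (dot_le z m) _; rewrite ler_wpM2r// enorm_ge0.
have P1 : `|dot k h * dot z l + dot l h * dot z k + dot z h * dot l k| <= 6 * (enorm h * enorm k * enorm l).
  apply: le_trans (ler_normD _ _) _; apply: le_trans (lerD (ler_normD _ _) (lexx _)) _; rewrite !normrM.
  have q1 := ler_pM (normr_ge0 _) (normr_ge0 _) (dot_le k h) (zd l).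
  have q2 := ler_pM (normr_ge0 _) (normr_ge0 _) (dot_le l h) (zd k).
  have q3 := ler_pM (normr_ge0 _) (normr_ge0 _) (zd h) (dot_le l k).
  have e1' : enorm k * enorm h * (2 * enorm l) = 2 * (enorm h * enorm k * enorm l) by ring.
  have e2' : enorm l * enorm h * (2 * enorm k) = 2 * (enorm h * enorm k * enorm l) by ring.
  have e3' : 2 * enorm h * (enorm l * enorm k) = 2 * (enorm h * enorm k * enorm l) by ring.
  lra.
have P2 : `|dot z h * dot z k * dot z l| <= 8 * (enorm h * enorm k * enorm l).
  rewrite !normrM.
  have q1 := ler_pM (normr_ge0 _) (normr_ge0 _) (zd h) (zd k).
  have q2 := ler_pM (mulr_ge0 (normr_ge0 _) (normr_ge0 _)) (normr_ge0 _) q1 (zd l).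
  by apply: le_trans q2 _; rewrite le_eqVlt; apply/orP; left; apply/eqP; ring.
have B2 : `|N2 e (sq z)| <= `|M2| by rewrite (le_trans (HM2 _ _ e0 e1 (s0 z)))// ler_norm.
have B3 : `|N3 e (sq z)| <= `|M3| by rewrite (le_trans (HM3 _ _ e0 e1 (s0 z)))// ler_norm.
rewrite /F3 [leRHS]mulrDl; apply: le_trans (ler_normD _ _) _; apply: lerD.
  rewrite normrM normrM ger0_norm//.
  have := ler_pM (normr_ge0 _) (normr_ge0 _) P1 B2; lra.
rewrite normrM normrM ger0_norm//.
have := ler_pM (normr_ge0 _) (normr_ge0 _) P2 B3; lra.
Qed.

End ThirdDifferences.

(** * Third differences of the solution *)

Section Limits.
Variable R : realType.
Implicit Types (u w f : V R -> R) (x y z h k l : V R).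

Lemma Ck_cst n (a : R) : Ck n (fun _ : V R => a).
Proof.
elim: n a => [|n IH] a; first by move=> x; exact: ctC.
split; first by move=> x; exact: ctC.
move=> i; split; first by move=> x; have [] := isdC a x (basis_vec R i).
by rewrite (_ : partial i _ = fun _ => 0)//; apply/funext => x; have [] := isdC a x (basis_vec R i).
Qed.

Lemma laplacian_cst (a : R) x : laplacian (laplacian (fun _ => a)) x = 0.
Proof.
have p0 (b : R) i : partial i (fun _ : V R => b) = fun _ => 0.
  by apply/funext => y; have [] := isdC b y (basis_vec R i).
rewrite /laplacian; apply: big1 => i _.
rewrite (_ : (fun _ => _) = fun _ => 0); first by rewrite !p0.
by apply/funext => y; apply: big1 => j _; rewrite !p0.
Qed.

(** The growth bound in the form in which it is used, for integrands dominated
    by a multiple of w on a ball of radius L. *)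
Lemma growth_test w : Ck 4 w -> (forall x, laplacian (laplacian w) x <= 0) -> (forall x, 0 <= w x) ->
  exists2 C : R, 0 <= C & forall (L a : R) F, 1 <= L -> 0 <= a -> continuous F ->
    (forall y, `|F y| <= a * w y) -> (forall y, L < enorm y -> F y = 0) ->
    `|I3 F| <= a * (C * L ^+ 5).
Proof.
move=> Cw Lw w0; have [C HC] := growth Cw Lw.
exists (64 * `|C|); first by rewrite mulr_ge0.
move=> L a F L1 a0 cF Fa F0.
have L0 : 0 < L by lra.
pose rho := (2 * L)^-1.
have rho0 : 0 < rho by rewrite invr_gt0; lra.
have rho1 : rho <= 1 by rewrite invf_le1; lra.
have [_ c z] := tpow_radial_facts 1 rho0.
have iw : int3 (fun y => w y * tpow 2 (1 - rho ^+ 2 * sq (y - 0))).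
  exact: (@int3_radial R (fun t => tpow 2 (1 - rho ^+ 2 * t)) 0 (rho ^+ 2)^-1 w (Ck_continuous Cw) (fun t _ => c t) z).
apply: (@le_trans _ _ (I3 (fun y => 2 * a * (w y * tpow 2 (1 - rho ^+ 2 * sq (y - 0)))))).
  apply: I3_norm_le => //; first exact: int3Z.
  move=> y; have [yL|yL] := ltP L (enorm y).
    by rewrite F0// normr0; apply: mulr_ge0; [exact: mulr_ge0|apply: mulr_ge0 => //; exact: tpow_ge0].
  apply: le_trans (Fa y) _.
  have h1 : rho ^+ 2 * sq (y - 0) <= 1 / 4.
    rewrite subr0 -sqr_enorm -exprMn; have : rho * enorm y <= 1 / 2.
      by rewrite /rho invfM -mulrA ler_pdivrMl// mulrC ler_pdivrMr//; lra.
    have : 0 <= rho * enorm y by rewrite mulr_ge0 ?enorm_ge0// ltW.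
    by move: (rho * _) => r; nra.
  have h2 : 1 / 2 <= tpow 2 (1 - rho ^+ 2 * sq (y - 0)).
    by rewrite tpow_pos; [|lra]; move: (rho ^+ 2 * _) h1 => r; nra.
  have h3 : 0 <= a * w y by rewrite mulr_ge0.
  rewrite (_ : 2 * a * _ = (a * w y) * (2 * tpow 2 (1 - rho ^+ 2 * sq (y - 0)))); last by ring.
  by rewrite ler_peMr//; lra.
rewrite I3Z//.
have := HC rho rho0 rho1; have := ler_norm C.
have -> : C / rho ^+ 5 = 32 * C * L ^+ 5.
  by rewrite /rho; field; rewrite gt_eqF.
have L5 : 0 <= L ^+ 5 by rewrite exprn_ge0// ltW.
move: (I3 _) => I Cn IC; have q := ler_wpM2r L5 Cn.
by rewrite -mulrA mulrCA ler_wpM2l//; lra.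
Qed.

(** The truncation distance is n + 1. With e = L^-5 the regularization E = e
    L^2 equals L^-3, so that the tail of the approximate identity, of order
    E^2, still wins over the growth L^5 of the integral of u. *)
Let Ln (n : nat) : R := n.+1%:R.
Let en (n : nat) : R := Ln n ^- 5.

Lemma Ln_ge1 n : 1 <= Ln n.
Proof. by rewrite ler1n. Qed.

Lemma Ln_gt0 n : 0 < Ln n.
Proof. by rewrite ltr0n. Qed.

Lemma near_Ln_ge (M : R) : \forall n \near \oo, M <= Ln n.
Proof.
exists (Num.truncn `|M|) => // n /= hn.
by rewrite (le_trans (ler_norm _))// ltW// (lt_le_trans (truncnS_gt _))// ler_nat ltnS.
Qed.

Lemma en_bounds n : 0 < en n /\ en n <= 1.
Proof.
have L1 := Ln_ge1 n; have L0 := Ln_gt0 n.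
by split; [rewrite invr_gt0 exprn_gt0|rewrite invf_le1 ?exprn_gt0// exprn_ege1].
Qed.

Lemma enLn n : en n * Ln n ^+ 2 = Ln n ^- 3.
Proof. by rewrite /en; field; rewrite gt_eqF// Ln_gt0. Qed.

Lemma Ln_inv_cvg0 : (Ln n)^-1 @[n --> \oo] --> 0.
Proof. exact: cvg_harmonic. Qed.

Lemma cutoff_continuous : continuous (@cutoff R).
Proof. exact: smooth_continuous (smooth_cutoff R). Qed.

Lemma cutoff_scaled_continuous (a : R) : continuous (fun t => cutoff (a * t)).
Proof. by move=> t; apply: (@ct_comp _ _ (@cutoff R)); [apply: ctZ; exact: ctI|exact: cutoff_continuous]. Qed.

Lemma cutoff_support n x y : 3 * Ln n + enorm x < enorm y -> cutoff (Ln n ^- 2 * sq (y - x)) = 0.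
Proof.
move=> yx; apply: cutoff0; have L0 := Ln_gt0 n.
rewrite ler_pdivlMl ?exprn_gt0// -sqr_enorm.
have := enorm_le_dist y x; rewrite ler_norml => /andP[_ h].
nra.
Qed.

Lemma int3_cutoff w n x : continuous w ->
  int3 (fun y => w y * cutoff (Ln n ^- 2 * sq (y - x))).
Proof.
move=> cw; apply: (@int3_radial R (fun t => cutoff (Ln n ^- 2 * t)) x (2 * Ln n ^+ 2)) => //.
  by move=> t _; exact: cutoff_scaled_continuous.
by move=> t h; apply: cutoff0; rewrite ler_pdivlMl ?exprn_gt0 ?Ln_gt0// mulrC ltW.
Qed.

(** At distance at least 1 from its centre the kernel is O(E^2) times the
    kernel of parameter 1, whose mass is known. *)
Lemma kern_tail (E t : R) : 0 < E -> E <= 1 -> 1 <= t -> kern E t <= 16 * E ^+ 2 * kern 1 t.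
Proof.
move=> E0 E1 t1; rewrite /kern expr1n mulr1.
have a0 : 0 < Num.sqrt (E + t) by rewrite sqrtr_gt0; lra.
have b0 : 0 < Num.sqrt (1 + t) by rewrite sqrtr_gt0; lra.
have ab : Num.sqrt (1 + t) ^+ 2 <= 2 * Num.sqrt (E + t) ^+ 2 by rewrite !sqr_sqrtr; lra.
rewrite mulrA ler_pdivrMr ?exprn_gt0// [leRHS]mulrAC ler_pdivlMr ?exprn_gt0//.
move: ab a0 b0; move: (Num.sqrt (1 + t)) (Num.sqrt (E + t)) => b a ab a0 b0.
have b4 : (b ^+ 7) ^+ 2 <= (16 * a ^+ 7) ^+ 2.
  have -> : (b ^+ 7) ^+ 2 = (b ^+ 2) ^+ 7 by ring.
  have -> : (16 * a ^+ 7) ^+ 2 = 2 * (2 * a ^+ 2) ^+ 7 by ring.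
  have b2 : 0 <= b ^+ 2 by exact: sqr_ge0.
  have : (b ^+ 2) ^+ 7 <= (2 * a ^+ 2) ^+ 7 by rewrite lerXn2r// ?nnegrE//; lra.
  have : 0 <= (2 * a ^+ 2) ^+ 7 by rewrite exprn_ge0//; lra.
  lra.
have b7 : b ^+ 7 <= 16 * a ^+ 7.
  by rewrite -ler_sqr ?nnegrE ?mulr_ge0 ?exprn_ge0// ltW.
have E2 := sqr_ge0 E.
have -> : 16 * E ^+ 2 * 15 * a ^+ 7 = 15 * E ^+ 2 * (16 * a ^+ 7) by ring.
by rewrite ler_wpM2l// mulr_ge0.
Qed.

Variables (u : V R -> R).
Hypotheses (Cu : Ck 4 u) (u0 : forall x, 0 <= u x)
  (Lu : forall x, laplacian (laplacian u) x <= 0).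

Let cu : continuous u. Proof. exact: Ck_continuous Cu. Qed.

Let K n x := I3 (fun y => u y * (kern (Ln n ^- 3) (sq (y - x)) * cutoff (Ln n ^- 2 * sq (y - x)))).

Lemma kern_cutoff_continuous (E a : R) x : 0 < E ->
  continuous (fun y => kern E (sq (y - x)) * cutoff (a * sq (y - x))).
Proof.
move=> E0 y; apply: ctM; last exact: (@radial_continuous R (fun t => cutoff (a * t)) x (fun t _ => @cutoff_scaled_continuous a t) y).
by apply: radial_continuous => t t0; exact: kern_continuous.
Qed.

Lemma int3_kern_cutoff w n x : continuous w ->
  int3 (fun y => w y * (kern (Ln n ^- 3) (sq (y - x)) * cutoff (Ln n ^- 2 * sq (y - x)))).
Proof.
move=> cw; have E0 : 0 < Ln n ^- 3 by rewrite invr_gt0 exprn_gt0// Ln_gt0.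
apply: (@int3_radial R (fun t => kern (Ln n ^- 3) t * cutoff (Ln n ^- 2 * t)) x (2 * Ln n ^+ 2)) => //.
  by move=> t t0; apply: ctM; [exact: kern_continuous|exact: cutoff_scaled_continuous].
move=> t h; rewrite cutoff0 ?mulr0//.
by rewrite ler_pdivlMl ?exprn_gt0 ?Ln_gt0// mulrC ltW.
Qed.

(** Near x the values of u are close to u x, and the kernel has mass 8 pi up
    to O(E^2). At distance at least [delta] the kernel is O(E^2) pointwise,
    and E^2 = L^-6 beats the growth L^5 of the integral of u over the support
    of the cutoff. *)
Lemma kernel_cvg x : K n x @[n --> \oo] --> 8 * pi * u x.
Proof.
have [C C0 HC] := growth_test Cu Lu u0.
have L1le y : laplacian (laplacian (fun _ : V R => (1 : R))) y <= 0 by rewrite laplacian_cst.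
have [C1 C10 HC1] := growth_test (Ck_cst 4 1) L1le (fun _ => ler01).
have pi0 := pi_ge0 R.
apply/cvgrPdist_le => eps eps0.
pose eta := eps / (16 * pi + 1).
have eta0 : 0 < eta by rewrite divr_gt0//; lra.
have cux : u y @[y --> x] --> u x by exact: cu.
move/cvgrPdist_le/(_ _ eta0): cux => /nbhs_ballP[delta /= delta0 ball_delta].
(* A / L bounds everything except the oscillation of u near x. *)
pose A := 15 / delta ^+ 7 * (C * 4 ^+ 5 + u x * (C1 * 4 ^+ 5)) + u x * (128 * pi).
have A0 : 0 <= A.
  have := u0 x => ux.
  have d7 : 0 <= 15 / delta ^+ 7 by apply: divr_ge0 => //; apply: exprn_ge0; exact: ltW.
  have c4 : 0 <= (4 : R) ^+ 5 by exact: exprn_ge0.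
  have cc4 := mulr_ge0 C0 c4; have cc14 := mulr_ge0 ux (mulr_ge0 C10 c4).
  have := mulr_ge0 d7 (addr_ge0 cc4 cc14).
  by have := mulr_ge0 ux pi0; rewrite /A; lra.
near=> n.
have L1 := Ln_ge1 n; have L0 := Ln_gt0 n.
pose E := Ln n ^- 3.
have E0 : 0 < E by rewrite invr_gt0 exprn_gt0.
have E1 : E <= 1 by rewrite invf_le1 ?exprn_gt0// exprn_ege1.
have xL : enorm x <= Ln n by near: n; exact: near_Ln_ge.
have AL : A * 2 / eps <= Ln n by near: n; exact: near_Ln_ge.
pose k y := kern E (sq (y - x)).
pose c y := cutoff (Ln n ^- 2 * sq (y - x)).
have ck : continuous k by apply: radial_continuous => t t0; exact: kern_continuous.
have cc : continuous c.
  exact: (@radial_continuous R (fun t => cutoff (Ln n ^- 2 * t)) x (fun t _ => @cutoff_scaled_continuous _ t)).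
have ckc : continuous (fun y => k y * c y) by exact: kern_cutoff_continuous.
have k0 y : 0 <= k y by exact: kern_ge0.
have c0 y : 0 <= c y by exact: cutoff_ge0.
have c1 y : c y <= 1 by exact: cutoff_le1.
have iuc : int3 (fun y => u y * c y) by exact: int3_cutoff.
have i1c : int3 (fun y => 1 * c y) by apply: (@int3_cutoff (fun _ => 1)) => y; exact: ctC.
have iukc : int3 (fun y => u y * (k y * c y)) by exact: int3_kern_cutoff.
have i1kc : int3 (fun y => 1 * (k y * c y)) by apply: (@int3_kern_cutoff (fun _ => 1)) => y; exact: ctC.
have ik : int3 k by exact: int3_kern.
have Ik : I3 k = 8 * pi by exact: I3_kern.
have supp y : 4 * Ln n < enorm y -> c y = 0 by move=> h; apply: cutoff_support; lra.
have L4 : 1 <= 4 * Ln n by lra.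
have Iuc : I3 (fun y => u y * c y) <= C * 4 ^+ 5 * Ln n ^+ 5.
  have := HC (4 * Ln n) 1 (fun y => u y * c y) L4 ler01.
  rewrite mul1r exprMn mulrA => H; apply: le_trans (ler_norm _) (H _ _ _).
  - by move=> y; apply: ctM; [exact: cu|exact: cc].
  - move=> y; have uy := u0 y; rewrite mul1r (ger0_norm (mulr_ge0 uy (c0 y))).
    by rewrite -[leRHS]mulr1; exact: ler_wpM2l (c1 y).
  - by move=> y /supp ->; rewrite mulr0.
have I1c : I3 (fun y => 1 * c y) <= C1 * 4 ^+ 5 * Ln n ^+ 5.
  have := HC1 (4 * Ln n) 1 (fun y => 1 * c y) L4 ler01.
  rewrite [X in _ -> _ -> _ -> _ <= X]mul1r exprMn [X in _ -> _ -> _ -> _ <= X]mulrA => H.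
  apply: le_trans (ler_norm _) (H _ _ _).
  - by move=> y; apply: ctZ; exact: cc.
  - by move=> y; rewrite !mul1r (ger0_norm (c0 y)).
  - by move=> y /supp ->; rewrite mulr0.
(* The oscillation of u: eta times the mass of the kernel within distance
   delta, and the pointwise bound of the kernel beyond. *)
have osc : `|I3 (fun y => u y * (k y * c y)) - u x * I3 (fun y => 1 * (k y * c y))| <=
    eta * (8 * pi) + 15 * E ^+ 2 / delta ^+ 7 * (I3 (fun y => u y * c y) + u x * I3 (fun y => 1 * c y)).
  rewrite -Ik -(I3Z _ ik) -(I3Z (u x) i1kc) -(I3Z (u x) i1c).
  rewrite -(I3D iuc (int3Z (u x) i1c)) -(I3B iukc (int3Z (u x) i1kc)).
  rewrite -(I3Z _ (int3D iuc (int3Z (u x) i1c))).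
  rewrite -(I3D (int3Z eta ik) (int3Z _ (int3D iuc (int3Z (u x) i1c)))).
  apply: I3_norm_le.
  - move=> y; apply: ctB; first by apply: ctM; [exact: cu|exact: ckc].
    by apply: ctZ; apply: ctZ; exact: ckc.
  - by apply: int3D; [exact: int3Z|apply: int3Z; apply: int3D => //; exact: int3Z].
  move=> y; have := u0 x; have := u0 y => uy ux.
  rewrite (_ : _ - _ = (u y - u x) * (k y * c y)); last by ring.
  rewrite normrM (ger0_norm (mulr_ge0 (k0 y) (c0 y))).
  have D0 : 0 <= 15 * E ^+ 2 / delta ^+ 7.
    by apply: divr_ge0; [apply: mulr_ge0 => //; exact: sqr_ge0|apply: exprn_ge0; exact: ltW].
  have [yd|yd] := ltP (enorm (y - x)) delta.
    have h1 : `|u y - u x| <= eta.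
      rewrite distrC; apply: ball_delta; rewrite -ball_normE /=.
      by apply: le_lt_trans yd; rewrite -normrN opprB; exact: norm_le_enorm.
    have h2 : k y * c y <= k y by rewrite ler_piMr.
    have h3 : 0 <= u y * c y + u x * (1 * c y).
      by rewrite mul1r; exact: addr_ge0 (mulr_ge0 uy (c0 y)) (mulr_ge0 ux (c0 y)).
    have := ler_pM (normr_ge0 _) (mulr_ge0 (k0 y) (c0 y)) h1 h2.
    by have := mulr_ge0 D0 h3; lra.
  have h1 : `|u y - u x| <= u y + u x by rewrite ler_norml; lra.
  have h2 : k y <= 15 * E ^+ 2 / delta ^+ 7.
    have sE : 0 < Num.sqrt (E + sq (y - x)) by rewrite sqrtr_gt0; have := sq_ge0 (y - x); lra.
    have E2 := sqr_ge0 E.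
    rewrite /k /kern; apply: ler_wpM2l; first exact: mulr_ge0.
    rewrite lef_pV2 ?posrE; [|exact: exprn_gt0|exact: exprn_gt0].
    rewrite lerXn2r ?nnegrE; [by []|exact: ltW|exact: ltW|].
    apply: le_trans yd _; rewrite enorm_sq ler_wsqrtr//; lra.
  have h3 := ler_wpM2r (c0 y) h2.
  have h4 := ler_pM (normr_ge0 _) (mulr_ge0 (k0 y) (c0 y)) h1 h3.
  have h5 : 0 <= eta * k y by rewrite mulr_ge0// ltW.
  rewrite (_ : 15 * E ^+ 2 / delta ^+ 7 * (u y * c y + u x * (1 * c y)) = (u y + u x) * (15 * E ^+ 2 / delta ^+ 7 * c y)); last by ring.
  lra.
(* The mass lost by the cutoff sits at distance at least L >= 1. *)
have mass : `|8 * pi - I3 (fun y => 1 * (k y * c y))| <= 128 * pi * E ^+ 2.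
  have ik1 := @int3_kern R 1 x ltr01.
  have := @I3_kern R 1 x ltr01 => Ik1.
  rewrite (_ : 128 * pi * E ^+ 2 = 16 * E ^+ 2 * (8 * pi)); last by ring.
  rewrite -{1}Ik -Ik1 -(I3Z _ ik1) -(I3B ik i1kc); apply: I3_norm_le.
  - by move=> y; apply: ctB; [exact: ck|apply: ctZ; exact: ckc].
  - exact: int3Z.
  move=> y; rewrite (_ : _ - _ = k y * (1 - c y)); last by ring.
  have h0 : 0 <= 1 - c y by have := c1 y; lra.
  rewrite (ger0_norm (mulr_ge0 (k0 y) h0)).
  have [t1|t1] := leP (Ln n ^- 2 * sq (y - x)) 1.
    rewrite /c (cutoff1 t1) subrr mulr0.
    by apply: mulr_ge0; [apply: mulr_ge0 => //; exact: sqr_ge0|exact: kern_ge0].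
  apply: (@le_trans _ _ (k y)); first by rewrite ler_piMr//; have := c0 y; lra.
  apply: kern_tail => //.
  move: t1; rewrite ltr_pdivlMl ?exprn_gt0// mulr1 => /ltW; apply: le_trans.
  exact: exprn_ege1.
have EL : E ^+ 2 * Ln n ^+ 5 = (Ln n)^-1 by rewrite /E; field; rewrite gt_eqF.
have E2 : E ^+ 2 <= (Ln n)^-1.
  rewrite /E -exprVn -exprM -[leRHS]expr1 ler_wiXn2l//; last by rewrite invf_le1.
  by rewrite invr_ge0 ltW.
have ux := u0 x.
have KE : K n x = I3 (fun y => u y * (k y * c y)) by [].
rewrite KE.
have tri : `|8 * pi * u x - I3 (fun y => u y * (k y * c y))| <=
   u x * (128 * pi * E ^+ 2) + (eta * (8 * pi) + 15 * E ^+ 2 / delta ^+ 7 * (I3 (fun y => u y * c y) + u x * I3 (fun y => 1 * c y))).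
  rewrite (_ : _ - _ = u x * (8 * pi - I3 (fun y => 1 * (k y * c y))) -
     (I3 (fun y => u y * (k y * c y)) - u x * I3 (fun y => 1 * (k y * c y)))); last by ring.
  apply: le_trans (ler_normB _ _) _; apply: lerD osc.
  by rewrite normrM (ger0_norm ux) ler_wpM2l.
apply: le_trans tri _.
have s1 : 15 * E ^+ 2 / delta ^+ 7 * (I3 (fun y => u y * c y) + u x * I3 (fun y => 1 * c y)) <=
    15 / delta ^+ 7 * (C * 4 ^+ 5 + u x * (C1 * 4 ^+ 5)) * (Ln n)^-1.
  rewrite -EL (_ : _ * (E ^+ 2 * _) = 15 * E ^+ 2 / delta ^+ 7 * (C * 4 ^+ 5 * Ln n ^+ 5 + u x * (C1 * 4 ^+ 5 * Ln n ^+ 5))); last by ring.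
  apply: ler_wpM2l.
    by apply: divr_ge0; [apply: mulr_ge0 => //; exact: sqr_ge0|apply: exprn_ge0; exact: ltW].
  by apply: lerD => //; exact: ler_wpM2l.
have s2 : u x * (128 * pi * E ^+ 2) <= u x * (128 * pi) * (Ln n)^-1.
  rewrite -[leRHS]mulrA; apply: ler_wpM2l => //; apply: ler_wpM2l => //; exact: mulr_ge0.
have s3 : eta * (8 * pi) <= eps / 2.
  rewrite /eta mulrAC ler_pdivrMr; last by lra.
  have : 0 <= eps by lra.
  by move=> ?; nra.
have s4 : A * (Ln n)^-1 <= eps / 2.
  rewrite ler_pdivrMr//; move: AL; rewrite ler_pdivrMr// => AL.
  by rewrite mulrAC ler_pdivlMr//; lra.
rewrite /A mulrDl in s4.
apply: le_trans (lerD s2 (lerD s3 s1)) _.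
by move: s4; move: (_ / Ln n) (_ / Ln n) => X Y; lra.
Unshelve. all: by end_near. Qed.

Lemma reflection_continuous x : continuous (fun y => x - y).
Proof.
move=> y; apply: (@continuousD _ _ _ (fun _ => x) (fun y : V R => - y) y); first exact: cst_continuous.
exact: (@continuousN _ _ _ (fun y : V R => y) y cvg_id).
Qed.

Lemma comp_reflection_continuous (F : V R -> R) x : continuous F -> continuous (fun y => F (x - y)).
Proof.
by move=> cF y; apply: (@continuous_comp _ _ _ (fun y => x - y)); [exact: reflection_continuous|exact: cF].
Qed.

Lemma diff3_reflect (F : V R -> R) h k l x y :
  diff3 h k l (fun x => F (x - y)) x = diff3 h k l F (x - y).
Proof. by have := diff3_scale h k l F 1 y x; rewrite !scale1r => <-; rewrite !diff3E !scale1r. Qed.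

Section FarTerm.
Variables (N : R -> R -> R) (h k l : V R).
Hypothesis uN : unif 3 N.

Let G n x y := u y * (Ln n ^- 3 * N (en n) (Ln n ^- 2 * sq (y - x))).

Lemma int3_far n x : int3 (G n x).
Proof.
have [N0 Nz Nc] := unif_unif0 uN; have [e0 e1] := en_bounds n; have L0 := Ln_gt0 n.
have L2 : 0 < Ln n ^+ 2 by rewrite exprn_gt0.
apply: (@int3_radial R (fun t => Ln n ^- 3 * N (en n) (Ln n ^- 2 * t)) x (2 * Ln n ^+ 2) u cu).
  move=> t t0; apply: ctZ; apply: (@ct_comp _ _ (N (en n))); first by apply: ctZ; exact: ctI.
  by apply: Nc => //; apply: mulr_ge0 => //; rewrite invr_ge0 ltW.
by move=> t t2; rewrite Nz ?mulr0//; right; rewrite ltr_pdivlMl// mulrC.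
Qed.

(** The error term varies at scale L, so third differences in x turn its size
    L^-3 into L^-6, which beats the growth L^5 of the integral of u. *)
Lemma far_cvg0 x : diff3 h k l (fun x => I3 (G n x)) x @[n --> \oo] --> 0.
Proof.
have [C C0 HC] := growth_test Cu Lu u0.
have [M M0 HM] := unif_diff3 uN.
have [_ _ Nc] := unif_unif0 uN.
pose P := enorm h * enorm k * enorm l.
have P0 : 0 <= P by rewrite /P !mulr_ge0 ?enorm_ge0.
pose S := enorm h + enorm k + enorm l.
pose Q := M * P * (C * 4 ^+ 5).
have Q0 : 0 <= Q by apply: mulr_ge0; apply: mulr_ge0 => //; exact: exprn_ge0.
apply/cvgrPdist_le => eps eps0; near=> n.
have L1 := Ln_ge1 n; have L0 := Ln_gt0 n; have [e0 e1] := en_bounds n.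
have xL : enorm x <= Ln n by near: n; exact: near_Ln_ge.
have SL : S <= Ln n by near: n; exact: near_Ln_ge.
have QL : Q / eps <= Ln n by near: n; exact: near_Ln_ge.
have [_ ->] := diff3_I3 h k l x (int3_far n).
pose H y := diff3 ((Ln n)^-1 *: h) ((Ln n)^-1 *: k) ((Ln n)^-1 *: l)
  (fun z => N (en n) (sq z)) ((Ln n)^-1 *: (x - y)).
have E y : diff3 h k l (G n ^~ y) x = u y * (Ln n ^- 3 * H y).
  rewrite /H -diff3_scale -!diff3Z; congr diff3; apply/funext => z.
  by rewrite /G sqZ -[in sq (z - y)]opprB sqN exprVn.
rewrite (_ : (fun y => _) = fun y => u y * (Ln n ^- 3 * H y)); last by apply/funext.
have L4 : 1 <= 4 * Ln n by lra.
have i0 : 0 <= (Ln n)^-1 by rewrite invr_ge0 ltW.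
have cH : continuous H.
  move=> y; apply: (@continuous_comp _ _ _ (fun y => (Ln n)^-1 *: (x - y))).
    by apply: (@continuous_comp _ _ _ (fun y => x - y) (fun z : V R => (Ln n)^-1 *: z));
      [exact: reflection_continuous|exact: scaler_continuous].
  apply: diff3_continuous => z.
  rewrite (_ : (fun z => _) = (fun z => N (en n) (sq (z - 0)))); last by apply/funext => w; rewrite subr0.
  by apply: radial_continuous => t t0; exact: Nc.
have PE : enorm ((Ln n)^-1 *: h) * enorm ((Ln n)^-1 *: k) * enorm ((Ln n)^-1 *: l) = Ln n ^- 3 * P.
  by rewrite !enormZ !ger0_norm// /P; field; rewrite gt_eqF.
have SE : enorm ((Ln n)^-1 *: h) + enorm ((Ln n)^-1 *: k) + enorm ((Ln n)^-1 *: l) = (Ln n)^-1 * S.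
  by rewrite !enormZ !ger0_norm// /S !mulrDr.
have := HC (4 * Ln n) (Ln n ^- 6 * (M * P)) (fun y => u y * (Ln n ^- 3 * H y)) L4.
have q0 : 0 <= Ln n ^- 6 * (M * P).
  by apply: mulr_ge0; [rewrite invr_ge0 exprn_ge0// ltW|exact: mulr_ge0].
move=> /(_ q0) HH; rewrite sub0r normrN; apply: le_trans (HH _ _ _) _.
- by move=> y; apply: ctM; [exact: cu|apply: ctZ; exact: cH].
- move=> y; rewrite normrM (ger0_norm (u0 y)) mulrC; apply: ler_wpM2r => //.
  have [hb _] := HM _ e0 e1 ((Ln n)^-1 *: h) ((Ln n)^-1 *: k) ((Ln n)^-1 *: l) ((Ln n)^-1 *: (x - y)).
  rewrite PE in hb.
  have i3 : 0 <= Ln n ^- 3 by rewrite invr_ge0 exprn_ge0// ltW.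
  rewrite normrM (ger0_norm i3); apply: le_trans (ler_wpM2l i3 hb) _.
  by rewrite le_eqVlt; apply/orP; left; apply/eqP; field; rewrite gt_eqF.
- move=> y hy; have [_ hz] := HM _ e0 e1 ((Ln n)^-1 *: h) ((Ln n)^-1 *: k) ((Ln n)^-1 *: l) ((Ln n)^-1 *: (x - y)).
  rewrite /H hz ?mulr0// SE enormZ ger0_norm// [ltRHS]mulrC ltr_pdivlMr//.
  rewrite mulrDl mulrAC mulVf ?gt_eqF// mul1r.
  have := enorm_le_dist y x; rewrite enorm_distC ler_norml => /andP[_ hd]; lra.
rewrite exprMn (_ : _ * _ = Q * (Ln n)^-1); last by rewrite /Q; field; rewrite gt_eqF.
by rewrite ler_pdivrMr// mulrC -ler_pdivrMr.
Unshelve. all: by end_near. Qed.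
End FarTerm.

Section PotentialTerm.
Variables (h k l : V R).

Let Psi n z := Num.sqrt (Ln n ^- 3 + sq z) * cutoff (Ln n ^- 2 * sq z).

Lemma truncated_norm_continuous n : continuous (Psi n).
Proof.
have E0 : 0 < Ln n ^- 3 by rewrite invr_gt0 exprn_gt0// Ln_gt0.
rewrite (_ : Psi n = fun z => (fun t => Num.sqrt (Ln n ^- 3 + t) * cutoff (Ln n ^- 2 * t)) (sq (z - 0))); last first.
  by apply/funext => z /=; rewrite subr0.
apply: (@radial_continuous R (fun t => Num.sqrt (Ln n ^- 3 + t) * cutoff (Ln n ^- 2 * t))) => t t0.
apply: ctM; last exact: cutoff_scaled_continuous.
exact: isd_continuous (sqrt_is_derive E0 t0).
Qed.

Lemma truncated_norm_cvg z : Psi n z @[n --> \oo] --> enorm z.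
Proof.
have c1 : \forall n \near \oo, Psi n z = Num.sqrt (Ln n ^- 3 + sq z).
  near=> n; rewrite /Psi cutoff1 ?mulr1//.
  have L1 := Ln_ge1 n; have L0 := Ln_gt0 n.
  have sL : sq z <= Ln n by near: n; exact: near_Ln_ge.
  by rewrite ler_pdivrMl ?exprn_gt0// mulr1; nra.
suff H : Num.sqrt (Ln n ^- 3 + sq z) @[n --> \oo] --> enorm z.
  apply: cvg_trans H; apply: near_eq_cvg; near=> n; apply/esym; near: n; exact: c1.
rewrite enorm_sq -[X in Num.sqrt X]add0r.
apply: (@cvg_comp _ _ _ (fun n => Ln n ^- 3 + sq z) (@Num.sqrt R)); last exact: sqrt_continuous.
apply: cvgD; last exact: cvg_cst.
rewrite (_ : (fun n => _) = fun n => ((Ln n)^-1) ^+ 3); last by apply/funext => n; rewrite exprVn.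
have H : (Ln n)^-1 ^+ 3 @[n --> \oo] --> (0 : R) ^+ 3.
  by apply: (@cvg_comp _ _ _ (fun n => (Ln n)^-1) (fun r : R => r ^+ 3)); [exact: Ln_inv_cvg0|exact: exprn_continuous].
by rewrite expr0n in H.
Unshelve. all: by end_near. Qed.

(** The gradient of sqrt(E + |z|^2) has length at most 1. The derivative of
    the cutoff contributes only for |z| at most 2 L, where it is at most of
    order |z| / L^2 and is multiplied by a factor of order L. *)
Lemma truncated_norm_lipschitz : exists2 B : R, 0 <= B & forall n z m, `|diff m (Psi n) z| <= B * enorm m.
Proof.
have [d [B [d0 dd dc dz dB]]] := @cutoff_seq R.
exists (1 + 8 * `|B|); first by have := normr_ge0 B; lra.
move=> n z m; have L1 := Ln_ge1 n; have L0 := Ln_gt0 n.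
have E0 : 0 < Ln n ^- 3 by rewrite invr_gt0 exprn_gt0.
have E1 : Ln n ^- 3 <= 1 by rewrite invf_le1 ?exprn_gt0// exprn_ege1.
pose s (w : V R) := Num.sqrt (Ln n ^- 3 + sq w).
pose F' (w : V R) := 2 * dot w m * ((2 * s w)^-1 * d 0%N (Ln n ^- 2 * sq w) + s w * (Ln n ^- 2 * d 1%N (Ln n ^- 2 * sq w))).
have dPsi (w : V R) : is_derive w m (Psi n) (F' w).
  have H : is_derive (sq w) 1 (fun t => Num.sqrt (Ln n ^- 3 + t) * d 0%N (Ln n ^- 2 * t))
     ((2 * s w)^-1 * d 0%N (Ln n ^- 2 * sq w) + s w * (Ln n ^- 2 * d 1%N (Ln n ^- 2 * sq w))).
    apply: (is_derive_eq (isdM (sqrt_is_derive E0 (sq_ge0 w)) (isd_comp (isdZ (Ln n ^- 2) (isdI (sq w))) (dd 0%N isT _)))).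
    by rewrite /s; ring.
  have := comp_sq_is_derive m H.
  rewrite (_ : (fun y => _) = Psi n)//.
  by apply/funext => y; rewrite /Psi d0.
have [th _ ->] := diff_mvt z dPsi.
move: (z + th *: m) => w.
have qw : 0 < Ln n ^- 3 + sq w by exact: ltr_wpDr (sq_ge0 w) E0.
have sw : 0 < s w by rewrite sqrtr_gt0.
have ew := enorm_ge0 w; have em := enorm_ge0 m.
have ws : enorm w <= s w by rewrite enorm_sq ler_wsqrtr// lerDr ltW.
have dm := dot_le w m.
have T1 : `|2 * dot w m * ((2 * s w)^-1 * d 0%N (Ln n ^- 2 * sq w))| <= enorm m.
  rewrite (_ : _ * _ = dot w m * d 0%N (Ln n ^- 2 * sq w) / s w); last by field; rewrite gt_eqF.
  rewrite d0 normrM normfV (gtr0_norm sw) ler_pdivrMr// normrM.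
  rewrite (ger0_norm (cutoff_ge0 _)).
  apply: (@le_trans _ _ (enorm w * enorm m * 1)).
    by apply: ler_pM => //; [exact: cutoff_ge0|exact: cutoff_le1].
  by rewrite mulr1 mulrC ler_wpM2l.
have T2 : `|2 * dot w m * (s w * (Ln n ^- 2 * d 1%N (Ln n ^- 2 * sq w)))| <= 8 * `|B| * enorm m.
  have [big|sm] := ltP 2 (Ln n ^- 2 * sq w).
    rewrite dz//; last by right.
    by rewrite !mulr0 normr0; apply: mulr_ge0 => //; apply: mulr_ge0.
  have {}sm : sq w <= 2 * Ln n ^+ 2 by move: sm; rewrite ler_pdivrMl ?exprn_gt0// mulrC.
  have s2 : s w <= 2 * Ln n.
    rewrite -ler_sqr ?nnegrE; [|exact: ltW|by lra].
    rewrite sqr_sqrtr; last exact: ltW.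
    by apply: le_trans (lerD E1 sm) _; nra.
  have i2 : 0 <= Ln n ^- 2 by rewrite invr_ge0 sqr_ge0.
  have dB1 : `|d 1%N (Ln n ^- 2 * sq w)| <= `|B|.
    by apply: le_trans (ler_norm B); apply: dB => //; apply: mulr_ge0 => //; exact: sq_ge0.
  rewrite !normrM (ger0_norm i2) (gtr0_norm sw) (ger0_norm (ler0n R 2)).
  have ds : `|dot w m| * s w <= 4 * Ln n ^+ 2 * enorm m.
    apply: (@le_trans _ _ ((2 * Ln n * enorm m) * (2 * Ln n))); last by nra.
    apply: ler_pM => //; [exact: ltW|]; apply: le_trans dm _.
    by apply: ler_wpM2r => //; exact: le_trans s2.
  have := ler_pM (mulr_ge0 (normr_ge0 _) (ltW sw)) (normr_ge0 _) ds dB1 => q.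
  have := ler_wpM2l i2 q.
  rewrite (_ : Ln n ^- 2 * (4 * Ln n ^+ 2 * enorm m * `|B|) = 4 * enorm m * `|B|); last by field; rewrite gt_eqF.
  move: (dot w m) (s w) (Ln n ^- 2) (enorm m) (d _ _) => a1 a2 a4 a6 a3; lra.
rewrite /F' mulrDr [leRHS]mulrDl mul1r; apply: le_trans (ler_normD _ _) _; exact: lerD T1 T2.
Qed.

Lemma diff3_le (B : R) F x : (forall z m, `|diff m F z| <= B * enorm m) ->
  `|diff3 h k l F x| <= 4 * (B * enorm l).
Proof.
move=> FB; have -> : diff3 h k l F x = diff l F (x + h + k) - diff l F (x + h) - (diff l F (x + k) - diff l F x) by [].
have := FB (x + h + k) l; have := FB (x + h) l; have := FB (x + k) l; have := FB x l.
rewrite !ler_norml; lra.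
Qed.

Hypothesis iLu : int3 (fun y => laplacian (laplacian u) y).

Let P n x := I3 (fun y => laplacian (laplacian u) y *
  (Num.sqrt (en n * Ln n ^+ 2 + sq (y - x)) * cutoff (Ln n ^- 2 * sq (y - x)))).

Let cLu : continuous (fun y => laplacian (laplacian u) y).
Proof. by apply: Ck_continuous; exact: (Ck_laplacian (Ck_laplacian Cu)). Qed.

(** Dominated convergence: since the truncated norms have a common Lipschitz
    constant, their third differences are bounded uniformly in y and n, and
    the bi-Laplacian of u is integrable. *)
Lemma potential_cvg x : diff3 h k l (P n) x @[n --> \oo] -->
  I3 (fun y => laplacian (laplacian u) y * diff3 h k l (fun x => enorm (x - y)) x).
Proof.
have [B B0 HB] := truncated_norm_lipschitz.
have PE n : P n = fun x => I3 (fun y => laplacian (laplacian u) y * Psi n (x - y)).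
  by apply/funext => z; congr I3; apply/funext => y; rewrite enLn -opprB sqN.
have E n : diff3 h k l (P n) x = I3 (fun y => laplacian (laplacian u) y * diff3 h k l (Psi n) (x - y)).
  rewrite PE; have [|_ ->] := @diff3_I3 R h k l (fun x y => laplacian (laplacian u) y * Psi n (x - y)) x.
    move=> z; rewrite (_ : (fun y => _) = (fun y => laplacian (laplacian u) y *
      (Num.sqrt (Ln n ^- 3 + sq (y - z)) * cutoff (Ln n ^- 2 * sq (y - z))))); last first.
      by apply/funext => y; rewrite /Psi -opprB sqN.
    have E0 : 0 < Ln n ^- 3 by rewrite invr_gt0 exprn_gt0// Ln_gt0.
    apply: (@int3_radial R (fun t => Num.sqrt (Ln n ^- 3 + t) * cutoff (Ln n ^- 2 * t)) z (2 * Ln n ^+ 2)) => //.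
      move=> t t0; apply: ctM; last exact: cutoff_scaled_continuous.
      exact: isd_continuous (sqrt_is_derive E0 t0).
    by move=> t t2; rewrite cutoff0 ?mulr0// ler_pdivlMl ?exprn_gt0 ?Ln_gt0// mulrC ltW.
  by congr I3; apply/funext => y; rewrite diff3Z diff3_reflect.
rewrite (_ : (fun n => _) = fun n => I3 (fun y => laplacian (laplacian u) y * diff3 h k l (Psi n) (x - y))); last exact/funext.
rewrite (_ : (fun y => _) = fun y => laplacian (laplacian u) y * diff3 h k l (@enorm R) (x - y)); last first.
  by apply/funext => y; rewrite diff3_reflect.
apply: (@I3_dominated_cvg R _ _ (fun y => - (4 * (B * enorm l)) * laplacian (laplacian u) y)).
- move=> n y; apply: ctM; first exact: cLu.
  by apply: comp_reflection_continuous; apply: diff3_continuous; exact: truncated_norm_continuous.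
- move=> y; apply: ctM; first exact: cLu.
  by apply: comp_reflection_continuous; apply: diff3_continuous; exact: enorm_continuous.
- exact: int3Z.
- move=> n y; rewrite normrM (ler0_norm (Lu y)) mulrC mulNr -mulrN; apply: ler_wpM2r.
    by rewrite oppr_ge0; exact: Lu.
  exact: diff3_le.
- by move=> y; apply: cvgM; [exact: cvg_cst|apply: diff3_cvg => z; exact: truncated_norm_cvg].
Qed.

(** Passing to the limit in [regularized_kernel] after taking third
    differences: the approximate identity returns u, the error disappears, and
    the truncated norm becomes the norm. *)
Lemma diff3_representation x : 8 * pi * diff3 h k l u x =
  - I3 (fun y => laplacian (laplacian u) y * diff3 h k l (fun x => enorm (x - y)) x).
Proof.
have [N [uN HN]] := regularized_kernel R.
rewrite -diff3Z.
have H1 : diff3 h k l (K n) x @[n --> \oo] --> diff3 h k l (fun x => 8 * pi * u x) x.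
  by apply: diff3_cvg => z; exact: kernel_cvg.
have H2 : diff3 h k l (K n) x @[n --> \oo] --> 0 -
    I3 (fun y => laplacian (laplacian u) y * diff3 h k l (fun x => enorm (x - y)) x).
  have E n : diff3 h k l (K n) x = diff3 h k l (fun x => I3 (fun y => u y * (Ln n ^- 3 * N (en n) (Ln n ^- 2 * sq (y - x))))) x
     - diff3 h k l (P n) x.
    rewrite -diff3B; congr diff3; apply/funext => z.
    have [e0 _] := en_bounds n.
    by rewrite -(HN u z (Ln n) (en n) Cu e0 (Ln_gt0 n)) enLn.
  rewrite (funext E).
  by apply: cvgB; [exact: far_cvg0|exact: potential_cvg].
by rewrite -[RHS]sub0r; apply: (cvg_unique _ H1 H2).
Qed.
End PotentialTerm.
End Limits.

(** * The potential of an integrable density *)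

Section Potential.
Variable R : realType.
Implicit Types (x y z h k l : V R).
Variable f : V R -> R.
Hypotheses (cf : continuous f) (f0 : forall y, 0 <= f y) (if_ : int3 f).

Let Lk (n : nat) : R := n.+1%:R.
Let far n y := 1 - cutoff (Lk n ^- 2 * sq y).

Lemma far_continuous n : continuous (far n).
Proof.
move=> y; apply: ctB; first exact: ctC.
rewrite (_ : (fun y => _) = fun y => cutoff (Lk n ^- 2 * sq (y - 0))); last by apply/funext => z; rewrite subr0.
apply: (@radial_continuous R (fun t => cutoff (Lk n ^- 2 * t))) => t t0.
by apply: (@ct_comp _ _ (@cutoff R)); [apply: ctZ; exact: ctI|exact: cutoff_continuous].
Qed.

Lemma far_ge0 n y : 0 <= far n y.
Proof. by rewrite subr_ge0 cutoff_le1. Qed.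

Lemma far_le1 n y : far n y <= 1.
Proof. by rewrite gerBl cutoff_ge0. Qed.

Lemma far_eq1 n y : 2 * Lk n <= enorm y -> far n y = 1.
Proof.
move=> yL; rewrite /far cutoff0 ?subr0//; have L0 := Ln_gt0 R n.
by rewrite ler_pdivlMl ?exprn_gt0// -sqr_enorm; nra.
Qed.

Lemma near_le n y : far n y < 1 -> enorm y <= 2 * Lk n.
Proof. by move=> h; rewrite leNgt; apply/negP => /ltW/far_eq1 e; rewrite e ltxx in h. Qed.

(** The mass of [f] at distance more than about n from the origin, with a
    continuous weight in place of an indicator function. *)
Definition tail n := I3 (fun y => f y * far n y).

Lemma int3_tail n : int3 (fun y => f y * far n y).
Proof.
apply: (int3_le _ _ if_); first by move=> y; apply: ctM; [exact: cf|exact: far_continuous].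
by move=> y; rewrite ger0_norm ?mulr_ge0 ?far_ge0// ler_piMr// far_le1.
Qed.

Lemma tail_cvg0 : tail n @[n --> \oo] --> 0.
Proof.
have z : I3 (fun _ : V R => 0) = 0 :> R by rewrite /I3 /Rintegral integral0.
rewrite -z; apply: (@I3_dominated_cvg R _ _ f) => //.
- by move=> n y; apply: ctM; [exact: cf|exact: far_continuous].
- by move=> y; exact: ctC.
- by move=> n y; rewrite ger0_norm ?mulr_ge0 ?far_ge0// ler_piMr// far_le1.
move=> y; apply: cvg_near_cst; near=> n.
rewrite /far cutoff1 ?subrr ?mulr0//.
have L1 := Ln_ge1 R n; have L0 := Ln_gt0 R n.
have sL : sq y <= Lk n by near: n; exact: near_Ln_ge.
by rewrite ler_pdivrMl ?exprn_gt0// mulr1; nra.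
Unshelve. all: by end_near. Qed.

Let G x y := f y * (enorm (x - y) - enorm y).
(** Subtracting |y| makes the kernel bounded in y, by |x|, so that
    integrability of [f] is enough. *)
Definition potential x := I3 (G x).

Lemma dist_lipschitz x z y : `|enorm (x - y) - enorm (z - y)| <= enorm (x - z).
Proof. by apply: le_trans (enorm_le_dist _ _) _; rewrite opprB addrA subrK. Qed.

Lemma dist0_lipschitz x y : `|enorm (x - y) - enorm y| <= enorm x.
Proof. by have := dist_lipschitz x 0 y; rewrite sub0r enormN subr0. Qed.

Lemma dist_continuous x : continuous (fun y => enorm (x - y)).
Proof. by apply: comp_reflection_continuous; exact: enorm_continuous. Qed.

Lemma int3_potential x : int3 (G x).
Proof.
apply: (@int3_le R _ (fun y => enorm x * f y)); last exact: int3Z.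
  move=> y; apply: ctM; [exact: cf|apply: ctB; [exact: dist_continuous|exact: enorm_continuous]].
by move=> y; rewrite normrM ger0_norm// mulrC ler_wpM2r// dist0_lipschitz.
Qed.

Lemma potential_le x : potential x <= I3 f * enorm x.
Proof.
rewrite mulrC -I3Z//; apply: I3_le; [exact: int3_potential|exact: int3Z|].
move=> y; rewrite /G mulrC ler_wpM2r//; apply: le_trans (ler_norm _) (dist0_lipschitz x y).
Qed.

Lemma potential_lipschitz x z : `|potential x - potential z| <= I3 f * enorm (x - z).
Proof.
rewrite -I3B; [|exact: int3_potential|exact: int3_potential].
rewrite [leRHS]mulrC -I3Z//; apply: I3_norm_le; last first.
- move=> y; rewrite /G -mulrBr normrM ger0_norm// mulrC ler_wpM2r//.
  rewrite (_ : _ - _ = enorm (x - y) - enorm (z - y)); first exact: dist_lipschitz.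
  by ring.
- exact: int3Z.
by move=> y; apply: ctB; (apply: ctM; [exact: cf|apply: ctB; [exact: dist_continuous|exact: enorm_continuous]]).
Qed.

Lemma potential_continuous : continuous potential.
Proof.
move=> x; apply/(@cvgrPdist_le _ _ _ (nbhs x) _) => eps eps0.
pose M := I3 f + 1; have I0 : 0 <= I3 f by exact: I3_ge0.
have M0 : 0 < M by rewrite /M; lra.
have e0 : 0 < eps / M by rewrite divr_gt0.
have ce : enorm (x - y) @[y --> x] --> 0.
  by have := @dist_continuous x x; rewrite /continuous_at subrr enorm0.
move/cvgrPdist_le/(_ _ e0): ce; apply: filterS => y.
rewrite sub0r normrN ger0_norm ?enorm_ge0// ler_pdivlMr// => h.
apply: le_trans (potential_lipschitz x y) _; apply: le_trans h.
by rewrite mulrC ler_wpM2l ?enorm_ge0// /M; lra.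
Qed.

Lemma potential_diff3 h k l x :
  diff3 h k l potential x = I3 (fun y => f y * diff3 h k l (fun x => enorm (x - y)) x).
Proof.
have [_ ->] := diff3_I3 h k l x int3_potential.
by congr I3; apply/funext => y; rewrite /G diff3Z diff3B diff3_cst subr0.
Qed.

(** The error | |x - y| - |y| - |x| | is at most 2 |y|, which serves for y
    near the origin, and at most 2 |x|, which serves for the small mass far
    away. *)
Lemma potential_asymptotic n x :
  `|potential x - I3 f * enorm x| <= 4 * Lk n * I3 f + 2 * tail n * enorm x.
Proof.
have it := int3_tail n; have L0 := Ln_gt0 R n.
rewrite /potential [I3 f * _]mulrC -(I3Z (enorm x) if_) -(I3B (int3_potential x) (int3Z _ if_)).
rewrite [2 * tail n * _]mulrAC /tail.
rewrite -(I3Z (4 * Lk n) if_) -(I3Z (2 * enorm x) it) -(I3D (int3Z _ if_) (int3Z _ it)).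
apply: I3_norm_le.
- move=> y; apply: ctB; last by apply: ctZ; exact: cf.
  by apply: ctM; [exact: cf|apply: ctB; [exact: dist_continuous|exact: enorm_continuous]].
- by apply: int3D; exact: int3Z.
move=> y; rewrite (_ : G x y - _ = f y * (enorm (x - y) - enorm y - enorm x)); last by rewrite /G; ring.
rewrite [leRHS](_ : _ = f y * (4 * Lk n + 2 * enorm x * far n y)); last by ring.
rewrite normrM ger0_norm// ler_wpM2l//.
have := dist0_lipschitz x y; have := dist_lipschitz 0 x y.
rewrite !sub0r !enormN => h1 h2.
have ex := enorm_ge0 x; have ey := enorm_ge0 y; have fg := far_ge0 n y.
have [h|h] := ltP (far n y) 1.
  have yl := near_le h; have := enorm_le_dist (x - y) x.
  rewrite addrAC subrr sub0r enormN; rewrite ler_norml => /andP[h3 h4].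
  have : 0 <= enorm x * far n y by exact: mulr_ge0.
  by rewrite ler_norml; move: h2; rewrite ler_norml => /andP[h5 h6]; lra.
have -> : far n y = 1 by apply/eqP; rewrite eq_le far_le1.
by move: h2; rewrite !ler_norml => /andP[h5 h6]; lra.
Qed.

(** The box has side 2, hence measure 8. If [f] is at least c0 > 0 on boxes
    arbitrarily far out, this contradicts [tail_cvg0]. *)
Lemma tail_box n c0 (p : R * R * R) : 0 <= c0 ->
  (forall y, (forall i, `|y i 0 - vec3 p i 0| <= 1) -> c0 <= f y /\ far n y = 1) ->
  8 * c0 <= tail n.
Proof.
move=> c00 H; case: p H => [[a b] c] H.
have mb := measurable_box a b c 1.
rewrite -lee_fin -(I3_EFin (int3_tail n)).
have -> : ((8 * c0)%:E = \int[mu3 R]_(q in box a b c 1) (cst c0%:E) q)%E.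
  rewrite integral_cst//; apply/esym.
  apply: (etrans (congr2 mule (erefl _) (@mu3_box R a b c 1 ler01))).
  by rewrite -EFinM; congr EFin; ring.
rewrite integral_mkcond.
apply: ge0_le_integral => //.
- by move=> q _; rewrite patchE; case: ifP => // _; rewrite lee_fin.
- by apply/(measurable_restrictT _ mb); exact: measurable_cst.
- apply/measurable_EFinP; apply: (@measurable_continuous_vec3 R (fun y => f y * far n y)) => y.
  by apply: ctM; [exact: cf|exact: far_continuous].
move=> q _; rewrite patchE; case: ifPn => [|_]; last by rewrite lee_fin mulr_ge0// far_ge0.
rewrite inE => -[[/= q1 q2] q3]; rewrite lee_fin.
have [] := H (vec3 q); last by move=> h ->; rewrite mulr1.
apply: all3; rewrite !mxE !inordK//= ler_norml.
- by move: q1; rewrite in_itv /=; lra.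
- by move: q2; rewrite in_itv /=; lra.
- by move: q3; rewrite in_itv /=; lra.
Qed.

End Potential.

(** * Functions with vanishing third differences *)

Section Frechet.
Variable R : realType.
Implicit Types (x y z h k l : V R).

(** Cauchy's functional equation: additivity gives homogeneity for rational
    factors, and density of the rationals gives the rest. *)
Lemma additive_linear (g : V R -> R) : continuous g -> (forall x y, g (x + y) = g x + g y) ->
  forall a x, g (a *: x) = a * g x.
Proof.
move=> cg gD a x.
have g0 : g 0 = 0 by have := gD 0 0; rewrite addr0; lra.
have gN y : g (- y) = - g y by have := gD y (- y); rewrite subrr g0; lra.
have gn n y : g (n%:R *: y) = n%:R * g y.
  elim: n => [|n IH]; first by rewrite scale0r mul0r.
  by rewrite -natr1 scalerDl mulrDl gD IH !scale1r mul1r.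
have gz (m : int) y : g (m%:~R *: y) = m%:~R * g y.
  by case: m => n; rewrite ?NegzE ?mulrNz ?scaleNr ?gN ?mulNr -pmulrn gn.
have gq (r : rat) : g (ratr r *: x) = ratr r * g x.
  have d0 : (denq r)%:~R != 0 :> R by rewrite intr_eq0 denq_neq0.
  have E : (denq r)%:~R * ratr r = (numq r)%:~R :> R by rewrite /ratr mulrC divfK.
  apply: (mulfI d0); rewrite -gz scalerA E gz -E; ring.
pose phi (t : R) := g (t *: x) - t * g x.
have cphi : continuous phi.
  move=> t; apply: ctB; last by apply: ctM; [exact: ctI|exact: ctC].
  apply: (@continuous_comp _ _ _ (fun t : R => t *: x) g); last exact: cg.
  exact: scalel_continuous.
suff : phi a = 0 by rewrite /phi => /eqP; rewrite subr_eq0 => /eqP.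
apply/eqP; rewrite -normr_le0; apply/ler_addgt0Pr => eps eps0; rewrite add0r.
have /nbhs_ballP[del /= del0 Hdel] : \forall t \near a, `|phi a - phi t| <= eps.
  by have := cphi a; move/cvgrPdist_le/(_ _ eps0).
have [|r] := @rat_in_itvoo R (a - del) (a + del); first by lra.
rewrite in_itv /= => /andP[r1 r2].
have := Hdel (ratr r); rewrite /phi gq subrr subr0; apply.
by rewrite /ball /= ltr_norml; lra.
Qed.

Lemma vec_basis x : x = x (inord 0) 0 *: basis_vec R (inord 0) + x (inord 1) 0 *: basis_vec R (inord 1) +
  x (inord 2) 0 *: basis_vec R (inord 2).
Proof.
apply/matrixP => i j; rewrite ord1 {j}; move: i; apply: all3; rewrite !mxE -!val_eqE /= !inordK//=; ring.
Qed.

(** The second difference B(h, k) of D at the origin is additive in each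
    variable, because its own difference in k is a third difference of D; by
    continuity it is bilinear. Subtracting half of B(x, x) leaves an additive,
    hence linear, function. *)
Lemma frechet (D : V R -> R) : continuous D -> (forall h k l, diff3 h k l D 0 = 0) ->
  exists (S : 'M[R]_3) (b : V R), S^T = S /\ forall x, D x = D 0 + dot b x + dot x (S *m x).
Proof.
move=> cD D3.
pose B h k := D (h + k) - D h - D k + D 0.
have BC h k : B h k = B k h by rewrite /B [h + k]addrC; ring.
have BD h k l : B h (k + l) = B h k + B h l.
  have := D3 h k l; rewrite diff3E !add0r /B addrA => E.
  lra.
have cB h : continuous (B h).
  move=> k; apply: ctD; last exact: ctC.
  apply: ctB; last exact: cD.
  apply: ctB; last exact: ctC.
  apply: (@continuous_comp _ _ _ (fun k => h + k) D); last exact: cD.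
  by apply: (@continuousD _ _ _ (fun _ => h) (fun y : V R => y) k); [exact: cst_continuous|exact: cvg_id].
have BZ h a k := additive_linear (cB h) (BD h) a k.
pose L x := D x - D 0 - 1 / 2 * B x x.
have LD x y : L (x + y) = L x + L y.
  have E : D (x + y) = B x y + D x + D y - D 0 by rewrite /B; ring.
  rewrite /L BD [B (x + y) x]BC [B (x + y) y]BC !BD [B y x]BC E; lra.
have cL : continuous L.
  move=> x; rewrite (_ : L = fun x => D x - D 0 - 1 / 2 * (D (2 *: x) - D x - D x + D 0)); last first.
    by apply/funext => z; rewrite /L /B scaler_nat mulr2n.
  have c2 : continuous_at x (fun x => D (2 *: x)).
    by apply: (@continuous_comp _ _ _ (fun y : V R => 2 *: y) D); [exact: scaler_continuous|exact: cD].
  apply: ctB; first by apply: ctB; [exact: cD|exact: ctC].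
  by apply: ctZ; apply: ctD; [do 2!(apply: ctB; last exact: cD)|exact: ctC].
have LZ := additive_linear cL LD.
pose e := basis_vec R.
exists (\matrix_(i, j) (1 / 2 * B (e i) (e j))), (\col_i L (e i)); split.
  by apply/matrixP => i j; rewrite !mxE BC.
move=> x.
have -> : D x = D 0 + L x + 1 / 2 * B x x by rewrite /L; ring.
congr (_ + _ + _).
  by rewrite {1}(vec_basis x) !LD !LZ dotE !mxE; ring.
have BDl h k l : B (h + k) l = B h l + B k l by rewrite BC BD ![B l _]BC.
have BZl a h k : B (a *: h) k = a * B h k by rewrite BC BZ BC.
rewrite {1 2}(vec_basis x) !BD !BDl !BZ !BZl dotE !mxE !sum3 !mxE -/e.
ring.
Qed.
End Frechet.

(** * Diagonalization of quadratic forms by rotations *)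

Section Diagonalization.
Variable R : realType.
Implicit Types (x y z a b p v w : V R).

Lemma sq_continuous : continuous (@sq R).
Proof.
rewrite (_ : @sq R = fun y => sq (y - 0)); first exact: sq_sub_continuous.
by apply/funext => y; rewrite subr0.
Qed.

Lemma dot_continuous p : continuous (fun x => dot x p).
Proof.
move=> x; rewrite (_ : (fun _ => _) = fun x => x (inord 0) 0 * p (inord 0) 0 + x (inord 1) 0 * p (inord 1) 0 +
  x (inord 2) 0 * p (inord 2) 0); last by apply/funext => y; rewrite dotE.
by apply: ctD; [apply: ctD|]; (apply: ctM; [exact: coord_continuous|exact: ctC]).
Qed.

Lemma sq_dot x : sq x = dot x x.
Proof. by rewrite sqE dotE !expr2. Qed.

Variable S : 'M[R]_3.
Hypothesis symS : S^T = S.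

Let B x y := dot x (S *m y).

Lemma form_sym x y : B x y = B y x.
Proof.
have S' i j : S i j = S j i by rewrite -{1}symS mxE.
rewrite /B !dotE !mxE !sum3 (S' (inord 1) (inord 0)) (S' (inord 2) (inord 0)) (S' (inord 2) (inord 1)).
ring.
Qed.

Lemma formDl x y z : B (x + y) z = B x z + B y z.
Proof. exact: dotDl. Qed.

Lemma formZl (c : R) x y : B (c *: x) y = c * B x y.
Proof. exact: dotZl. Qed.

Lemma form_continuous : continuous (fun x => B x x).
Proof.
move=> x; rewrite (_ : (fun _ => _) = fun x => \sum_(i < 3) \sum_(j < 3) x i 0 * (S i j * x j 0)); last first.
  by apply/funext => y; rewrite /B /dot; apply: eq_bigr => i _; rewrite mxE big_distrr.
rewrite (_ : (fun _ => _) = fun x => x (inord 0) 0 * (S (inord 0) (inord 0) * x (inord 0) 0 + S (inord 0) (inord 1) * x (inord 1) 0 + S (inord 0) (inord 2) * x (inord 2) 0) +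
   x (inord 1) 0 * (S (inord 1) (inord 0) * x (inord 0) 0 + S (inord 1) (inord 1) * x (inord 1) 0 + S (inord 1) (inord 2) * x (inord 2) 0) +
   x (inord 2) 0 * (S (inord 2) (inord 0) * x (inord 0) 0 + S (inord 2) (inord 1) * x (inord 1) 0 + S (inord 2) (inord 2) * x (inord 2) 0)); last first.
  by apply/funext => y; rewrite !sum3 !mulrDr.
have cc i : continuous_at x (fun x => x i 0) by exact: coord_continuous.
have cl i : continuous_at x (fun x => S i (inord 0) * x (inord 0) 0 + S i (inord 1) * x (inord 1) 0 + S i (inord 2) * x (inord 2) 0).
  by apply: ctD; [apply: ctD|]; apply: ctZ.
by apply: ctD; [apply: ctD|]; apply: ctM => //; exact: cl.
Qed.

(** A maximum point v of the quadratic form on the unit vectors orthogonal to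
    p: comparing with the normalized vectors v + t w, the term linear in t
    must vanish, and this term is B v w. *)
Lemma form_max p : (exists2 w, sq w = 1 & dot w p = 0) ->
  exists v, [/\ sq v = 1, dot v p = 0 &
    forall w, dot w p = 0 -> dot w v = 0 -> B v w = 0].
Proof.
move=> [w0 w1 w2]; pose K := [set x | sq x = 1 /\ dot x p = 0].
have clK : closed K.
  rewrite (_ : K = [set x | sq x = 1] `&` [set x | dot x p = 0]); last by [].
  apply: closedI.
    apply: (@preimage_closed _ _ (@sq R) [set r | r = 1]); last exact: closed_eq.
    by move=> x _; exact: sq_continuous.
  apply: (@preimage_closed _ _ (fun x => dot x p) [set r | r = 0]); last exact: closed_eq.
  by move=> x _; exact: dot_continuous.
have KM x : K x -> `|x| <= 1.
  by move=> [x1 _]; apply: le_trans (norm_le_enorm x) _; rewrite enorm_sq x1 sqrtr1.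
have [|v [v1 vp] vmax] := EVT_max_cV clK _ KM form_continuous; first by exists w0.
exists v; split => // w wp wv.
have ray (t : R) : B (v + t *: w) (v + t *: w) <= (1 + t ^+ 2 * sq w) * B v v.
  have E : sq (v + t *: w) = 1 + t ^+ 2 * sq w.
    by rewrite sqD v1 sqZ dotC dotZl wv; ring.
  have n0 : 0 < 1 + t ^+ 2 * sq w by have := mulr_ge0 (sqr_ge0 t) (sq_ge0 w); lra.
  pose s := Num.sqrt (1 + t ^+ 2 * sq w).
  have s0 : 0 < s by rewrite sqrtr_gt0.
  have s2 : s ^+ 2 = 1 + t ^+ 2 * sq w by rewrite sqr_sqrtr// ltW.
  have := vmax (s^-1 *: (v + t *: w)).
  rewrite formZl form_sym formZl => /(_ _) H.
  have {H} : s^-1 * (s^-1 * B (v + t *: w) (v + t *: w)) <= B v v.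
    apply: H; split; first by rewrite sqZ E -s2 exprVn mulVf// expf_neq0// gt_eqF.
    by rewrite dotZl dotDl dotZl vp wp; ring.
  by rewrite -s2 ler_pdivrMl// ler_pdivrMl// expr2 mulrA.
have ray2 (t : R) : 2 * t * B v w + t ^+ 2 * B w w <= t ^+ 2 * (sq w * B v v).
  have := ray t; rewrite formDl formZl ![B _ (v + _)]form_sym !formDl !formZl [B w v]form_sym.
  by move: (B v v) (B v w) (B w w) (sq w) => q1 q2 q3 q4; lra.
move: ray2; move: (B v w) (B w w) (_ * B v v) => q r m H.
apply/eqP; rewrite -normr_le0 leNgt; apply/negP => q0.
(* A positive multiple of q small enough for the linear term to dominate. *)
pose c := `|m| + `|r| + 1.
have c0 : 0 < c by rewrite /c; have := normr_ge0 m; have := normr_ge0 r; lra.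
have := H (q / c).
have -> : 2 * (q / c) * q + (q / c) ^+ 2 * r = (q ^+ 2 / c ^+ 2) * (2 * c + r) by field; rewrite gt_eqF.
have -> : (q / c) ^+ 2 * m = (q ^+ 2 / c ^+ 2) * m by field; rewrite gt_eqF.
have k0 : 0 < q ^+ 2 / c ^+ 2.
  by apply: divr_gt0; [rewrite exprn_even_gt0//= -normr_gt0|exact: exprn_gt0].
rewrite ler_pM2l//; apply/negP; rewrite -ltNge.
by rewrite /c; have := normr_ge0 m; have := normr_ge0 r; have := ler_norm m; have := ler_norm (- r); rewrite [`|- r|]normrN; lra.
Qed.

Definition cross a b : V R := vec3
  (a (inord 1) 0 * b (inord 2) 0 - a (inord 2) 0 * b (inord 1) 0,
   a (inord 2) 0 * b (inord 0) 0 - a (inord 0) 0 * b (inord 2) 0,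
   a (inord 0) 0 * b (inord 1) 0 - a (inord 1) 0 * b (inord 0) 0).

Lemma cross_coord a b : [/\ cross a b (inord 0) 0 = a (inord 1) 0 * b (inord 2) 0 - a (inord 2) 0 * b (inord 1) 0,
  cross a b (inord 1) 0 = a (inord 2) 0 * b (inord 0) 0 - a (inord 0) 0 * b (inord 2) 0 &
  cross a b (inord 2) 0 = a (inord 0) 0 * b (inord 1) 0 - a (inord 1) 0 * b (inord 0) 0].
Proof. by split; rewrite !mxE !inordK. Qed.

Lemma crossP a b : [/\ dot (cross a b) a = 0, dot (cross a b) b = 0 &
  sq (cross a b) = sq a * sq b - dot a b ^+ 2].
Proof. by have [e0 e1 e2] := cross_coord a b; split; rewrite ?sqE ?dotE e0 e1 e2; ring. Qed.

Lemma orthogonal_exists v : sq v = 1 -> exists2 w, sq w = 1 & dot w v = 0.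
Proof.
move=> v1; pose w0 : V R := vec3 (- v (inord 1) 0, v (inord 0) 0, 0).
have e : [/\ w0 (inord 0) 0 = - v (inord 1) 0, w0 (inord 1) 0 = v (inord 0) 0 & w0 (inord 2) 0 = 0].
  by split; rewrite !mxE !inordK.
have [e0 e1 e2] := e.
have wv : dot w0 v = 0 by rewrite dotE e0 e1 e2; ring.
have sw : sq w0 = v (inord 1) 0 ^+ 2 + v (inord 0) 0 ^+ 2 by rewrite sqE e0 e1 e2; ring.
have [z|nz] := eqVneq (sq w0) 0.
  have v0 : v (inord 0) 0 = 0.
    apply/eqP; rewrite -sqrf_eq0; move: z; rewrite sw.
    have := sqr_ge0 (v (inord 0) 0); have := sqr_ge0 (v (inord 1) 0) => h1 h2 h.
    by apply/eqP; lra.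
  exists (basis_vec R (inord 0)).
    by rewrite sqE !mxE -!val_eqE /= !inordK//=; ring.
  by rewrite dotE !mxE -!val_eqE /= !inordK//= v0; ring.
have s0 : 0 < sq w0 by rewrite lt_neqAle eq_sym nz sq_ge0.
exists ((Num.sqrt (sq w0))^-1 *: w0).
  by rewrite sqZ exprVn sqr_sqrtr ?ltW// mulVf.
by rewrite dotZl wv mulr0.
Qed.

Definition frame a b c : 'M[R]_3 := \matrix_(i, j) [:: a; b; c]`_j i 0.

Lemma frame_mul a b c x : frame a b c *m x = x (inord 0) 0 *: a + x (inord 1) 0 *: b + x (inord 2) 0 *: c.
Proof.
apply/matrixP => i j; rewrite ord1 {j} !mxE sum3 !mxE !inordK//=; ring.
Qed.

(** The frame consists of a maximum point of the form on the sphere, a maximum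
    point on the great circle orthogonal to it, and their cross product. *)
Lemma rotation_diagonalization : exists (A : 'M[R]_3) (d : 'I_3 -> R),
  is_rotation A /\ forall x, B (A *m x) (A *m x) = \sum_(i < 3) d i * x i 0 ^+ 2.
Proof.
have [|a [a1 _ Ba]] := @form_max 0.
  exists (basis_vec R (inord 0)).
    by rewrite sqE !mxE -!val_eqE /= !inordK//=; ring.
  by rewrite dotE !mxE; ring.
have d0 w : dot w 0 = 0 by rewrite dotE !mxE; ring.
have [b [b1 ba Bb]] := form_max (orthogonal_exists a1).
pose c := cross a b.
have [ca cb cc] := crossP a b.
have c1 : sq c = 1 by rewrite /c cc a1 b1 dotC ba; ring.
have Bab : B a b = 0 by exact: Ba.
have Bac : B a c = 0 by exact: Ba.
have Bbc : B b c = 0 by exact: Bb.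
pose A0 := frame a b c.
have AA : A0^T *m A0 = 1%:M.
  have E i j : (A0^T *m A0) i j = dot [:: a; b; c]`_i [:: a; b; c]`_j.
    by rewrite mxE; apply: eq_bigr => k _; rewrite !mxE.
  apply/matrixP => i j; rewrite E mxE; move: i; apply: all3; move: j; apply: all3;
    rewrite -val_eqE /= !inordK//= -?sq_dot ?a1 ?b1 ?c1// ?ca ?cb ?ba// dotC ?ca ?cb ?ba//.
pose D := \det A0.
have D2 : D ^+ 2 = 1 by have := congr1 determinant AA; rewrite det_mulmx det_tr det1 expr2.
(* The frame may have determinant -1; in odd dimension multiplication by the
   determinant repairs this and leaves quadratic forms unchanged. *)
exists (D *: A0), (fun i => [:: B a a; B b b; B c c]`_i); split.
  split; last by rewrite detZ -/D -[D in _ * D]expr1 -exprD (_ : (3 + 1 = 2 * 2)%N)// exprM D2 expr1n.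
  have DT : (D *: A0)^T = D *: A0^T by apply/matrixP => i j; rewrite !mxE.
  by rewrite DT -scalemxAl -scalemxAr AA scalerA -expr2 D2 scale1r.
move=> x; rewrite -scalemxAl formZl form_sym formZl mulrA -expr2 D2 mul1r frame_mul sum3 !inordK//=.
rewrite !formDl !formZl ![B _ (_ + _)]form_sym !formDl !formZl.
rewrite [B b a]form_sym [B c a]form_sym [B c b]form_sym Bab Bac Bbc.
ring.
Qed.
End Diagonalization.

(** * Half lines of bounded growth *)

Section Rotations.
Variable R : realType.
Implicit Types (x y z b : V R) (A : 'M[R]_3).

Lemma dot_mulmx A b x : dot b (A *m x) = dot (A^T *m b) x.
Proof. by rewrite !dotE !mxE !sum3 !mxE; ring. Qed.

Lemma rotation_enorm A x : is_rotation A -> enorm (A *m x) = enorm x.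
Proof. by move=> [AA _]; rewrite !enorm_sq !sq_dot dot_mulmx mulmxA AA mul1mx. Qed.

Lemma rotation_tr A x : is_rotation A -> A *m (A^T *m x) = x /\ enorm (A^T *m x) = enorm x.
Proof.
move=> rA; have [AA _] := rA.
have E : A *m (A^T *m x) = x by rewrite mulmxA (mulmx1C AA) mul1mx.
by split=> //; rewrite -(rotation_enorm (A^T *m x) rA) E.
Qed.

Lemma vec3_coord x : vec3 (x (inord 0) 0, x (inord 1) 0, x (inord 2) 0) = x.
Proof. by apply/matrixP => i j; rewrite ord1 {j}; move: i; apply: all3; rewrite !mxE !inordK. Qed.

Lemma enorm_le2 y : (forall i, `|y i 0| <= 1) -> enorm y <= 2.
Proof.
move=> y1; rewrite -ler_sqr ?nnegrE ?enorm_ge0// sqr_enorm sqE.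
have c i : y i 0 ^+ 2 <= 1 by rewrite -real_normK ?num_real// exprn_ile1.
by have := c (inord 0); have := c (inord 1); have := c (inord 2); lra.
Qed.

Lemma coord_enorm y i : `|y i 0| <= enorm y.
Proof. by rewrite -sqrtr_sqr ler_wsqrtr// coord_sq_le. Qed.

Lemma sum1 (F : 'I_3 -> R) i : (forall j, j != i -> F j = 0) -> \sum_(j < 3) F j = F i.
Proof. by move=> F0; rewrite (bigD1 i)//= big1 ?addr0// => j /F0. Qed.

Lemma enorm_basis i : enorm (basis_vec R i) = 1.
Proof.
rewrite enorm_sq (_ : sq _ = 1) ?sqrtr1// /sq (sum1 (i := i)) ?mxE ?eqxx ?expr1n//.
by move=> j ji; rewrite mxE (negbTE ji) expr0n.
Qed.

Lemma sqr1_norm (s : R) : s ^+ 2 = 1 -> `|s| = 1.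
Proof. by move=> /eqP; rewrite sqrf_eq1 => /orP[] /eqP ->; rewrite ?normrN normr1. Qed.

End Rotations.

Section Tube.
Variable R : realType.
Implicit Types (x y z : V R).

(** With the sign of s chosen so that s * b i = - |b i|, the growth m t of the
    first term is compensated along the half line by the linear term if |b i|
    >= m, and by the quadratic term if d i < 0. Displacements of length at
    most 2 change the sum by a bounded amount, or by a multiple of t that the
    quadratic term absorbs. *)
Lemma tube (m : R) (d b : 'I_3 -> R) i : 0 <= m ->
  d i < 0 /\ b i = 0 \/ d i = 0 /\ m <= `|b i| ->
  exists (C s : R), s ^+ 2 = 1 /\ forall (t : R) y, 0 <= t -> enorm y <= 2 ->
    m * enorm ((s * t) *: basis_vec R i + y) +
    \sum_(j < 3) (b j * ((s * t) *: basis_vec R i + y) j 0 + d j * ((s * t) *: basis_vec R i + y) j 0 ^+ 2) <= C.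
Proof.
move=> m0 H.
pose s : R := if b i <= 0 then 1 else -1.
have s2 : s ^+ 2 = 1 by rewrite /s; case: ifP => _; rewrite ?sqrrN expr1n.
have sb : s * b i = - `|b i|.
  rewrite /s; case: leP => h; first by rewrite ler0_norm// mul1r opprK.
  by rewrite gtr0_norm// mulN1r.
pose T := \sum_(j < 3) (2 * `|b j| + 4 * `|d j|).
exists (2 * m + T + (if d i < 0 then (m + 4 * `|d i|) ^+ 2 / (4 * `|d i|) else 0)), s; split => // t y t0 y2.
have e1 := enorm_basis R i.
have n1 : enorm ((s * t) *: basis_vec R i + y) <= t + 2.
  apply: le_trans (enormD _ _) _; rewrite enormZ e1 mulr1 normrM (ger0_norm t0).
  have -> := sqr1_norm s2.
  by rewrite mul1r lerD2l.
have yc j : `|y j 0| <= 2 by exact: le_trans (coord_enorm y j) y2.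
have yc2 j : y j 0 ^+ 2 <= 4.
  have -> : (4 : R) = 2 ^+ 2 by rewrite expr2; ring.
  by rewrite -[y j 0 ^+ 2]real_normK ?num_real// lerXn2r// nnegrE.
have T0 j : b j * y j 0 + d j * y j 0 ^+ 2 <= 2 * `|b j| + 4 * `|d j|.
  apply: lerD.
    by apply: le_trans (ler_norm _) _; rewrite normrM mulrC ler_wpM2r.
  apply: le_trans (ler_norm _) _; rewrite normrM mulrC ler_wpM2r// ger0_norm ?sqr_ge0//.
rewrite (_ : \sum_(j < 3) _ = \sum_(j < 3) (b j * y j 0 + d j * y j 0 ^+ 2) +
    (s * t * b i + d i * (t ^+ 2 + 2 * (s * t) * y i 0))); last first.
  rewrite (bigD1 i)//= [in RHS](bigD1 i)//= -[RHS]addrAC; congr (_ + _).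
    rewrite !mxE eqxx /= mulr1.
    have -> : t ^+ 2 = (s * t) ^+ 2 by rewrite exprMn s2 mul1r.
    by move: (s * t) => r; ring.
  by apply: eq_bigr => j ji; rewrite !mxE (negbTE ji) mulr0 add0r.
have ST : \sum_(j < 3) (b j * y j 0 + d j * y j 0 ^+ 2) <= T by apply: ler_sum => j _.
have M1 := ler_wpM2l m0 n1.
suff : s * t * b i + d i * (t ^+ 2 + 2 * (s * t) * y i 0) + m * t <=
    if d i < 0 then (m + 4 * `|d i|) ^+ 2 / (4 * `|d i|) else 0.
  by move: (if _ then _ else _) => c h; lra.
rewrite mulrAC sb; case: H => [[di bi]|[di bi]].
  rewrite di bi normr0 oppr0 mul0r add0r (ltr0_norm di).
  have sy : - (s * y i 0) <= 2.
    apply: le_trans (ler_norm _) _; rewrite normrN normrM.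
    have -> := sqr1_norm s2.
    by rewrite mul1r.
  have e0 : 0 < - d i by rewrite oppr_gt0.
  move: (- d i) e0 (opprK (d i)) => e e0 <-.
  rewrite ler_pdivlMr; last by lra.
  have h : - e * (t ^+ 2 + 2 * (s * t) * y i 0) <= - e * t ^+ 2 + 4 * e * t.
    rewrite (_ : - e * _ = - e * t ^+ 2 + 2 * (e * t) * (- (s * y i 0))); last by ring.
    have et : 0 <= 2 * (e * t) by rewrite !mulr_ge0// ltW.
    have := ler_wpM2l et sy; lra.
  have h2 := ler_wpM2r (_ : 0 <= 4 * e) (lerD h (lexx (m * t))).
  apply: (le_trans (h2 _)); first by lra.
  (* The bound is the maximum over t of (m + 4 e) t - e t^2. *)
  have := sqr_ge0 (2 * e * t - (m + 4 * e)); lra.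
by rewrite di ltxx mul0r addr0; nra.
Qed.

End Tube.

(** * Expansion of the solution at infinity *)

Section Normalization.
Variable R : realType.
Implicit Types (x y z : V R).

(** The translation completes the squares in the directions where the
    quadratic coefficient is nonzero. *)
Lemma normal_form (D : V R -> R) : continuous D -> (forall h k l, diff3 h k l D 0 = 0) ->
  exists (A : 'M[R]_3) (x0 : V R) (d b : 'I_3 -> R) (c : R),
  [/\ is_rotation A, forall i, d i = 0 \/ b i = 0 &
    forall x, D (A *m x + x0) = c + \sum_(i < 3) (b i * x i 0 + d i * x i 0 ^+ 2)].
Proof.
move=> cD D3; have [S [bb [symS DE]]] := frechet cD D3.
have [A [d [rA dE]]] := rotation_diagonalization symS.
pose b' := A^T *m bb.
pose z : V R := \col_i (if d i == 0 then 0 else - (b' i 0 / (2 * d i))).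
exists A, (A *m z), d, (fun i => if d i == 0 then b' i 0 else 0),
  (D 0 + \sum_(i < 3) (b' i 0 * z i 0 + d i * z i 0 ^+ 2)); split=> // [i|x].
  by case: ifPn => [/eqP|_]; [left|right].
rewrite -mulmxDr DE dE dot_mulmx -/b' -addrA /dot -big_split -addrA -big_split; congr (_ + _).
apply: eq_bigr => i _; rewrite /= !mxE.
have [->|d0] := eqVneq (d i) 0; first by ring.
by field.
Qed.

Lemma at_infty_filter : Filter (at_infty R).
Proof.
apply: filter_from_filter; first by exists 0.
move=> M N _ _; exists (Num.max M N) => // x /=.
by rewrite gt_max => /andP[].
Qed.

End Normalization.

Section Solutions.
Variables (R : realType) (q : R) (u : V R -> R).
Hypotheses (q0 : 0 < q) (hu : is_solution q u) (hbeta : (beta q u < +oo)%E).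
Implicit Types (x y z : V R).

Let f y := u y `^ (- q).
Let Cu : Ck 4 u. Proof. by case: hu. Qed.
Let u_gt0 x : 0 < u x. Proof. by case: hu. Qed.
Let u_ge0 x : 0 <= u x. Proof. exact: ltW. Qed.
Let f_ge0 y : 0 <= f y. Proof. exact: powR_ge0. Qed.
Let lapE x : laplacian (laplacian u) x = - f x.
Proof. by case: hu => _ _ /(_ x) h; apply/eqP; rewrite -addr_eq0 h. Qed.
Let lap_le0 x : laplacian (laplacian u) x <= 0. Proof. by rewrite lapE oppr_le0. Qed.

Lemma source_continuous : continuous f.
Proof.
rewrite (_ : f = fun y => - 1 * laplacian (laplacian u) y); last first.
  by apply/funext => y; rewrite lapE mulN1r opprK.
move=> y; apply: ctZ; exact: (Ck_continuous (Ck_laplacian (Ck_laplacian Cu))).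
Qed.

Let pi8 : 0 < 8 * pi :> R. Proof. by have := pi_gt0 R; lra. Qed.

Lemma source_integrable : int3 f.
Proof.
apply/integrableP; split.
  by apply/measurable_EFinP; apply: measurable_continuous_vec3; exact: source_continuous.
rewrite (_ : integral _ _ _ = integral_R3 f); last first.
  by apply: eq_integral => p _ /=; rewrite ger0_norm.
move: hbeta; rewrite /beta; case: (integral_R3 _) => [r| |] //.
  by move=> _; exact: ltry.
by rewrite gt0_muley ?lte_fin ?invr_gt0.
Qed.

Let m := fine (beta q u).

Lemma betaE : m = (8 * pi)^-1 * I3 f.
Proof.
rewrite /m /beta (_ : integral_R3 _ = (I3 f)%:E); first by rewrite -EFinM.
exact: I3_EFin source_integrable.
Qed.

Lemma beta_ge0 : 0 <= m.
Proof. by rewrite betaE mulr_ge0 ?invr_ge0 ?(ltW pi8)// I3_ge0. Qed.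

Let v x := (8 * pi)^-1 * potential f x.

(** The kernels |x - y| and |x - y| - |y| have the same third differences in
    x. *)
Lemma remainder_diff3 h k l : diff3 h k l (fun x => u x - v x) 0 = 0.
Proof.
have ilap : int3 (fun y => laplacian (laplacian u) y).
  rewrite (_ : (fun _ => _) = fun y => - 1 * f y); last by apply/funext => y; rewrite lapE mulN1r.
  exact: int3Z source_integrable.
have H := diff3_representation Cu u_ge0 lap_le0 h k l ilap 0.
rewrite diff3B diff3Z (potential_diff3 source_continuous f_ge0 source_integrable).
have -> : I3 (fun y => f y * diff3 h k l (fun x => enorm (x - y)) 0) =
    - I3 (fun y => laplacian (laplacian u) y * diff3 h k l (fun x => enorm (x - y)) 0).
  have i : int3 (fun y => laplacian (laplacian u) y * diff3 h k l (fun x => enorm (x - y)) 0).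
    have [i1 _] := diff3_I3 h k l 0 (int3_potential source_continuous f_ge0 source_integrable).
    rewrite (_ : (fun _ => _) = fun y => - 1 * diff3 h k l (fun x => f y * (enorm (x - y) - enorm y)) 0).
      exact: int3Z.
    by apply/funext => y; rewrite lapE diff3Z diff3B diff3_cst; ring.
  rewrite -mulN1r -(I3Z _ i); congr I3; apply/funext => y; rewrite lapE; ring.
by rewrite -H mulrA mulVf ?gt_eqF// mul1r subrr.
Qed.

Lemma remainder_continuous : continuous (fun x => u x - v x).
Proof.
move=> x; apply: ctB; first exact: (Ck_continuous Cu).
by apply: ctZ; exact: (potential_continuous source_continuous f_ge0 source_integrable).
Qed.

Lemma v_le x : v x <= m * enorm x.
Proof.
rewrite betaE -mulrA /v ler_wpM2l ?invr_ge0 ?(ltW pi8)//.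
exact: (potential_le source_continuous f_ge0 source_integrable).
Qed.

Lemma v_asymptotic (eps : R) : 0 < eps ->
  exists2 C : R, 0 <= C & forall x, `|v x - m * enorm x| <= C + eps * enorm x.
Proof.
move=> eps0; have f_tail := tail_cvg0 source_continuous f_ge0 source_integrable.
have e0 : 0 < eps * (8 * pi) / 2 by rewrite divr_gt0// mulr_gt0.
move/cvgrPdist_le: f_tail => /(_ _ e0)[n _ /(_ n (leqnn n)) Hn].
rewrite /= sub0r normrN in Hn.
have I0 : 0 <= I3 f by exact: I3_ge0.
exists ((8 * pi)^-1 * (4 * n.+1%:R * I3 f)).
  by apply: mulr_ge0; [rewrite invr_ge0 ltW|apply: mulr_ge0 => //; apply: mulr_ge0].
move=> x; have i8 : 0 <= (8 * pi)^-1 :> R by rewrite invr_ge0 ltW.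
rewrite betaE -[_ * I3 f * _]mulrA /v -mulrBr normrM (ger0_norm i8).
rewrite ler_pdivrMl// [leRHS]mulrDr mulrA divff ?gt_eqF// mul1r.
apply: le_trans (potential_asymptotic source_continuous f_ge0 source_integrable n x) _.
rewrite lerD2l mulrA; apply: ler_wpM2r; first exact: enorm_ge0.
by have := ler_norm (tail f n); move: Hn; rewrite ler_pdivlMr//; lra.
Qed.

(** Otherwise [tube] and [v_le] bound u above by a constant along a half line,
    up to distance 2; then [f] is bounded below by a positive constant on
    boxes that run off to infinity, and its tails do not tend to zero. *)
Lemma tube_excluded (A : 'M[R]_3) x0 (d b : 'I_3 -> R) (c : R) : is_rotation A ->
  (forall x, u (A *m x + x0) - v (A *m x + x0) = c + \sum_(i < 3) (b i * x i 0 + d i * x i 0 ^+ 2)) ->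
  forall i, d i = 0 \/ b i = 0 -> 0 < d i \/ d i = 0 /\ `|b i| < m.
Proof.
move=> rA DE i dbi.
have [//|di] := ltP 0 (d i); first by left.
have [[d0 bm]|bad] := pselect (d i = 0 /\ `|b i| < m); first by right.
exfalso.
have {}bad : d i < 0 /\ b i = 0 \/ d i = 0 /\ m <= `|b i|.
  move: di; rewrite le_eqVlt => /orP[/eqP d0|d0].
    by right; split => //; rewrite leNgt; apply/negP => bm; apply: bad.
  by left; split => //; case: dbi => // d0'; rewrite d0' ltxx in d0.
have [C [s [s2 HC]]] := tube beta_ge0 bad.
pose C' := `|C + c + m * enorm x0| + 1.
have C'0 : 0 < C' by rewrite /C'; have := normr_ge0 (C + c + m * enorm x0); lra.
have ub (t : R) y : 0 <= t -> enorm y <= 2 -> u (A *m ((s * t) *: basis_vec R i + y) + x0) <= C'.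
  move=> t0 y2; have := HC t y t0 y2.
  move: (_ + y) => w; have := DE w; have := v_le (A *m w + x0).
  have := ler_wpM2l beta_ge0 (enormD (A *m w) x0); rewrite (rotation_enorm _ rA).
  by rewrite /C'; have := ler_norm (C + c + m * enorm x0); lra.
pose c0 := C' `^ (- q).
have c00 : 0 < c0 by exact: powR_gt0.
have lb n : 8 * c0 <= tail f n.
  pose t : R := 2 * n.+1%:R + enorm x0 + 2.
  have t0 : 0 <= t by have := enorm_ge0 x0; have := ler0n R n.+1; rewrite /t; lra.
  pose p := A *m ((s * t) *: basis_vec R i) + x0.
  apply: (tail_box source_continuous f_ge0 source_integrable
    (p := (p (inord 0) 0, p (inord 1) 0, p (inord 2) 0))); first exact: ltW.
  rewrite vec3_coord => z zp.
  have z2 : enorm (z - p) <= 2 by apply: enorm_le2 => j; rewrite [(z - p) j 0]mxE [(- p) j 0]mxE; exact: zp.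
  have [Ew nw] := rotation_tr (z - p) rA.
  have Ez : z = A *m ((s * t) *: basis_vec R i + A^T *m (z - p)) + x0.
    by rewrite mulmxDr Ew addrAC -/p addrC subrK.
  have uz : u z <= C' by rewrite Ez; apply: ub; rewrite ?nw.
  split.
    rewrite /f /c0 !powRN lef_pV2 ?posrE ?powR_gt0//.
    by apply: ge0_ler_powR; rewrite ?nnegrE ?(ltW q0) ?(ltW C'0)//; exact: u_ge0.
  apply: far_eq1.
  have pt : enorm p >= t - enorm x0.
    have := enormD p (- x0); rewrite enormN addrK (rotation_enorm _ rA) enormZ.
    by rewrite enorm_basis mulr1 normrM (sqr1_norm s2) mul1r (ger0_norm t0); lra.
  have := enorm_le_dist p z; rewrite enorm_distC; rewrite /t in pt; rewrite ler_norml => /andP[_ h].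
  lra.
have f_tail := tail_cvg0 source_continuous f_ge0 source_integrable.
move/cvgrPdist_le: f_tail => /(_ _ c00)[n _ /(_ n (leqnn n))] /=.
rewrite sub0r normrN; have := lb n; have := ler_norm (tail f n); lra.
Qed.

Lemma v_shifted_cvg (A : 'M[R]_3) x0 (c : R) : is_rotation A ->
  ((v (A *m x + x0) + c) / enorm x - m) @[x --> at_infty R] --> 0.
Proof.
move=> rA; apply/(@cvgrPdist_le _ _ _ _ (at_infty_filter R)) => eps eps0.
have e2 : 0 < eps / 2 by lra.
have [C C0 HC] := v_asymptotic e2.
pose K := C + (m + eps / 2) * enorm x0 + `|c|.
have K0 : 0 <= K.
  have := mulr_ge0 (addr_ge0 beta_ge0 (ltW e2)) (enorm_ge0 x0).
  by have := normr_ge0 c; rewrite /K; lra.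
exists (2 * K / eps) => // x /= xK; rewrite sub0r normrN.
have ex : 0 < enorm x by apply: le_lt_trans xK; apply: divr_ge0; [exact: mulr_ge0|exact: ltW].
have xne : enorm x != 0 by rewrite gt_eqF.
rewrite (_ : _ - m = (v (A *m x + x0) + c - m * enorm x) / enorm x); last by field.
rewrite normrM normfV (gtr0_norm ex) ler_pdivrMr//.
have h1 := HC (A *m x + x0).
have h2 : `|enorm (A *m x + x0) - enorm x| <= enorm x0.
  by have := enorm_le_dist (A *m x + x0) (A *m x); rewrite (rotation_enorm _ rA) addrAC subrr add0r.
have h3 : `|m * (enorm (A *m x + x0) - enorm x)| <= m * enorm x0.
  by rewrite normrM (ger0_norm beta_ge0) ler_wpM2l// beta_ge0.
have h4 : eps / 2 * enorm (A *m x + x0) <= eps / 2 * enorm x + eps / 2 * enorm x0.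
  by rewrite -mulrDr; apply: ler_wpM2l; [exact: ltW|move: h2; rewrite ler_norml; lra].
have h5 : 2 * K <= eps * enorm x by move: xK; rewrite ltr_pdivrMr// [enorm x * _]mulrC => /ltW.
rewrite (_ : _ - _ = (v (A *m x + x0) - m * enorm (A *m x + x0)) +
  m * (enorm (A *m x + x0) - enorm x) + c); last by ring.
apply: le_trans (ler_normD _ _) _; apply: le_trans (lerD (ler_normD _ _) (lexx _)) _.
rewrite /K in h5; lra.
Qed.

Lemma solution_expansion :
  exists (A : 'M[R]_3) (x0 : V R) (I1 I2 : {set 'I_3}) (a b : 'I_3 -> R) (c : R) (o1 : V R -> R),
    [/\ is_rotation A, [disjoint I1 & I2]%B, forall i, i \in I1 -> 0 < a i,
        forall i, i \in I2 -> `|b i| < m &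
        [/\ 0 < c, o1 x @[x --> at_infty R] --> (0 : R) &
            \forall x \near at_infty R, u (A *m x + x0) = (m + o1 x) * enorm x
                + \sum_(i in I1) a i * x i 0 ^+ 2 + \sum_(i in I2) b i * x i 0 + c]].
Proof.
have [A [x0 [d [b [c [rA db DE]]]]]] := normal_form remainder_continuous remainder_diff3.
have alt i := tube_excluded rA DE (db i).
pose I1 : {set 'I_3} := finset (fun i => 0 < d i).
(* Any constant is o(|x|): c is replaced by 1 at the expense of the
   remainder. *)
exists A, x0, I1, (~: I1), d, b, 1, (fun x => (v (A *m x + x0) + (c - 1)) / enorm x - m).
split => //.
- by rewrite -finset.setI_eq0 finset.setICr.
- by move=> i; rewrite inE.
- move=> i; rewrite !inE => /negbTE di; case: (alt i) => [|[]//].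
  by rewrite di.
split; [by []|exact: v_shifted_cvg|].
exists 0 => // x /= x0'; have xne : enorm x != 0 by rewrite gt_eqF.
have -> : u (A *m x + x0) = v (A *m x + x0) + (c + \sum_(i < 3) (b i * x i 0 + d i * x i 0 ^+ 2)).
  by rewrite -DE; ring.
have -> : \sum_(i < 3) (b i * x i 0 + d i * x i 0 ^+ 2) =
    \sum_(i in I1) d i * x i 0 ^+ 2 + \sum_(i in ~: I1) b i * x i 0.
  rewrite (bigID (fun i => i \in I1))/=; congr (_ + _).
    apply: eq_bigr => i; rewrite inE => di; case: (db i) => [d0|->]; last by rewrite mul0r add0r.
    by rewrite d0 ltxx in di.
  rewrite [RHS](eq_bigl (fun i => i \notin I1)); last by move=> i; rewrite inE.
  apply: eq_bigr => i; rewrite inE => di; case: (alt i) => [d0|[d0 _]]; first by rewrite d0 in di.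
  by rewrite d0 mul0r addr0.
by move: (v _) (\sum_(i in ~: I1) _) (\sum_(i in I1) _) => w s1 s2; field.
Qed.
End Solutions.

Theorem theorem1p1 (R : realType) (q : R) (hq : 1 < q) (u : 'cV[R]_3 -> R)
    (hu : is_solution q u) (hbeta : (beta q u < +oo)%E) :
  exists (A : 'M[R]_3) (x0 : 'cV[R]_3) (I1 I2 : {set 'I_3})
         (a b : 'I_3 -> R) (c : R) (o1 : 'cV[R]_3 -> R),
    [/\ is_rotation A,
        [disjoint I1 & I2]%B,
        forall i, i \in I1 -> 0 < a i,
        forall i, i \in I2 -> `|b i| < fine (beta q u) &
        [/\ 0 < c,
            o1 x @[x --> at_infty R] --> (0 : R) &
            \forall x \near at_infty R,
              u (A *m x + x0) =
                (fine (beta q u) + o1 x) * enorm x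
                + \sum_(i in I1) a i * x i 0 ^+ 2
                + \sum_(i in I2) b i * x i 0 + c]].
Proof. exact: (solution_expansion (lt_trans ltr01 hq) hu hbeta). Qed.
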